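(* Let $\omega=(\omega(n))_{n\ge 0}$ be a weight sequence. If $$\sum_{n\ge 1}\frac{(\log \omega(n))^2}{n^{2}}=\infty,$$ then every function in $H^\infty$ without zeros in $\mathbb{D}$ is cyclic in $\mathcal{A}^{2}_{\omega}$.
   Context: $\mathbb{D}$ is the open unit disk in $\mathbb{C}$ and $H^\infty$ is the space of bounded analytic functions on $\mathbb{D}$. A sequence of positive numbers $\omega=(\omega(n))_{n\ge 0}$ is called a weight sequence if it is nondecreasing with $\omega(n)\to+\infty$, and $\log\omega(n)=o(n)$ as $n\to\infty$. For a weight sequence $\omega$, $\mathcal{A}^2_\omega$ is the space of all analytic functions $f(z)=\sum_{n=0}^\infty a_nz^n$ on $\mathbb{D}$ such that $\|f\|_{\omega,2}^2=\sum_{n\ge 0}\frac{|a_n|^2}{\omega(n)^2}<\infty$. A function $f\in\mathcal{A}^2_\omega$ is cyclic in $\mathcal{A}^2_\omega$ if the set $\{pf: p \text{ a polynomial}\}$ is dense in $\mathcal{A}^2_\omega$. *)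

(* Defs.v *)
From Stdlib Require Export Reals.
From Coquelicot Require Export Coquelicot.
Open Scope R_scope.

(* Functions on the unit disk are represented by total functions [C -> C];
   every definition below depends only on their values on [disk]. *)
Definition disk (z : C) : Prop := Cmod z < 1.

Definition is_power_series_at (a : nat -> C) (z0 z w : C) : Prop :=
  @is_pseries C_AbsRing C_NormedModule a (z - z0)%C w.

Definition analytic_on_disk (f : C -> C) : Prop :=
  forall z0 : C, disk z0 ->
    exists (r : R) (a : nat -> C), 0 < r /\
      forall z : C, Cmod (z - z0)%C < r -> disk z ->
        is_power_series_at a z0 z (f z).

Definition in_Hinf (f : C -> C) : Prop :=
  analytic_on_disk f /\
  exists M : R, forall z : C, disk z -> Cmod (f z) <= M.

Definition weight_sequence (omega : nat -> R) : Prop :=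
  (forall n : nat, 0 < omega n) /\
  (forall m n : nat, (m <= n)%nat -> omega m <= omega n) /\
  is_lim_seq omega p_infty /\
  is_lim_seq (fun n : nat => ln (omega n) / INR n) 0.

(* [f] is the sum of the power series with coefficients [a] at [0],
   which converges on the whole disk. *)
Definition taylor_on_disk (a : nat -> C) (f : C -> C) : Prop :=
  forall z : C, disk z -> is_power_series_at a (RtoC 0) z (f z).

(* [f] belongs to the weighted space and its norm there is [N].  This is a
   relation because [Series] has a junk value on divergent series; the
   coefficients [a] are determined by the values of [f] on [disk]. *)
Definition is_A2_norm (omega : nat -> R) (f : C -> C) (N : R) : Prop :=
  0 <= N /\
  exists a : nat -> C, taylor_on_disk a f /\
    is_series (fun n : nat => (Cmod (a n)) ^ 2 / (omega n) ^ 2) (N ^ 2).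

Definition in_A2 (omega : nat -> R) (f : C -> C) : Prop :=
  exists a : nat -> C, taylor_on_disk a f /\
    ex_series (fun n : nat => (Cmod (a n)) ^ 2 / (omega n) ^ 2).

Definition dense_in_A2 (omega : nat -> R) (S : (C -> C) -> Prop) : Prop :=
  (forall h : C -> C, S h -> in_A2 omega h) /\
  forall g : C -> C, in_A2 omega g -> forall eps : R, 0 < eps ->
    exists h : C -> C, S h /\
      exists N : R, is_A2_norm omega (fun z => h z - g z)%C N /\ N < eps.

Definition is_polynomial (p : C -> C) : Prop :=
  exists (d : nat) (c : nat -> C),
    forall z : C, p z = sum_n (fun k : nat => (c k * z ^ k)%C) d.

Definition polynomial_multiple (f h : C -> C) : Prop :=
  exists p : C -> C, is_polynomial p /\
    forall z : C, disk z -> h z = (p z * f z)%C.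

Definition cyclic_in_A2 (omega : nat -> R) (f : C -> C) : Prop :=
  in_A2 omega f /\ dense_in_A2 omega (polynomial_multiple f).

(* Main.v *)
Require Import Defs.
From Stdlib Require Import Reals Lra Lia Psatz ClassicalEpsilon.
From Coquelicot Require Import Coquelicot.
Open Scope R_scope.

(** Write [n] for a large integer and let [f = exp G] be bounded by 1 and zero-free, so
that [Re G <= 0].  For [t > 0] the function [exp (- t G)] is analytic, and if [h] is its
Taylor polynomial of degree below [n], then [exp (t G) * h = 1 + E] where [E] vanishes
to order [n] at 0.  By Harnack's inequality [|exp (- t G z)| <= exp (t kappa / (1 - |z|))],
so the Cauchy estimates on the circle of radius [1 - lam / n] give
[|h| <= n * exp (3 lam)] on the disk as soon as [t kappa n <= lam ^ 2]
([polynomial_inverse_mod_zn]).  A bounded analytic function with a zero of order [n]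
has norm at most its supremum divided by [omega n] ([A2_bound_vanishing]), so that the
power [exp (t G)] of [f] is inverted by a polynomial up to an error of size
[n * exp (3 lam) / omega n].

One such step disposes only of a small power [t] of [f].  Beurling's device is to do it
along the dyadic scales [n = 2 ^ j] and to multiply the results.  Let
[L j = ln (omega (2 ^ j))] and let [d] be its increment into the scale [j].  With
[lam = d / 12] the product of the suprema up to the scale [j] stays below
[exp ((L j - L J0) / 2)], because the increments telescope, whereas the weight is
[exp (L j)]: the errors are summable and their total is of order [exp (- L J0 / 2)]
([approximate_inverse]).  Scales with [d < 4 (j + 1)] are skipped, which absorbs the
factor [n].  The powers used add up to a multiple of the sum of the [d ^ 2 / 2 ^ j], and
this sum diverges: by a discrete Hardy inequality ([energy_le_gains]) it controls the sum
of the [L j ^ 2 / 2 ^ j], which by dyadic condensation ([dyadic_sum]) controls the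
divergent sum of the [(ln (omega n)) ^ 2 / n ^ 2].  Hence the powers can be made to add up
to exactly 1, and a polynomial multiple of [f] comes arbitrarily close to the constant 1
([approximates_one]).  Since the shift is a contraction, multiplication by a fixed
polynomial is bounded; the polynomial multiples of [f] therefore approach every
polynomial, and polynomials are dense.

The function theory behind this rests on means over circles, [circle_mean].  Cauchy's
formula is obtained by contracting a circle to a point ([cauchy_transport]); it gives
every holomorphic function a power series on the whole disk ([holo_taylor]), which in turn
yields the logarithm [G] as a primitive of [f' / f] ([holo_log]).  Bessel's inequality
for the circle gives the square summability of the coefficients of bounded functions. *)

(** * Limits and derivatives of complex functions in terms of the modulus *)

Lemma series_eps (a : nat -> C) (l : C) :
  @is_series C_AbsRing C_NormedModule a l <->
  forall eps, 0 < eps -> exists N, forall n, (N <= n)%nat ->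
    Cmod (sum_n a n - l)%C < eps.
Proof.
  unfold is_series. split.
  - intros H eps He.
    apply (proj1 (filterlim_locally_ball_norm (U:=C_NormedModule) _ _)) with (eps := mkposreal eps He) in H.
    destruct H as [N HN]. exists N. intros n Hn. exact (HN n Hn).
  - intros H.
    apply (proj2 (filterlim_locally_ball_norm (U:=C_NormedModule) _ _)). intros eps.
    destruct (H eps (cond_pos eps)) as [N HN]. exists N. intros n Hn. exact (HN n Hn).
Qed.

Definition Cder (f : C -> C) (z l : C) : Prop :=
  @is_derive C_AbsRing (AbsRing_NormedModule C_AbsRing) f z l.

Lemma Cder_eps (f : C -> C) (z l : C) :
  Cder f z l <->
  forall eps, 0 < eps -> exists d, 0 < d /\ forall w, Cmod (w - z)%C < d ->
    Cmod (f w - f z - l * (w - z))%C <= eps * Cmod (w - z)%C.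
Proof.
  unfold Cder, is_derive, filterdiff. split.
  - intros [_ H] eps He.
    specialize (H z (fun P HP => HP) (mkposreal eps He)).
    destruct (locally_norm_le_locally (V:=AbsRing_NormedModule C_AbsRing) _ _ H) as [d Hd].
    exists d; split; [apply cond_pos|]. intros w Hw.
    specialize (Hd w Hw).
    change (Cmod ((f w + - f z) + - ((w + - z) * l))%C <= eps * Cmod (w - z)%C) in Hd.
    replace (f w - f z - l * (w - z))%C with ((f w + - f z) + - ((w + - z) * l))%C by ring.
    exact Hd.
  - intros H. split. apply is_linear_scal_l.
    intros x Hx.
    assert (E : z = x) by exact (is_filter_lim_locally_unique (V:=AbsRing_NormedModule C_AbsRing) z x Hx).
    subst x.
    intros eps.
    destruct (H eps (cond_pos eps)) as [d [Hd H1]].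
    apply (locally_le_locally_norm (V:=AbsRing_NormedModule C_AbsRing)).
    exists (mkposreal d Hd). intros w Hw. specialize (H1 w Hw).
    change (Cmod ((f w + - f z) + - ((w + - z) * l))%C <= eps * Cmod (w - z)%C).
    replace ((f w + - f z) + - ((w + - z) * l))%C with (f w - f z - l * (w - z))%C by ring.
    exact H1.
Qed.

(** The metric on the target is the modulus, with respect to which [Cder] is defined, and not
    the product structure of [R * R] to which [C] defaults. *)
Definition Ccont {U : UniformSpace} (f : U -> C) (x : U) : Prop :=
  continuous (f : U -> AbsRing_UniformSpace C_AbsRing) x.

Lemma Ccont_eps (f : C -> C) (z : C) :
  @Ccont (AbsRing_UniformSpace C_AbsRing) f z <->
  forall eps, 0 < eps -> exists d, 0 < d /\ forall w, Cmod (w - z)%C < d ->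
    Cmod (f w - f z)%C < eps.
Proof.
  unfold Ccont, continuous. split.
  - intros H eps He.
    apply (proj1 (filterlim_locally _ _)) with (eps := mkposreal eps He) in H.
    destruct H as [d Hd].
    exists d; split; [apply cond_pos|]. intros w Hw. exact (Hd w Hw).
  - intros H. apply filterlim_locally. intros eps.
    destruct (H eps (cond_pos eps)) as [d [Hd H1]].
    exists (mkposreal d Hd). intros w Hw. exact (H1 w Hw).
Qed.

Lemma Cder_const (c z : C) : Cder (fun _ => c) z (RtoC 0).
Proof. exact (@is_derive_const C_AbsRing (AbsRing_NormedModule C_AbsRing) c z). Qed.

Lemma Cder_id (z : C) : Cder (fun w => w) z (RtoC 1).
Proof. exact (@is_derive_id C_AbsRing z). Qed.

Lemma Cder_plus f g z a b : Cder f z a -> Cder g z b ->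
  Cder (fun w => f w + g w)%C z (a + b)%C.
Proof. exact (@is_derive_plus C_AbsRing (AbsRing_NormedModule C_AbsRing) f g z a b). Qed.

Lemma Cder_mult f g z a b : Cder f z a -> Cder g z b ->
  Cder (fun w => f w * g w)%C z (a * g z + f z * b)%C.
Proof. intros H1 H2. exact (@is_derive_mult C_AbsRing f g z a b H1 H2 Cmult_comm). Qed.

(** The derivative appears as [b * a], inner factor first, which is the order of [scal] in the
    general chain rule. *)
Lemma Cder_comp f g z a b : Cder f (g z) a -> Cder g z b ->
  Cder (fun w => f (g w)) z (b * a)%C.
Proof. exact (@is_derive_comp C_AbsRing (AbsRing_NormedModule C_AbsRing) f g z a b). Qed.

Lemma Cder_eq f z a b : Cder f z a -> a = b -> Cder f z b.
Proof. now intros H <-. Qed.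

Lemma Cder_scal c f z a : Cder f z a -> Cder (fun w => c * f w)%C z (c * a)%C.
Proof.
  intros H. eapply Cder_eq. apply (Cder_mult (fun _ => c) f z _ _ (Cder_const c z) H). ring.
Qed.

Lemma Cder_minus f g z a b : Cder f z a -> Cder g z b ->
  Cder (fun w => f w - g w)%C z (a - b)%C.
Proof. exact (@is_derive_minus C_AbsRing (AbsRing_NormedModule C_AbsRing) f g z a b). Qed.

Lemma Cder_local f g z a r : 0 < r ->
  (forall w, Cmod (w - z)%C < r -> f w = g w) -> Cder f z a -> Cder g z a.
Proof.
  intros Hr H. rewrite !Cder_eps. intros Hf eps He.
  destruct (Hf eps He) as [d [Hd H1]]. exists (Rmin d r). split. now apply Rmin_pos.
  intros w Hw. rewrite <- !H. apply H1.
  eapply Rlt_le_trans; [exact Hw|apply Rmin_l].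
  replace (z - z)%C with (RtoC 0) by ring. now rewrite Cmod_0.
  eapply Rlt_le_trans; [exact Hw|apply Rmin_r].
Qed.

Lemma Cder_cont f z a : Cder f z a -> @Ccont (AbsRing_UniformSpace C_AbsRing) f z.
Proof.
  intros H. apply (@ex_derive_continuous C_AbsRing (AbsRing_NormedModule C_AbsRing) f z).
  now exists a.
Qed.

Lemma Cmod_minus_sym (a b : C) : Cmod (a - b)%C = Cmod (b - a)%C.
Proof. rewrite <- Cmod_opp. f_equal. ring. Qed.

Lemma Cmod_triangle_minus (a b : C) : Cmod (a - b)%C <= Cmod a + Cmod b.
Proof. unfold Cminus. rewrite <- (Cmod_opp b). apply Cmod_triangle. Qed.

Lemma Cmod_triangle_rev (a b : C) : Cmod a - Cmod b <= Cmod (a - b)%C.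
Proof.
  replace a with ((a - b) + b)%C at 1 by ring.
  pose proof (Cmod_triangle (a - b) b)%C. lra.
Qed.

Lemma Cder_inv (z : C) : z <> RtoC 0 -> Cder (fun w => / w)%C z (- / (z * z))%C.
Proof.
  intros Hz. apply Cder_eps. intros eps He.
  assert (Hm : 0 < Cmod z) by now apply Cmod_gt_0.
  exists (Rmin (Cmod z / 2) (eps * Cmod z ^ 3 / 2)). split.
  { apply Rmin_pos; [lra|]. pose proof (pow_lt _ 3 Hm). nra. }
  intros w Hw.
  assert (H1 : Cmod (w - z)%C < Cmod z / 2) by (eapply Rlt_le_trans; [exact Hw|apply Rmin_l]).
  assert (H2 : Cmod (w - z)%C < eps * Cmod z ^ 3 / 2) by (eapply Rlt_le_trans; [exact Hw|apply Rmin_r]).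
  assert (H3 : Cmod z / 2 < Cmod w).
  { pose proof (Cmod_triangle_rev z w). rewrite Cmod_minus_sym in H. lra. }
  assert (Hw0 : w <> RtoC 0) by (apply Cmod_gt_0; lra).
  replace (/ w - / z - - / (z * z) * (w - z))%C with ((w - z) * (w - z) / (w * (z * z)))%C
    by (field; auto).
  rewrite Cmod_div, !Cmod_mult by (repeat apply Cmult_neq_0; auto).
  set (m := Cmod (w - z)%C) in *. set (x := Cmod z) in *. set (y := Cmod w) in *.
  assert (0 <= m) by apply Cmod_ge_0.
  apply (Rmult_le_reg_r (y * (x * x))). apply Rmult_lt_0_compat; nra.
  unfold Rdiv. rewrite Rmult_assoc, Rinv_l by (apply Rgt_not_eq; apply Rmult_lt_0_compat; nra).
  assert (eps * x ^ 3 / 2 <= eps * (y * (x * x))).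
  { replace (eps * x ^ 3 / 2) with (eps * (x * x) * (x / 2)) by field.
    replace (eps * (y * (x * x))) with (eps * (x * x) * y) by ring.
    apply Rmult_le_compat_l. apply Rmult_le_pos; nra. lra. }
  nra.
Qed.

(** * The complex exponential *)

Definition cexp (z : C) : C := (exp (Re z) * cos (Im z), exp (Re z) * sin (Im z)).

Lemma cexp_add (z w : C) : cexp (z + w)%C = (cexp z * cexp w)%C.
Proof.
  destruct z as [a b], w as [c d]. unfold cexp, Cmult, Cplus; simpl.
  rewrite exp_plus, cos_plus, sin_plus. f_equal; ring.
Qed.

Lemma cexp_0 : cexp 0 = 1.
Proof. unfold cexp; simpl. rewrite exp_0, cos_0, sin_0. unfold RtoC. f_equal; ring. Qed.

Lemma cexp_RtoC (x : R) : cexp x = exp x.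
Proof. unfold cexp; simpl. rewrite cos_0, sin_0. unfold RtoC. f_equal; ring. Qed.

Lemma Cmod_cexp (z : C) : Cmod (cexp z) = exp (Re z).
Proof.
  unfold Cmod, cexp; simpl fst; simpl snd.
  replace ((exp (Re z) * cos (Im z)) ^ 2 + (exp (Re z) * sin (Im z)) ^ 2) with (exp (Re z) ^ 2 *
    (Rsqr (sin (Im z)) + Rsqr (cos (Im z)))) by (unfold Rsqr; ring).
  rewrite sin2_cos2, Rmult_1_r. apply sqrt_pow2. left; apply exp_pos.
Qed.

Lemma cexp_neq0 (z : C) : cexp z <> RtoC 0.
Proof. apply Cmod_gt_0. rewrite Cmod_cexp. apply exp_pos. Qed.

Lemma Im_le_Cmod (z : C) : Rabs (Im z) <= Cmod z.
Proof. eapply Rle_trans; [apply Rmax_r|apply (Rmax_Cmod z)]. Qed.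

Lemma Cmod_le_Re_Im (z : C) : Cmod z <= Rabs (Re z) + Rabs (Im z).
Proof.
  replace z with ((Re z : C) + Ci * (Im z : C))%C at 1 by (destruct z; unfold Ci, Cmult, Cplus,
    RtoC; simpl; f_equal; ring).
  eapply Rle_trans; [apply Cmod_triangle|]. rewrite Cmod_mult, Cmod_Ci, !Cmod_R. lra.
Qed.

Lemma is_derive_eps (f : R -> R) (x l : R) : is_derive f x l <->
  forall eps, 0 < eps -> exists d, 0 < d /\ forall y, Rabs (y - x) < d ->
    Rabs (f y - f x - l * (y - x)) <= eps * Rabs (y - x).
Proof.
  rewrite is_derive_Reals. unfold derivable_pt_lim. split.
  - intros H eps He. destruct (H eps He) as [d Hd].
    exists d; split; [apply cond_pos|]. intros y Hy.
    destruct (Req_dec (y - x) 0) as [E|E].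
    + replace y with x by lra. replace (f x - f x - l * (x - x)) with 0 by ring.
      replace (x - x) with 0 by ring. rewrite Rabs_R0; lra.
    + specialize (Hd (y - x) E Hy). replace (x + (y - x)) with y in Hd by ring.
      replace (f y - f x - l * (y - x)) with (((f y - f x) / (y - x) - l) * (y - x)) by (field; lra).
      rewrite Rabs_mult. apply Rmult_le_compat_r. apply Rabs_pos. lra.
  - intros H eps He. destruct (H (eps/2)) as [d [Hd H1]]. lra.
    exists (mkposreal d Hd). simpl. intros h Hh Hhd.
    specialize (H1 (x + h)). replace (x + h - x) with h in H1 by ring.
    specialize (H1 Hhd).
    replace ((f (x + h) - f x) / h - l) with ((f (x + h) - f x - l * h) / h) by (field; lra).
    unfold Rdiv. rewrite Rabs_mult, Rabs_inv.
    assert (0 < Rabs h) by now apply Rabs_pos_lt.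
    apply (Rmult_lt_reg_r (Rabs h)); auto. rewrite Rmult_assoc, Rinv_l; nra.
Qed.

(** Writing [z = x + i y], the error [cexp z - 1 - z] splits into terms each of which contains
    one of [exp x - 1 - x], [cos y - 1], [sin y - y], all of which are little-o at 0. *)
Lemma Cder_cexp0 : Cder cexp 0 1.
Proof.
  apply Cder_eps. intros eps He.
  assert (Hexp : is_derive exp 0 1) by (apply is_derive_Reals; rewrite <- exp_0; apply derivable_pt_lim_exp).
  assert (Hcos : is_derive cos 0 0).
  { apply is_derive_Reals. generalize (derivable_pt_lim_cos 0). now rewrite sin_0, Ropp_0. }
  assert (Hsin : is_derive sin 0 1).
  { apply is_derive_Reals. generalize (derivable_pt_lim_sin 0). now rewrite cos_0. }
  set (e := Rmin 1 (eps / 12)).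
  assert (He' : 0 < e <= 1) by (split; [apply Rmin_pos; lra| apply Rmin_l]).
  assert (He'' : 12 * e <= eps) by (pose proof (Rmin_r 1 (eps/12)); unfold e; lra).
  destruct (proj1 (is_derive_eps _ _ _) Hexp e) as [d1 [Hd1 H1]]. lra.
  destruct (proj1 (is_derive_eps _ _ _) Hcos e) as [d2 [Hd2 H2]]. lra.
  destruct (proj1 (is_derive_eps _ _ _) Hsin e) as [d3 [Hd3 H3]]. lra.
  exists (Rmin (Rmin d1 d2) (Rmin d3 e)). split. repeat apply Rmin_pos; lra.
  intros w Hw. rewrite cexp_0. replace (w - 0)%C with w in * by ring.
  assert (Hwm : Cmod w < d1 /\ Cmod w < d2 /\ Cmod w < d3 /\ Cmod w < e).
  { pose proof (Rmin_l (Rmin d1 d2) (Rmin d3 e)). pose proof (Rmin_r (Rmin d1 d2) (Rmin d3 e)).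
    pose proof (Rmin_l d1 d2). pose proof (Rmin_r d1 d2). pose proof (Rmin_l d3 e).
    pose proof (Rmin_r d3 e). lra. }
  pose proof (re_le_Cmod w) as Hr. pose proof (Im_le_Cmod w) as Hi.
  set (m := Cmod w) in *. unfold cexp.
  set (x := Re w) in *. set (y := Im w) in *.
  assert (Hx : Rabs (exp x - 1 - x) <= e * m).
  { generalize (H1 x). rewrite exp_0, Rminus_0_r.
    replace (exp x - 1 - 1 * x) with (exp x - 1 - x) by ring. intros Q.
    eapply Rle_trans. apply Q; lra. apply Rmult_le_compat_l; lra. }
  assert (Hc : Rabs (cos y - 1) <= e * m).
  { generalize (H2 y). rewrite cos_0, Rminus_0_r.
    replace (cos y - 1 - 0 * y) with (cos y - 1) by ring. intros Q.
    eapply Rle_trans. apply Q; lra. apply Rmult_le_compat_l; lra. }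
  assert (Hs : Rabs (sin y - y) <= e * m).
  { generalize (H3 y). rewrite sin_0, Rminus_0_r.
    replace (sin y - 0 - 1 * y) with (sin y - y) by ring. intros Q.
    eapply Rle_trans. apply Q; lra. apply Rmult_le_compat_l; lra. }
  assert (Hm : 0 <= m) by apply Cmod_ge_0.
  eapply Rle_trans. apply Cmod_le_Re_Im.
  replace (Re _) with ((exp x - 1 - x) + (exp x - 1 - x + x + 1) * (cos y - 1)) by (unfold x,
    y; destruct w; simpl; ring).
  replace (Im _) with ((exp x - 1 - x + x + 1) * (sin y - y) + (exp x - 1 - x + x) * y) by (unfold
    x, y; destruct w; simpl; ring).
  revert Hx Hc Hs Hr Hi. generalize (exp x - 1 - x) (cos y - 1) (sin y - y).
  intros A B D Hx Hc Hs Hr Hi.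
  assert (HA : Rabs (A + x + 1) <= 3).
  { eapply Rle_trans; [apply Rabs_triang|]. rewrite Rabs_R1. pose proof (Rabs_triang A x). nra. }
  assert (HA2 : Rabs (A + x) <= 2 * e).
  { pose proof (Rabs_triang A x). nra. }
  assert (Rabs (A + (A + x + 1) * B) <= 4 * e * m).
  { eapply Rle_trans; [apply Rabs_triang|]. rewrite Rabs_mult.
    pose proof (Rabs_pos B). pose proof (Rabs_pos (A+x+1)). nra. }
  assert (Rabs ((A + x + 1) * D + (A + x) * y) <= 5 * e * m).
  { eapply Rle_trans; [apply Rabs_triang|]. rewrite !Rabs_mult.
    pose proof (Rabs_pos D). pose proof (Rabs_pos (A+x+1)). pose proof (Rabs_pos y).
    pose proof (Rabs_pos (A+x)).
    assert (Rabs (A+x+1) * Rabs D <= 3 * (e * m)) by (apply Rmult_le_compat; lra).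
    assert (Rabs (A+x) * Rabs y <= 2 * e * m) by (apply Rmult_le_compat; lra). lra. }
  assert (e * m * 12 <= eps * m) by nra. nra.
Qed.

Lemma Cder_cexp (z : C) : Cder cexp z (cexp z).
Proof.
  assert (H : Cder (fun w => cexp z * cexp (w - z))%C z (cexp z)).
  { eapply Cder_eq. apply Cder_scal. apply (Cder_comp cexp (fun w => w - z)%C z (RtoC 1) (RtoC 1)).
    replace (z - z)%C with (RtoC 0) by ring. apply Cder_cexp0.
    eapply Cder_eq. apply Cder_minus. apply Cder_id. apply Cder_const. ring. ring. }
  revert H. apply Cder_local with 1. lra. intros w _. rewrite <- cexp_add. f_equal. ring.
Qed.

(** Every real curve used later is the restriction of a complex differentiable map to the real
    axis, so this passage to real derivatives replaces a chain rule for curves. *)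
Lemma Cder_Re (F : C -> C) (s : R) (l : C) : Cder F s l ->
  is_derive (fun x : R => Re (F x)) s (Re l).
Proof.
  rewrite Cder_eps. intros H. apply is_derive_eps. intros eps He.
  destruct (H eps He) as [d [Hd H1]]. exists d; split; auto. intros y Hy.
  specialize (H1 (RtoC y)). rewrite <- RtoC_minus, Cmod_R in H1. specialize (H1 Hy).
  eapply Rle_trans; [|exact H1].
  eapply Rle_trans; [|apply re_le_Cmod]. right. f_equal.
  destruct (F y), (F s), l; simpl. ring.
Qed.

Lemma Cder_Im (F : C -> C) (s : R) (l : C) : Cder F s l ->
  is_derive (fun x : R => Im (F x)) s (Im l).
Proof.
  rewrite Cder_eps. intros H. apply is_derive_eps. intros eps He.
  destruct (H eps He) as [d [Hd H1]]. exists d; split; auto. intros y Hy.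
  specialize (H1 (RtoC y)). rewrite <- RtoC_minus, Cmod_R in H1. specialize (H1 Hy).
  eapply Rle_trans; [|exact H1].
  eapply Rle_trans; [|apply Im_le_Cmod]. right. f_equal.
  destruct (F y), (F s), l; simpl. ring.
Qed.

(** * Continuity of complex-valued maps *)

Lemma Ccont_const {U : UniformSpace} (c : C) (x : U) : Ccont (fun _ => c) x.
Proof. apply continuous_const. Qed.

Lemma Ccont_plus {U : UniformSpace} (f g : U -> C) (x : U) :
  Ccont f x -> Ccont g x -> Ccont (fun y => f y + g y)%C x.
Proof. exact (@continuous_plus U C_AbsRing (AbsRing_NormedModule C_AbsRing) f g x). Qed.

Lemma Ccont_minus {U : UniformSpace} (f g : U -> C) (x : U) :
  Ccont f x -> Ccont g x -> Ccont (fun y => f y - g y)%C x.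
Proof. exact (@continuous_minus U C_AbsRing (AbsRing_NormedModule C_AbsRing) f g x). Qed.

Lemma Ccont_mult {U : UniformSpace} (f g : U -> C) (x : U) :
  Ccont f x -> Ccont g x -> Ccont (fun y => f y * g y)%C x.
Proof. exact (@continuous_mult U C_AbsRing f g x). Qed.

Lemma Ccont_comp {U : UniformSpace} (g : U -> C) (f : C -> C) (x : U) :
  Ccont g x -> @Ccont (AbsRing_UniformSpace C_AbsRing) f (g x) -> Ccont (fun y => f (g y)) x.
Proof.
exact (@continuous_comp U (AbsRing_UniformSpace C_AbsRing) (AbsRing_UniformSpace C_AbsRing) g f x).
Qed.

Lemma Ccont_lip_R {U : UniformSpace} (g : U -> C) (h : C -> R) (x : U) :
  (forall a b, Rabs (h a - h b) <= Cmod (a - b)%C) -> Ccont g x ->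
  continuous (fun y => h (g y) : R_UniformSpace) x.
Proof.
  intros Hh Hg. apply filterlim_locally. intros eps.
  assert (Hg' := proj1 (filterlim_locally (U:=AbsRing_UniformSpace C_AbsRing) _ _) Hg eps).
  revert Hg'. apply filter_imp. intros y Hy.
  apply Rle_lt_trans with (2 := Hy). apply Hh.
Qed.

Lemma Ccont_Re {U : UniformSpace} (g : U -> C) (x : U) : Ccont g x ->
  continuous (fun y => Re (g y) : R_UniformSpace) x.
Proof.
  apply Ccont_lip_R. intros a b.
  replace (Re a - Re b) with (Re (a - b)%C) by (destruct a, b; simpl; ring).
  apply re_le_Cmod.
Qed.

Lemma Ccont_Im {U : UniformSpace} (g : U -> C) (x : U) : Ccont g x ->
  continuous (fun y => Im (g y) : R_UniformSpace) x.
Proof.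
  apply Ccont_lip_R. intros a b.
  replace (Im a - Im b) with (Im (a - b)%C) by (destruct a, b; simpl; ring).
  apply Im_le_Cmod.
Qed.

Lemma Ccont_lip {U : UniformSpace} (g : U -> C) (h : C -> C) (x : U) :
  (forall a b, Cmod (h a - h b)%C <= Cmod (a - b)%C) -> Ccont g x ->
  Ccont (fun y => h (g y)) x.
Proof.
  intros Hh Hg. apply (filterlim_locally (U:=AbsRing_UniformSpace C_AbsRing)). intros eps.
  assert (Hg' := proj1 (filterlim_locally (U:=AbsRing_UniformSpace C_AbsRing) _ _) Hg eps).
  revert Hg'. apply filter_imp. intros y Hy.
  apply Rle_lt_trans with (2 := Hy). apply Hh.
Qed.

Lemma Ccont_conj {U : UniformSpace} (g : U -> C) (x : U) : Ccont g x -> Ccont (fun y => Cconj (g y)) x.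
Proof.
  apply Ccont_lip. intros a b. right.
  rewrite <- (Cmod_conj (a - b)). f_equal. destruct a, b; unfold Cconj, Cminus, Cplus, Copp; simpl.
  f_equal; ring.
Qed.

Lemma Ccont_Cmod {U : UniformSpace} (g : U -> C) (x : U) : Ccont g x -> Ccont (fun y => Cmod (g y) : C) x.
Proof.
  apply (Ccont_lip g (fun c => Cmod c : C)). intros a b. rewrite <- RtoC_minus, Cmod_R.
  apply Rabs_le. split.
  pose proof (Cmod_triangle_rev b a). rewrite Cmod_minus_sym in H. lra.
  apply Cmod_triangle_rev.
Qed.

Lemma Ccont_RtoC {U : UniformSpace} (g : U -> R) (x : U) :
  continuous (g : U -> R_UniformSpace) x -> Ccont (fun y => g y : C) x.
Proof.
  intros Hg. apply (filterlim_locally (U:=AbsRing_UniformSpace C_AbsRing)). intros eps.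
  assert (Hg' := proj1 (filterlim_locally (U:=R_UniformSpace) _ _) Hg eps).
  revert Hg'. apply filter_imp. intros y Hy.
  change (Cmod (g y - g x)%C < eps). rewrite <- RtoC_minus, Cmod_R. exact Hy.
Qed.

Definition cts (phi : R -> C) : Prop := forall t : R, @Ccont R_UniformSpace phi t.

Lemma cts_const c : cts (fun _ => c).
Proof. intros t. apply Ccont_const. Qed.
Lemma cts_plus f g : cts f -> cts g -> cts (fun t => f t + g t)%C.
Proof. intros H1 H2 t. now apply Ccont_plus. Qed.
Lemma cts_minus f g : cts f -> cts g -> cts (fun t => f t - g t)%C.
Proof. intros H1 H2 t. now apply Ccont_minus. Qed.
Lemma cts_mult f g : cts f -> cts g -> cts (fun t => f t * g t)%C.
Proof. intros H1 H2 t. now apply Ccont_mult. Qed.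
Lemma cts_conj f : cts f -> cts (fun t => Cconj (f t)).
Proof. intros H1 t. now apply Ccont_conj. Qed.
Lemma cts_Cmod f : cts f -> cts (fun t => Cmod (f t) : C).
Proof. intros H1 t. now apply Ccont_Cmod. Qed.
Lemma cts_pow f n : cts f -> cts (fun t => f t ^ n)%C.
Proof. intros H1. induction n; simpl. apply cts_const. now apply cts_mult. Qed.
Lemma cts_comp g f : cts g -> (forall t, @Ccont (AbsRing_UniformSpace C_AbsRing) f (g t)) ->
  cts (fun t => f (g t)).
Proof. intros H1 H2 t. now apply Ccont_comp. Qed.

(** * Means over the circle *)

(** Taking components reduces linearity and differentiation under the integral sign to the real
    integral. *)
Definition circle_mean (phi : R -> C) : C :=
  (RInt (fun t => Re (phi t)) 0 (2 * PI) / (2 * PI), RInt (fun t => Im (phi t)) 0 (2 * PI) / (2 * PI)).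

Lemma cts_ex_Re phi a b : cts phi -> ex_RInt (fun t => Re (phi t)) a b.
Proof. intros H. apply (@ex_RInt_continuous R_CompleteNormedModule). intros t _. now apply Ccont_Re.
Qed.
Lemma cts_ex_Im phi a b : cts phi -> ex_RInt (fun t => Im (phi t)) a b.
Proof. intros H. apply (@ex_RInt_continuous R_CompleteNormedModule). intros t _. now apply Ccont_Im.
Qed.

Lemma two_PI_pos : 0 < 2 * PI.
Proof. pose proof PI_RGT_0. lra. Qed.

Lemma circle_mean_ext f g : (forall t, f t = g t) -> circle_mean f = circle_mean g.
Proof. intros H. unfold circle_mean. f_equal; f_equal; apply RInt_ext; intros; now rewrite H. Qed.

Lemma circle_mean_plus f g : cts f -> cts g ->
  circle_mean (fun t => f t + g t)%C = (circle_mean f + circle_mean g)%C.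
Proof.
  intros Hf Hg. pose proof two_PI_pos. unfold circle_mean, Cplus; simpl fst; simpl snd.
  f_equal.
  - rewrite <- Rdiv_plus_distr. f_equal.
    exact (@RInt_plus R_CompleteNormedModule (fun t => Re (f t)) (fun t => Re (g t)) 0 (2*PI)
      (cts_ex_Re _ _ _ Hf) (cts_ex_Re _ _ _ Hg)).
  - rewrite <- Rdiv_plus_distr. f_equal.
    exact (@RInt_plus R_CompleteNormedModule (fun t => Im (f t)) (fun t => Im (g t)) 0 (2*PI)
      (cts_ex_Im _ _ _ Hf) (cts_ex_Im _ _ _ Hg)).
Qed.

Lemma RInt_lin f g (a b u v : R) : ex_RInt f a b -> ex_RInt g a b ->
  RInt (fun t => u * f t + v * g t) a b = u * RInt f a b + v * RInt g a b.
Proof.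
  intros Hf Hg.
  assert (H1 := @RInt_scal R_CompleteNormedModule f a b u Hf).
  assert (H2 := @RInt_scal R_CompleteNormedModule g a b v Hg).
  assert (H3 := @RInt_plus R_CompleteNormedModule _ _ a b (@ex_RInt_scal R_NormedModule f a b u Hf)
    (@ex_RInt_scal R_NormedModule g a b v Hg)).
  exact (eq_trans H3 (f_equal2 Rplus H1 H2)).
Qed.

Lemma circle_mean_scal c f : cts f -> circle_mean (fun t => c * f t)%C = (c * circle_mean f)%C.
Proof.
  intros Hf. pose proof two_PI_pos. destruct c as [a b].
  unfold circle_mean, Cmult; simpl fst; simpl snd.
  f_equal.
  - rewrite (RInt_ext _ (fun t => a * Re (f t) + (- b) * Im (f t))).
    rewrite (RInt_lin (fun t => Re (f t)) (fun t => Im (f t)) 0 (2*PI) a (-b) (cts_ex_Re _ _ _ Hf)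
      (cts_ex_Im _ _ _ Hf)). field; lra.
    intros t _. unfold Re, Im; simpl. ring.
  - rewrite (RInt_ext _ (fun t => a * Im (f t) + b * Re (f t))).
    rewrite (RInt_lin (fun t => Im (f t)) (fun t => Re (f t)) 0 (2*PI) a b (cts_ex_Im _ _ _ Hf)
      (cts_ex_Re _ _ _ Hf)). field; lra.
    intros t _. unfold Re, Im; simpl. ring.
Qed.

Lemma circle_mean_minus f g : cts f -> cts g ->
  circle_mean (fun t => f t - g t)%C = (circle_mean f - circle_mean g)%C.
Proof.
  intros Hf Hg.
  replace (circle_mean f - circle_mean g)%C with (circle_mean f + (- (1)) * circle_mean g)%C by ring.
  rewrite <- circle_mean_scal, <- circle_mean_plus; auto. apply circle_mean_ext. intros t. ring.
  apply cts_mult; auto. apply cts_const.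
Qed.

Lemma circle_mean_const c : circle_mean (fun _ => c) = c.
Proof.
  pose proof two_PI_pos. unfold circle_mean. rewrite !RInt_const. destruct c as [a b].
  unfold scal; simpl; unfold mult; simpl. f_equal; field; lra.
Qed.

Lemma circle_mean_conj f : cts f -> circle_mean (fun t => Cconj (f t)) = Cconj (circle_mean f).
Proof.
  intros Hf. pose proof two_PI_pos. unfold circle_mean, Cconj; simpl. f_equal.
  rewrite (RInt_ext _ (fun t => 0 * Re (f t) + (-1) * Im (f t))).
  rewrite (RInt_lin (fun t => Re (f t)) (fun t => Im (f t)) 0 (2*PI) 0 (-1) (cts_ex_Re _ _ _ Hf)
    (cts_ex_Im _ _ _ Hf)). unfold Im. field. lra.
  intros t _. unfold Re, Im; simpl. ring.
Qed.

Lemma circle_mean_Re_le f g : cts f -> cts g -> (forall t, Re (f t) <= Re (g t)) ->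
  Re (circle_mean f) <= Re (circle_mean g).
Proof.
  intros Hf Hg H. pose proof two_PI_pos. unfold circle_mean; simpl. apply Rmult_le_compat_r.
  left; apply Rinv_0_lt_compat; lra.
  apply RInt_le; auto. lra. now apply cts_ex_Re. now apply cts_ex_Re.
Qed.

(** After multiplication by a unimodular constant the mean of [f] is a nonnegative real, so it
    equals the mean of a real part, and real parts can be compared pointwise. Comparison with
    the mean of [g] rather than with a constant is what the estimate on the coefficients of [G]
    requires. *)
Lemma circle_mean_bound f g : cts f -> cts g -> (forall t, Cmod (f t) <= Re (g t)) ->
  Cmod (circle_mean f) <= Re (circle_mean g).
Proof.
  intros Hf Hg H.
  destruct (Req_dec (Cmod (circle_mean f)) 0) as [E|E].
  - rewrite E. change 0 with (Re (RtoC 0)). rewrite <- (circle_mean_const 0).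
    apply circle_mean_Re_le; auto. apply cts_const.
    intros t. simpl. eapply Rle_trans; [apply Cmod_ge_0|apply H].
  - set (m := Cmod (circle_mean f)) in *.
    assert (0 < m) by (pose proof (Cmod_ge_0 (circle_mean f)); fold m in H0; lra).
    set (u := (Cconj (circle_mean f) / m)%C).
    assert (Hu : Cmod u = 1).
    { unfold u. rewrite Cmod_div, Cmod_conj, Cmod_R. fold m. rewrite Rabs_pos_eq by lra. field; lra.
      intros Q; apply RtoC_inj in Q; lra. }
    assert (Hm : (u * circle_mean f)%C = m).
    { unfold u.
      replace (Cconj (circle_mean f) / m * circle_mean f)%C with ((circle_mean f * Cconj
        (circle_mean f)) / m)%C by (field; intros Q; apply RtoC_inj in Q; lra).
      rewrite <- Cmod2_conj. fold m. rewrite RtoC_pow. field. intros Q; apply RtoC_inj in Q; lra. }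
    replace m with (Re (u * circle_mean f)) by now rewrite Hm.
    rewrite <- circle_mean_scal by auto. apply circle_mean_Re_le; auto.
    apply cts_mult; auto; apply cts_const.
    intros t. eapply Rle_trans; [|apply H]. eapply Rle_trans; [apply Rle_abs|].
    eapply Rle_trans; [apply re_le_Cmod|]. rewrite Cmod_mult, Hu. lra.
Qed.

Lemma circle_mean_bound_const f M : cts f -> (forall t, Cmod (f t) <= M) -> Cmod (circle_mean f) <= M.
Proof.
  intros Hf H. replace M with (Re (circle_mean (fun _ => RtoC M))) by now rewrite circle_mean_const.
  apply circle_mean_bound; auto. apply cts_const.
Qed.

(** The fundamental theorem of calculus along a closed curve: it gives both the orthogonality of
    characters and the vanishing of the derivative in [cauchy_transport]. *)
Lemma circle_mean_deriv_periodic (F F' : C -> C) :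
  (forall t : R, Cder F t (F' t)) -> cts (fun t : R => F' t) ->
  F (2 * PI) = F 0 -> circle_mean (fun t => F' t) = 0.
Proof.
  intros HF HF' Hp. unfold circle_mean.
  assert (H1 := fun D Cc => is_RInt_unique _ _ _ _ (@is_RInt_derive R_CompleteNormedModule (fun t :
    R => Re (F t)) (fun t : R => Re (F' t)) 0 (2*PI) D Cc)).
  assert (H2 := fun D Cc => is_RInt_unique _ _ _ _ (@is_RInt_derive R_CompleteNormedModule (fun t :
    R => Im (F t)) (fun t : R => Im (F' t)) 0 (2*PI) D Cc)).
  rewrite H1, H2. rewrite Hp. unfold minus, plus, opp; simpl.
  unfold RtoC. f_equal; field; pose proof PI_RGT_0; lra.
  intros; now apply Cder_Im. intros; now apply Ccont_Im.
  intros; now apply Cder_Re. intros; now apply Ccont_Re.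
Qed.

Definition cis (t : R) : C := cexp (Ci * t).

Lemma cis_cs t : cis t = (cos t, sin t).
Proof. unfold cis, cexp, Ci, Cmult; simpl. replace (0 * t - 1 * 0) with 0 by ring. rewrite exp_0.
f_equal; [rewrite Rmult_1_l|rewrite Rmult_1_l]; f_equal; ring. Qed.

Lemma Cmod_cis t : Cmod (cis t) = 1.
Proof. unfold cis. rewrite Cmod_cexp. simpl. replace (0 * t - 1 * 0) with 0 by ring. apply exp_0.
Qed.

Lemma cis_conj t : (cis t * Cconj (cis t) = 1)%C.
Proof. rewrite <- Cmod2_conj, Cmod_cis. f_equal. ring. Qed.

Lemma cis_neq0 t : cis t <> 0.
Proof. apply cexp_neq0. Qed.

Lemma cts_RtoC : cts (fun t => t).
Proof. intros t. apply Ccont_RtoC. apply continuous_id. Qed.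

Lemma Cder_cont_cexp z : @Ccont (AbsRing_UniformSpace C_AbsRing) cexp z.
Proof. eapply Cder_cont. apply Cder_cexp. Qed.

Lemma cts_cis : cts cis.
Proof.
  apply (cts_comp (fun t => Ci * t)%C cexp). apply cts_mult. apply cts_const. apply cts_RtoC.
  intros t. apply Cder_cont_cexp.
Qed.

Lemma cexp_pow z n : (cexp z ^ n = cexp (INR n * z))%C.
Proof.
  induction n. simpl. now rewrite Cmult_0_l, cexp_0.
  rewrite Cpow_S, IHn, <- cexp_add, S_INR. f_equal. rewrite RtoC_plus. ring.
Qed.

Lemma circle_mean_cis_pow n : (0 < n)%nat -> circle_mean (fun t => cis t ^ n)%C = 0.
Proof.
  intros Hn. assert (Hn' : RtoC (INR n) <> 0).
  { intros Q; apply RtoC_inj in Q. apply (not_0_INR n); lia || auto. }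
  rewrite <- (circle_mean_deriv_periodic (fun w => / (INR n * Ci) * cexp (INR n * Ci * w))%C (fun w
    => cexp (INR n * Ci * w))%C).
  - apply circle_mean_ext. intros t. unfold cis. rewrite cexp_pow. f_equal. ring.
  - intros t. eapply Cder_eq. apply Cder_scal. apply (Cder_comp cexp (fun w => INR n * Ci * w)%C).
    apply Cder_cexp. apply Cder_scal. apply Cder_id. field. split; auto. apply Ci_nz.
  - apply (cts_comp (fun t => INR n * Ci * t)%C cexp). apply cts_mult. apply cts_const.
    apply cts_RtoC.
    intros t. apply Cder_cont_cexp.
  - f_equal. replace (INR n * Ci * 0)%C with (RtoC 0) by ring. rewrite cexp_0.
    replace (INR n * Ci * RtoC (2 * PI)%R)%C with (INR n * (Ci * RtoC (2 * PI)%R))%C by ring.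
    rewrite <- cexp_pow. change (cexp (Ci * RtoC (2 * PI)%R)) with (cis (2*PI)).
    rewrite cis_cs, cos_2PI, sin_2PI. apply Cpow_1_l.
Qed.

Lemma circle_mean_cis_ortho l k :
  circle_mean (fun t => cis t ^ l * Cconj (cis t) ^ k)%C = if Nat.eqb l k then 1 else 0.
Proof.
  destruct (Nat.eqb_spec l k) as [->|Hlk].
  - rewrite (circle_mean_ext _ (fun _ => RtoC 1)). apply circle_mean_const. intros t.
    now rewrite <- Cpow_mult_l, cis_conj, Cpow_1_l.
  - destruct (Nat.lt_ge_cases l k).
    + rewrite (circle_mean_ext _ (fun t => Cconj (cis t ^ (k - l)))%C).
      rewrite circle_mean_conj, circle_mean_cis_pow by (try lia; apply cts_pow, cts_cis).
      unfold Cconj, RtoC; simpl. f_equal; ring.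
      intros t. replace k with (l + (k - l))%nat at 1 by lia.
      rewrite Cpow_add_r, Cmult_assoc, <- Cpow_mult_l, cis_conj, Cpow_1_l, Cpow_conj. ring.
    + rewrite <- (circle_mean_cis_pow (l - k)) by lia. apply circle_mean_ext. intros t.
      replace l with ((l - k) + k)%nat at 1 by lia.
      rewrite Cpow_add_r, <- Cmult_assoc, <- Cpow_mult_l, cis_conj, Cpow_1_l. ring.
Qed.

(** Continuity is decided by the syntactic shape of the integrand; unification against the
    closure lemmas would unfold the complex operations. *)
Ltac solve_cts :=
  lazymatch goal with
  | H : cts ?f |- cts ?f => exact H
  | |- cts cis => exact cts_cis
  | |- cts (fun t => cis t) => exact cts_cis
  | |- cts (fun _ => ?c) => exact (cts_const c)
  | |- cts (fun t => Cmult (@?f t) (@?g t)) => apply (cts_mult f g); solve_cts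
  | |- cts (fun t => Cplus (@?f t) (@?g t)) => apply (cts_plus f g); solve_cts
  | |- cts (fun t => Cminus (@?f t) (@?g t)) => apply (cts_minus f g); solve_cts
  | |- cts (fun t => Cconj (@?f t)) => apply (cts_conj f); solve_cts
  | |- cts (fun t => Cpow (@?f t) ?n) => apply (cts_pow f n); solve_cts
  | |- cts (fun t => ?f t) => change (cts f); solve_cts
  | |- _ => auto
  end.

(** * Power series *)

(** Summing over the indices strictly below [n] makes the empty sum available, and lets a
    polynomial of degree below [n] be a partial sum of length [n]. *)
Fixpoint psum (a : nat -> C) (z : C) (n : nat) : C :=
  match n with O => RtoC 0 | S n => (psum a z n + a n * z ^ n)%C end.

Definition Clim (u : nat -> C) (l : C) : Prop :=
  forall eps, 0 < eps -> exists N, forall n, (N <= n)%nat -> Cmod (u n - l)%C < eps.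

Definition expands_on (R : R) (a : nat -> C) (F : C -> C) : Prop :=
  forall z, Cmod z < R -> Clim (psum a z) (F z).

Lemma pow_le_1 x n : 0 <= x <= 1 -> x ^ n <= 1.
Proof. intros H. rewrite <- (pow1 n). apply pow_incr. exact H. Qed.

Lemma pow_n_Cpow (z : C) n : @pow_n C_AbsRing z n = (z ^ n)%C.
Proof. induction n; simpl; auto; now rewrite IHn. Qed.

Lemma sum_n_psum a (z : C) n :
  @sum_n C_NormedModule (fun k => @scal C_AbsRing C_NormedModule (@pow_n C_AbsRing z k) (a k)) n =
    psum a z (S n).
Proof.
  induction n.
  - rewrite sum_O. rewrite pow_n_Cpow. simpl. change (1 * a 0%nat = 0 + a 0%nat * 1)%C. ring.
  - rewrite sum_Sn, IHn, pow_n_Cpow.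
    change (psum a z (S n) + (z ^ S n * a (S n)) = psum a z (S n) + a (S n) * z ^ S n)%C.
    now rewrite (Cmult_comm (a (S n))).
Qed.

Lemma power_series_at_iff a z0 z w :
  is_power_series_at a z0 z w <-> Clim (psum a (z - z0)%C) w.
Proof.
  unfold is_power_series_at, is_pseries. rewrite series_eps. unfold Clim.
  split; intros H eps He; destruct (H eps He) as [N HN].
  - exists (S N). intros [|n] Hn. lia. specialize (HN n). rewrite sum_n_psum in HN. apply HN. lia.
  - exists N. intros n Hn. rewrite sum_n_psum. apply HN. lia.
Qed.

Lemma taylor_iff a F : taylor_on_disk a F <-> expands_on 1 a F.
Proof.
  unfold taylor_on_disk, expands_on, disk. split; intros H z Hz; specialize (H z Hz); revert H;
  rewrite power_series_at_iff; now replace (z - 0)%C with z by ring.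
Qed.

Lemma Clim_bound u l c B n0 : Clim u l -> (forall n, (n0 <= n)%nat -> Cmod (u n - c)%C <= B) ->
  Cmod (l - c)%C <= B.
Proof.
  intros H Hb. apply le_epsilon. intros eps He.
  destruct (H eps He) as [N HN]. specialize (HN (max N n0) ltac:(lia)).
  specialize (Hb (max N n0) ltac:(lia)).
  replace (l - c)%C with ((u (max N n0) - c) - (u (max N n0) - l))%C by ring.
  eapply Rle_trans; [apply Cmod_triangle_minus|]. lra.
Qed.

Lemma Clim_unique u l l' : Clim u l -> Clim u l' -> l = l'.
Proof.
  intros H H'. apply Ceq_minus. apply Cmod_eq_0. apply Rle_antisym; [|apply Cmod_ge_0].
  apply le_epsilon. intros eps He. rewrite Rplus_0_l. destruct (H' eps He) as [N HN].
  apply (Clim_bound u l l' eps N H). intros n Hn. left. now apply HN.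
Qed.

Lemma finite_bound (u : nat -> R) n : exists M, 0 < M /\ forall k, (k < n)%nat -> u k <= M.
Proof.
  induction n. exists 1. split. lra. intros; lia.
  destruct IHn as [M [HM H]]. exists (Rmax M (u n)). split.
  eapply Rlt_le_trans; [exact HM|apply Rmax_l].
  intros k Hk. destruct (Nat.eq_dec k n) as [->|]. apply Rmax_r.
  eapply Rle_trans; [apply H; lia|apply Rmax_l].
Qed.

Definition geom_bounded (a : nat -> C) (s : R) := exists M, 0 < M /\ forall k, Cmod (a k) * s ^ k <= M.

(** The terms of a convergent series are bounded. *)
Lemma expands_geom_bounded R a F s : expands_on R a F -> 0 <= s < R -> geom_bounded a s.
Proof.
  intros H Hs. assert (Hsz : Cmod (RtoC s) < R) by (rewrite Cmod_R, Rabs_pos_eq; lra).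
  destruct (H s Hsz 1 ltac:(lra)) as [N HN].
  destruct (finite_bound (fun k => Cmod (a k) * s ^ k) N) as [M [HM H1]].
  exists (M + 2). split. lra. intros k. destruct (Nat.lt_ge_cases k N) as [Hk|Hk].
  specialize (H1 k Hk). simpl in H1. lra.
  pose proof (HN k Hk) as A1. pose proof (HN (S k) ltac:(lia)) as A2. simpl psum in A2.
  replace (Cmod (a k) * s ^ k) with (Cmod (a k * s ^ k)%C).
  replace (a k * s ^ k)%C with ((psum a s k + a k * s ^ k - F s) - (psum a s k - F s))%C by ring.
  eapply Rle_trans; [apply Cmod_triangle_minus|]. lra.
  rewrite Cmod_mult, Cmod_pow, Cmod_R, Rabs_pos_eq; lra.
Qed.

Lemma Rpow_div_l (x y : R) n : (x / y) ^ n = x ^ n / y ^ n.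
Proof. unfold Rdiv. now rewrite Rpow_mult_distr, pow_inv. Qed.

Lemma psum_tail a t M z n m : 0 < t -> (forall k, Cmod (a k) * t ^ k <= M) -> Cmod z < t -> (n <= m)%nat ->
  Cmod (psum a z m - psum a z n)%C <= M * (Cmod z / t) ^ n / (1 - Cmod z / t).
Proof.
  intros Ht HM Hz Hnm. set (q := Cmod z / t).
  assert (Hq : 0 <= q < 1).
  { unfold q. split. apply Rle_mult_inv_pos. apply Cmod_ge_0. lra.
    apply (Rmult_lt_reg_r t); auto. unfold Rdiv. rewrite Rmult_assoc, Rinv_l; lra. }
  assert (HM0 : 0 <= M) by (specialize (HM 0%nat); simpl in HM; pose proof (Cmod_ge_0 (a 0%nat)); lra).
  assert (Hterm : forall k, Cmod (a k * z ^ k)%C <= M * q ^ k).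
  { intros k. rewrite Cmod_mult, Cmod_pow. unfold q. rewrite Rpow_div_l.
    replace (Cmod (a k) * Cmod z ^ k) with (Cmod (a k) * t ^ k * (Cmod z ^ k / t ^ k)) by (field;
      apply pow_nonzero; lra).
    apply Rmult_le_compat_r; auto. apply Rle_mult_inv_pos. apply pow_le, Cmod_ge_0.
    now apply pow_lt. }
  assert (Cmod (psum a z m - psum a z n)%C <= M * (q ^ n - q ^ m) / (1 - q)).
  { induction Hnm.
    - replace (psum a z n - psum a z n)%C with (RtoC 0) by ring. rewrite Cmod_0. right. field. lra.
    - simpl psum.
      replace (psum a z m + a m * z ^ m - psum a z n)%C with ((psum a z m - psum a z n) + a m * z ^
        m)%C by ring.
      eapply Rle_trans; [apply Cmod_triangle|]. specialize (Hterm m).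
      replace (M * (q ^ n - q ^ S m) / (1 - q)) with (M * (q ^ n - q ^ m) / (1 - q) + M * q ^ m) by
        (simpl; field; lra).
      lra. }
  eapply Rle_trans; [exact H|]. apply Rmult_le_compat_r. left; apply Rinv_0_lt_compat; lra.
  apply Rmult_le_compat_l; auto. pose proof (pow_le q m (proj1 Hq)). lra.
Qed.

Lemma expands_tail R a F t M z n : expands_on R a F -> 0 < t ->
  (forall k, Cmod (a k) * t ^ k <= M) -> Cmod z < t -> Cmod z < R ->
  Cmod (F z - psum a z n)%C <= M * (Cmod z / t) ^ n / (1 - Cmod z / t).
Proof.
  intros H Ht HM Hz HR. apply (Clim_bound (psum a z) _ _ _ n). now apply H.
  intros m Hm. now apply psum_tail.
Qed.

Lemma geometric_eventually_small q A eps : 0 <= q < 1 -> 0 < eps ->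
  exists N, forall n, (N <= n)%nat -> A * q ^ n < eps.
Proof.
  intros Hq He. destruct (Rle_lt_dec A 0) as [HA|HA].
  - exists 0%nat. intros n _. pose proof (pow_le q n (proj1 Hq)). nra.
  - destruct (pow_lt_1_zero q ltac:(rewrite Rabs_pos_eq; lra) (eps / A) ltac:(now apply
      Rdiv_lt_0_compat)) as [N HN].
    exists N. intros n Hn. specialize (HN n Hn). rewrite Rabs_pos_eq in HN by (apply pow_le; lra).
    apply (Rmult_lt_compat_l A) in HN; auto. replace (A * (eps / A)) with eps in HN by (field; lra).
    exact HN.
Qed.

Lemma geom_bounded_converges a t z : 0 < t -> geom_bounded a t -> Cmod z < t -> exists l, Clim (psum a z) l.
Proof.
  intros Ht [M [HM H]] Hz. set (q := Cmod z / t).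
  assert (Hq : 0 <= q < 1).
  { unfold q. split. apply Rle_mult_inv_pos. apply Cmod_ge_0. lra.
    apply (Rmult_lt_reg_r t); auto. unfold Rdiv. rewrite Rmult_assoc, Rinv_l; lra. }
  destruct (@ex_series_le C_AbsRing C_CompleteNormedModule (fun k => a k * z ^ k)%C (fun k => M * q
    ^ k)) as [l Hl].
  - intros k. change (Cmod (a k * z ^ k)%C <= M * q ^ k). rewrite Cmod_mult, Cmod_pow. unfold q.
    rewrite Rpow_div_l.
    replace (Cmod (a k) * Cmod z ^ k) with (Cmod (a k) * t ^ k * (Cmod z ^ k / t ^ k)) by (field;
      apply pow_nonzero; lra).
    apply Rmult_le_compat_r; auto. apply Rle_mult_inv_pos. apply pow_le, Cmod_ge_0.
    now apply pow_lt.
  - apply (ex_series_scal_l M (fun k => q ^ k)). exists (/ (1 - q)). apply is_series_geom.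
    rewrite Rabs_pos_eq; lra.
  - exists l. replace z with (z - 0)%C by ring. apply power_series_at_iff.
    unfold is_power_series_at, is_pseries. revert Hl. apply is_series_ext. intros k.
    replace (z - 0)%C with z by ring. transitivity (z ^ k * a k)%C. apply Cmult_comm.
    exact (f_equal (fun x => x * a k)%C (eq_sym (pow_n_Cpow z k))).
Qed.

(** The sum is chosen pointwise; it is arbitrary outside the disk of convergence. *)
Lemma geom_bounded_sum R a : (forall s, 0 < s < R -> geom_bounded a s) -> exists F, expands_on R a F.
Proof.
  intros H. assert (H' : forall z, exists l, Cmod z < R -> Clim (psum a z) l).
  { intros z. destruct (Rlt_dec (Cmod z) R) as [Hz|Hz].
    - destruct (geom_bounded_converges a ((Cmod z + R) / 2) z) as [l Hl].
      pose proof (Cmod_ge_0 z); lra.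
      apply H. pose proof (Cmod_ge_0 z); lra. lra. now exists l.
    - exists (RtoC 0). tauto. }
  exists (fun z => epsilon (inhabits (RtoC 0)) (fun l => Cmod z < R -> Clim (psum a z) l)).
  intros z.
  apply (epsilon_spec (inhabits (RtoC 0)) (fun l => Cmod z < R -> Clim (psum a z) l) (H' z)).
Qed.

(** Bernoulli's inequality for [(t / s) ^ k]. *)
Lemma pow_growth s t : 0 < s < t -> exists K, 0 < K /\ forall k, INR k * s ^ k <= K * t ^ k.
Proof.
  intros H. exists (s / (t - s)). split. apply Rdiv_lt_0_compat; lra. intros k.
  assert (Hp := poly k ((t - s) / s) ltac:(apply Rdiv_lt_0_compat; lra)).
  replace (1 + (t - s) / s) with (t / s) in Hp by (field; lra).
  rewrite Rpow_div_l in Hp. pose proof (pow_lt s k (proj1 H)).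
  assert (INR k * ((t - s) / s) * s ^ k <= t ^ k).
  { apply (Rmult_le_compat_r (s ^ k)) in Hp; [|lra].
    replace (t ^ k / s ^ k * s ^ k) with (t ^ k) in Hp by (field; lra). nra. }
  replace (INR k * s ^ k) with (s / (t - s) * (INR k * ((t - s) / s) * s ^ k)) by (field; lra).
  apply Rmult_le_compat_l; auto. left. apply Rdiv_lt_0_compat; lra.
Qed.

Lemma geom_bounded_INR a s t : 0 < s < t -> geom_bounded a t -> geom_bounded (fun k => INR k * a k)%C s.
Proof.
  intros H [M [HM H1]]. destruct (pow_growth s t H) as [K [HK H2]].
  exists (K * M). split. nra. intros k. rewrite Cmod_mult, Cmod_R, Rabs_pos_eq by apply pos_INR.
  pose proof (Cmod_ge_0 (a k)). specialize (H1 k). specialize (H2 k).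
  replace (INR k * Cmod (a k) * s ^ k) with (Cmod (a k) * (INR k * s ^ k)) by ring.
  eapply Rle_trans. apply Rmult_le_compat_l; eauto. nra.
Qed.

Definition dcoef (a : nat -> C) (k : nat) : C := (INR (S k) * a (S k))%C.

Lemma geom_bounded_shift a s : 0 < s -> geom_bounded a s -> geom_bounded (fun k => a (S k)) s.
Proof.
  intros Hs [M [HM H]]. exists (M / s). split. now apply Rdiv_lt_0_compat. intros k.
  specialize (H (S k)).
  simpl in H. apply (Rmult_le_reg_r s); auto. unfold Rdiv. rewrite !Rmult_assoc, Rinv_l by lra. lra.
Qed.

Lemma geom_bounded_dcoef a s t : 0 < s < t -> geom_bounded a t -> geom_bounded (dcoef a) s.
Proof. intros H Ha. apply (geom_bounded_shift (fun k => INR k * a k)%C). lra.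
now apply geom_bounded_INR with t. Qed.

(** The extra factor [s] on the left keeps the exponent of [s] on the right free of
    subtraction. *)
Lemma pow_taylor2 (w z : C) s k : 0 <= s -> Cmod w <= s -> Cmod z <= s ->
  s * Cmod (w ^ S k - z ^ S k - INR (S k) * z ^ k * (w - z))%C <= INR (S k) ^ 2 * s ^ k * Cmod (w - z)%C ^ 2.
Proof.
  intros Hs Hw Hz. induction k.
  - replace (w ^ 1 - z ^ 1 - INR 1 * z ^ 0 * (w - z))%C with (RtoC 0) by (simpl; ring).
    rewrite Cmod_0, Rmult_0_r. simpl. pose proof (Cmod_ge_0 (w - z)%C). nra.
  - replace (w ^ S (S k) - z ^ S (S k) - INR (S (S k)) * z ^ S k * (w - z))%C with
     (w * (w ^ S k - z ^ S k - INR (S k) * z ^ k * (w - z)) + INR (S k) * z ^ k * ((w - z) * (w - z)))%C.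
    2:{ rewrite (S_INR (S k)), RtoC_plus, !Cpow_S. ring. }
    set (m := Cmod (w - z)%C) in *.
    set (T := (w ^ S k - z ^ S k - INR (S k) * z ^ k * (w - z))%C) in *.
    assert (0 <= m) by apply Cmod_ge_0.
    apply Rle_trans with (s * (Cmod w * Cmod T + INR (S k) * Cmod z ^ k * (m * m))).
    { apply Rmult_le_compat_l; auto. eapply Rle_trans; [apply Cmod_triangle|].
      rewrite !Cmod_mult, Cmod_pow, Cmod_R, Rabs_pos_eq by apply pos_INR. fold m. lra. }
    assert (H1 : Cmod z ^ k <= s ^ k) by (apply pow_incr; split; [apply Cmod_ge_0|auto]).
    assert (H0 : 0 <= s ^ k) by now apply pow_le.
    assert (H2 : 0 <= Cmod T) by apply Cmod_ge_0.
    assert (H3 : 0 <= Cmod w) by apply Cmod_ge_0.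
    set (x := INR (S k)) in *. assert (Hx : 0 <= x) by apply pos_INR.
    replace (INR (S (S k))) with (x + 1) by (rewrite (S_INR (S k)); reflexivity). simpl pow at 3.
    assert (s * (Cmod w * Cmod T) <= s * (x ^ 2 * s ^ k * m ^ 2)).
    { apply Rle_trans with (s * (s * Cmod T)). apply Rmult_le_compat_l; auto.
      apply Rmult_le_compat_r; auto.
      apply Rmult_le_compat_l; auto. }
    assert (s * (x * Cmod z ^ k * (m * m)) <= s * (x * s ^ k * (m * m))).
    { apply Rmult_le_compat_l; auto. apply Rmult_le_compat_r. nra. apply Rmult_le_compat_l; auto. }
    assert (0 <= s * s ^ k * (m * m)) by (apply Rmult_le_pos; [apply Rmult_le_pos|]; nra).
    assert (0 <= x * (s * s ^ k * (m * m))) by (apply Rmult_le_pos; auto). simpl. nra.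
Qed.

(** On [|w| <= s] the increments of the partial sums satisfy a quadratic bound [K |w - z| ^ 2]
    with [K] independent of the length, since the twice differentiated series is dominated by a
    geometric one of ratio [q]; the bound then passes to the limit. *)
Lemma expands_derivative R a F F' : expands_on R a F -> expands_on R (dcoef a) F' ->
  forall z, Cmod z < R -> Cder F z (F' z).
Proof.
  intros HF HF' z Hz. pose proof (Cmod_ge_0 z) as Hz0.
  set (d := (R - Cmod z) / 5). set (s := Cmod z + d).
  assert (Hd : 0 < d) by (unfold d; lra).
  assert (Hg : geom_bounded (dcoef (fun k => INR k * a k)%C) (s + d)).
  { apply geom_bounded_dcoef with (s + 2 * d). unfold s; lra.
    apply geom_bounded_INR with (s + 3 * d). unfold s; lra.
    apply (expands_geom_bounded R a F); auto. unfold s, d; lra. }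
  destruct Hg as [M [HM Hg]].
  set (q := s / (s + d)).
  assert (Hq : 0 < q < 1).
  { unfold q. split. apply Rdiv_lt_0_compat; unfold s; lra.
    apply (Rmult_lt_reg_r (s + d)). unfold s; lra. unfold Rdiv.
    rewrite Rmult_assoc, Rinv_l; unfold s; lra. }
  set (K := M / (1 - q) / s).
  assert (HK : 0 < K) by (unfold K; repeat apply Rdiv_lt_0_compat; unfold s; lra).
  assert (Hps : forall w n, Cmod w <= s ->
     s * Cmod (psum a w (S n) - psum a z (S n) - psum (dcoef a) z n * (w - z))%C <=
       M * (1 - q ^ n) / (1 - q) * Cmod (w - z)%C ^ 2).
  { intros w n Hw. induction n.
    - simpl. replace (0 + a 0%nat * 1 - (0 + a 0%nat * 1) - 0 * (w - z))%C with (RtoC 0) by ring.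
      rewrite Cmod_0.
      right. field. lra.
    - change (psum a ?x (S (S n))) with (psum a x (S n) + a (S n) * x ^ S n)%C.
      change (psum (dcoef a) z (S n)) with (psum (dcoef a) z n + dcoef a n * z ^ n)%C.
      replace (psum a w (S n) + a (S n) * w ^ S n - (psum a z (S n) + a (S n) * z ^ S n) - (psum
        (dcoef a) z n + dcoef a n * z ^ n) * (w - z))%C
       with ((psum a w (S n) - psum a z (S n) - psum (dcoef a) z n * (w - z)) + a (S n) * (w ^ S n
         - z ^ S n - INR (S n) * z ^ n * (w - z)))%C
       by (unfold dcoef; ring).
      eapply Rle_trans. apply Rmult_le_compat_l. unfold s; lra. apply Cmod_triangle.
      rewrite Cmod_mult, Rmult_plus_distr_l.
      replace (M * (1 - q ^ S n) / (1 - q) * Cmod (w - z) ^ 2) with (M * (1 - q ^ n) / (1 - q) *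
        Cmod (w - z) ^ 2 + M * q ^ n * Cmod (w - z) ^ 2) by (simpl; field; lra).
      apply Rplus_le_compat. exact IHn.
      assert (Hs : 0 <= s) by (unfold s; lra). assert (Hzs : Cmod z <= s) by (unfold s; lra).
      pose proof (pow_taylor2 w z s n Hs Hw Hzs) as HT.
      replace (s * (Cmod (a (S n)) * Cmod (w ^ S n - z ^ S n - INR (S n) * z ^ n * (w - z)))) with
        (Cmod (a (S n)) * (s * Cmod (w ^ S n - z ^ S n - INR (S n) * z ^ n * (w - z)))) by ring.
      eapply Rle_trans. apply Rmult_le_compat_l. apply Cmod_ge_0. exact HT.
      replace (Cmod (a (S n)) * (INR (S n) ^ 2 * s ^ n * Cmod (w - z) ^ 2)) with
       ((INR (S n) ^ 2 * Cmod (a (S n)) * s ^ n) * Cmod (w - z) ^ 2) by ring.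
      apply Rmult_le_compat_r. apply pow_le, Cmod_ge_0.
      specialize (Hg n). unfold dcoef in Hg.
      rewrite !Cmod_mult, Cmod_R, Rabs_pos_eq in Hg by apply pos_INR.
      unfold q. rewrite Rpow_div_l.
      assert (Hsd : 0 < (s + d) ^ n) by (apply pow_lt; unfold s; lra).
      replace (INR (S n) ^ 2 * Cmod (a (S n)) * s ^ n) with (INR (S n) * (INR (S n) * Cmod (a (S
        n))) * (s + d) ^ n * (s ^ n / (s + d) ^ n)) by (field; lra).
      apply Rmult_le_compat_r; auto. apply Rle_mult_inv_pos; auto. now apply pow_le. }
  assert (Hquad : forall w, Cmod w <= s -> Cmod (F w - F z - F' z * (w - z))%C <= K * Cmod (w - z)%C ^ 2).
  { intros w Hw. apply le_epsilon. intros eps He.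
    assert (HwR : Cmod w < R) by (unfold s, d in Hw; lra).
    assert (Hc : 0 < eps / (2 + Cmod (w - z)%C)) by (apply Rdiv_lt_0_compat; pose proof (Cmod_ge_0
      (w - z)%C); lra).
    set (e := eps / (2 + Cmod (w - z)%C)) in *.
    destruct (HF w HwR e Hc) as [N1 H1]. destruct (HF z Hz e Hc) as [N2 H2].
    destruct (HF' z Hz e Hc) as [N3 H3].
    set (n := max N1 (max N2 N3)).
    specialize (H1 (S n) ltac:(lia)). specialize (H2 (S n) ltac:(lia)).
    specialize (H3 n ltac:(lia)).
    specialize (Hps w n Hw).
    assert (Hp2 : Cmod (psum a w (S n) - psum a z (S n) - psum (dcoef a) z n * (w - z))%C <=
      K * Cmod (w - z)%C ^ 2).
    { apply (Rmult_le_reg_l s). unfold s; lra. eapply Rle_trans; [exact Hps|].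
      replace (s * (K * Cmod (w - z) ^ 2)) with (M / (1 - q) * Cmod (w - z) ^ 2) by (unfold K;
        field; unfold s; lra).
      apply Rmult_le_compat_r. apply pow_le, Cmod_ge_0. apply Rmult_le_compat_r.
      left; apply Rinv_0_lt_compat; lra.
      pose proof (pow_lt q n (proj1 Hq)). nra. }
    replace (F w - F z - F' z * (w - z))%C with
     ((psum a w (S n) - psum a z (S n) - psum (dcoef a) z n * (w - z)) - (psum a w (S n) - F w) -
       (- (psum a z (S n) - F z) + - ((psum (dcoef a) z n - F' z) * (w - z))))%C by ring.
    eapply Rle_trans; [apply Cmod_triangle_minus|].
    eapply Rle_trans. apply Rplus_le_compat. apply Cmod_triangle_minus. apply Cmod_triangle.
    rewrite !Cmod_opp, Cmod_mult.
    pose proof (Cmod_ge_0 (w - z)%C).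
    assert (Cmod (psum (dcoef a) z n - F' z)%C * Cmod (w - z)%C <=
      e * Cmod (w - z)%C) by (apply Rmult_le_compat_r; lra).
    assert (e * (2 + Cmod (w - z)%C) = eps) by (unfold e; field; lra). lra. }
  apply Cder_eps. intros eps He. exists (Rmin d (eps / K)). split. apply Rmin_pos; auto.
  now apply Rdiv_lt_0_compat.
  intros w Hw. assert (Hw1 := Rlt_le_trans _ _ _ Hw (Rmin_l _ _)).
  assert (Hw2 := Rlt_le_trans _ _ _ Hw (Rmin_r _ _)).
  eapply Rle_trans. apply Hquad.
  replace w with ((w - z) + z)%C by ring. eapply Rle_trans; [apply Cmod_triangle|]. unfold s. lra.
  pose proof (Cmod_ge_0 (w - z)%C).
  assert (K * Cmod (w - z)%C <= eps). { apply (Rmult_lt_compat_l K) in Hw2; auto.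
  replace (K * (eps / K)) with eps in Hw2 by (field; lra). lra. }
  simpl. nra.
Qed.

Lemma expands_dcoef R a F : expands_on R a F -> exists F', expands_on R (dcoef a) F'.
Proof.
  intros H. apply geom_bounded_sum. intros s Hs. apply geom_bounded_dcoef with ((s + R) / 2). lra.
  apply (expands_geom_bounded R a F); auto. lra.
Qed.

(** * Fourier coefficients and Bessel's inequality *)

Lemma psum_scale a (r : R) (c : C) n : psum a (r * c)%C n = psum (fun k => a k * r ^ k)%C c n.
Proof. induction n; simpl; auto. rewrite IHn, Cpow_mult_l. ring. Qed.

Lemma cts_psum a phi n : cts phi -> cts (fun t => psum a (phi t) n).
Proof.
  intros H. induction n; simpl. apply cts_const. apply cts_plus; auto.
  apply cts_mult. apply cts_const. now apply cts_pow.
Qed.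

Lemma circle_mean_psum_coef a n k : circle_mean (fun t => psum a (cis t) n * Cconj (cis t) ^ k)%C =
  if Nat.ltb k n then a k else 0.
Proof.
  assert (Hc := cts_cis). assert (Hcc := cts_pow _ k (cts_conj _ Hc)).
  induction n.
  - simpl. rewrite (circle_mean_ext _ (fun _ => RtoC 0)). apply circle_mean_const. intros; ring.
  - rewrite (circle_mean_ext _ (fun t => psum a (cis t) n * Cconj (cis t) ^ k + a n * (cis t ^ n *
      Cconj (cis t) ^ k))%C) by (intros; simpl; ring).
    assert (Hp := cts_psum a _ n Hc).
    rewrite circle_mean_plus by solve_cts. rewrite circle_mean_scal by solve_cts.
    rewrite IHn, circle_mean_cis_ortho.
    destruct (Nat.ltb_spec k n), (Nat.ltb_spec k (S n)), (Nat.eqb_spec n k); subst; try lia; ring.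
Qed.

Lemma circle_mean_psum_coef_neg a n k : (0 < k)%nat ->
  circle_mean (fun t => psum a (cis t) n * cis t ^ k)%C = 0.
Proof.
  intros Hk. assert (Hc := cts_cis).
  induction n.
  - simpl. rewrite (circle_mean_ext _ (fun _ => RtoC 0)). apply circle_mean_const. intros; ring.
  - rewrite (circle_mean_ext _ (fun t => psum a (cis t) n * cis t ^ k + a n * (cis t ^ (n + k)))%C)
      by (intros; rewrite Cpow_add_r; simpl; ring).
    assert (Hp := cts_psum a _ n Hc).
    rewrite circle_mean_plus by solve_cts. rewrite circle_mean_scal by solve_cts.
    rewrite IHn, circle_mean_cis_pow by lia.
    ring.
Qed.

Lemma geom_zero (x : C) q A k : 0 <= q < 1 -> (forall n, (k <= n)%nat -> Cmod x <= A * q ^ n) -> x = 0.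
Proof.
  intros Hq H. apply Cmod_eq_0. apply Rle_antisym; [|apply Cmod_ge_0]. apply le_epsilon.
  intros eps He.
  destruct (geometric_eventually_small q A eps Hq He) as [N HN].
  specialize (HN (max N k) ltac:(lia)). specialize (H (max N k) ltac:(lia)). lra.
Qed.

(** On a circle inside the disk of convergence the series converges uniformly at a geometric
    rate, so means against bounded functions may be computed on partial sums. *)
Lemma circle_mean_psum_approx R a F r psi : expands_on R a F -> 0 < r < R -> cts (fun t => F (r * cis t)%C) ->
  cts psi -> (forall t, Cmod (psi t) <= 1) ->
  exists A q, 0 <= q < 1 /\ forall n,
   Cmod (circle_mean (fun t => F (r * cis t) * psi t)%C - circle_mean (fun t => psum (fun k => a k
     * r ^ k)%C (cis t) n * psi t)%C)%C <= A * q ^ n.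
Proof.
  intros H Hr Hc Hpsi Hb. set (t0 := (r + R) / 2).
  destruct (expands_geom_bounded R a F t0 H) as [M [HM Hg]]. unfold t0; lra.
  assert (Hq : 0 <= r / t0 < 1).
  { split. apply Rle_mult_inv_pos; unfold t0; lra. apply (Rmult_lt_reg_r t0). unfold t0; lra.
    unfold Rdiv. rewrite Rmult_assoc, Rinv_l; unfold t0; lra. }
  exists (M / (1 - r / t0)), (r / t0). split; auto. intros n.
  assert (Hm : forall t, Cmod (r * cis t)%C = r) by (intros; rewrite Cmod_mult, Cmod_cis, Cmod_R,
    Rabs_pos_eq; lra).
  rewrite <- circle_mean_minus. apply circle_mean_bound_const.
  - apply cts_minus; apply cts_mult; auto. apply cts_psum, cts_cis.
  - intros t. rewrite <- psum_scale.
    replace (F (r * cis t) * psi t - psum a (r * cis t) n * psi t)%C with ((F (r * cis t) - psum a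
      (r * cis t) n) * psi t)%C by ring.
    rewrite Cmod_mult.
    assert (HT := expands_tail R a F t0 M (r * cis t) n H ltac:(unfold t0; lra) Hg).
    rewrite Hm in HT. specialize (HT ltac:(unfold t0; lra) ltac:(lra)).
    replace (M / (1 - r / t0) * (r / t0) ^ n) with (M * (r / t0) ^ n / (1 - r / t0)) by (field;
      unfold t0; lra).
    pose proof (Cmod_ge_0 (F (r * cis t) - psum a (r * cis t) n)%C). specialize (Hb t).
    pose proof (Cmod_ge_0 (psi t)). nra.
  - now apply cts_mult.
  - apply cts_mult; auto. apply cts_psum, cts_cis.
Qed.

Lemma coef_formula R a F r k : expands_on R a F -> 0 < r < R -> cts (fun t => F (r * cis t)%C) ->
  circle_mean (fun t => F (r * cis t) * Cconj (cis t) ^ k)%C = (a k * r ^ k)%C.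
Proof.
  intros H Hr Hc.
  destruct (circle_mean_psum_approx R a F r (fun t => Cconj (cis t) ^ k)%C H Hr Hc) as [A [q [Hq HA]]].
  apply cts_pow, cts_conj, cts_cis. intros t. rewrite Cmod_pow, Cmod_conj, Cmod_cis, pow1. lra.
  apply Ceq_minus. apply (geom_zero _ q A (S k) Hq). intros n Hn. specialize (HA n).
  rewrite circle_mean_psum_coef in HA. destruct (Nat.ltb_spec k n); [|lia]. exact HA.
Qed.

(** The negative Fourier coefficients vanish; this is what separates the real part of an
    analytic function from the function itself in [caratheodory_coef]. *)
Lemma coef_formula_neg R a F r k : expands_on R a F -> 0 < r < R ->
  cts (fun t => F (r * cis t)%C) -> (0 < k)%nat ->
  circle_mean (fun t => F (r * cis t) * cis t ^ k)%C = 0.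
Proof.
  intros H Hr Hc Hk.
  destruct (circle_mean_psum_approx R a F r (fun t => cis t ^ k)%C H Hr Hc) as [A [q [Hq HA]]].
  apply cts_pow, cts_cis. intros t. rewrite Cmod_pow, Cmod_cis, pow1. lra.
  apply Ceq_minus. apply (geom_zero _ q A 0 Hq). intros n Hn. specialize (HA n).
  now rewrite circle_mean_psum_coef_neg in HA.
Qed.

Lemma Cmod2_Re (z : C) : Cmod z ^ 2 = Re (z * Cconj z)%C.
Proof. now rewrite <- Cmod2_conj. Qed.

(** The energy of the remainder after removal of the modes below [m] is nonnegative, and
    removing one more mode lowers it by exactly the squared modulus of its coefficient. *)
Lemma bessel phi n : cts phi ->
  let c := fun k => circle_mean (fun t => phi t * Cconj (cis t) ^ k)%C in
  sum_n (fun k => Cmod (c k) ^ 2) n <= Re (circle_mean (fun t => phi t * Cconj (phi t))%C).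
Proof.
  intros Hphi c.
  set (rem := fun n t => (phi t - psum c (cis t) n)%C).
  assert (Hpc : forall n, cts (fun t => psum c (cis t) n)) by (intros m; apply cts_psum, cts_cis).
  assert (Hrem : forall n, cts (rem n)).
  { intros m. apply cts_minus; auto. }
  assert (Hcis := cts_cis). assert (Hcc := fun k => cts_pow _ k (cts_conj _ cts_cis)).
  assert (Hcoef : forall m, circle_mean (fun t => rem m t * Cconj (cis t) ^ m)%C = c m).
  { intros m.
    rewrite (circle_mean_ext _ (fun t => phi t * Cconj (cis t) ^ m - psum c (cis t) m * Cconj (cis
      t) ^ m)%C) by (intros; unfold rem; ring).
    rewrite circle_mean_minus, circle_mean_psum_coef. rewrite Nat.ltb_irrefl. fold (c m). ring.
    now apply cts_mult. now apply cts_mult. }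
  assert (Hstep : forall m, circle_mean (fun t => rem (S m) t * Cconj (rem (S m) t))%C =
    (circle_mean (fun t => rem m t * Cconj (rem m t)) - c m * Cconj (c m))%C).
  { intros m.
    rewrite (circle_mean_ext _ (fun t => (rem m t * Cconj (rem m t) - Cconj (c m) * (rem m t *
      Cconj (cis t) ^ m)) - (c m * Cconj (rem m t * Cconj (cis t) ^ m) - c m * Cconj (c m)))%C).
    2:{ intros t. unfold rem. simpl psum.
        set (u := cis t). set (P := psum c u m). set (v := (u ^ m)%C).
        assert (Hv : (v * Cconj u ^ m = 1)%C) by (unfold v; now rewrite <- Cpow_mult_l; unfold u;
          rewrite cis_conj, Cpow_1_l).
        replace (Cconj u ^ m)%C with (Cconj v) in * by (unfold v; now rewrite Cpow_conj).
        assert (E1 : Cconj (phi t - (P + c m * v)) = (Cconj (phi t - P) - Cconj (c m) * Cconj v)%C).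
        { destruct (phi t), P, (c m), v; unfold Cconj, Cminus, Cplus, Copp, Cmult; simpl; f_equal; ring.
          }
        assert (E2 : Cconj ((phi t - P) * Cconj v) = (Cconj (phi t - P) * v)%C).
        { destruct (phi t), P, v; unfold Cconj, Cminus, Cplus, Copp, Cmult; simpl; f_equal; ring. }
        rewrite E1, E2.
        replace (c m * Cconj (c m))%C with (c m * Cconj (c m) * (v * Cconj v))%C by (rewrite Hv; ring).
        ring. }
    assert (K1 : cts (fun t => rem m t * Cconj (rem m t))%C) by (apply cts_mult; [|apply cts_conj];
      apply Hrem).
    assert (K2 : cts (fun t => rem m t * Cconj (cis t) ^ m)%C) by (apply cts_mult; [apply Hrem|apply Hcc]).
    assert (K3 : cts (fun t => Cconj (c m) * (rem m t * Cconj (cis t) ^ m))%C) by (apply cts_mult;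
      [apply cts_const|exact K2]).
    assert (K4 : cts (fun t => c m * Cconj (rem m t * Cconj (cis t) ^ m))%C) by (apply cts_mult;
      [apply cts_const|apply cts_conj; exact K2]).
    rewrite circle_mean_minus; [|now apply cts_minus|apply cts_minus; [exact K4|apply cts_const]].
    rewrite circle_mean_minus by assumption. rewrite circle_mean_minus; [|exact K4|apply cts_const].
    rewrite circle_mean_scal by assumption. rewrite circle_mean_scal by (now apply cts_conj).
    rewrite circle_mean_conj by assumption. rewrite Hcoef, circle_mean_const. ring. }
  assert (Hall : forall m, sum_n (fun k => Cmod (c k) ^ 2) m + Re (circle_mean (fun t => rem (S m)
    t * Cconj (rem (S m) t))%C) = Re (circle_mean (fun t => phi t * Cconj (phi t))%C)).
  { assert (Hs : forall m, Re (circle_mean (fun t => rem (S m) t * Cconj (rem (S m) t))%C) =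
      Re (circle_mean (fun t => rem m t * Cconj (rem m t))%C) - Cmod (c m) ^ 2).
    { intros m. rewrite Hstep, Cmod2_Re. unfold Cminus.
      generalize (circle_mean (fun t => rem m t * Cconj (rem m t))%C) (c m * Cconj (c m))%C.
      intros [x1 x2] [y1 y2]. simpl. ring. }
    induction m.
    - rewrite sum_O, Hs.
      rewrite (circle_mean_ext (fun t => rem 0%nat t * Cconj (rem 0%nat t))%C (fun t => phi t *
        Cconj (phi t))%C). ring.
      intros t. unfold rem; simpl. replace (phi t - 0)%C with (phi t) by ring. reflexivity.
    - rewrite sum_Sn, Hs. unfold plus; simpl. simpl in IHm. lra. }
  rewrite <- (Hall n).
  assert (0 <= Re (circle_mean (fun t => rem (S n) t * Cconj (rem (S n) t))%C)).
  { replace 0 with (Re (circle_mean (fun _ => RtoC 0))) by now rewrite circle_mean_const.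
    apply circle_mean_Re_le. apply cts_const. apply cts_mult; [|apply cts_conj]; apply Hrem.
    intros t. rewrite <- Cmod2_Re. apply pow2_ge_0. }
  lra.
Qed.

Lemma expands_cts R a F r : expands_on R a F -> 0 <= r < R -> cts (fun t => F (r * cis t)%C).
Proof.
  intros H Hr. destruct (expands_dcoef R a F H) as [F' H'].
  apply (cts_comp (fun t => r * cis t)%C F). apply cts_mult. apply cts_const. apply cts_cis.
  intros t. eapply Cder_cont. apply (expands_derivative R a F F' H H').
  rewrite Cmod_mult, Cmod_cis, Cmod_R, Rabs_pos_eq; lra.
Qed.

(** The Fourier coefficients of [F] on the circle of radius [r] are the [a k * r ^ k]. *)
Lemma expands_bessel R a F r M n : expands_on R a F -> 0 < r < R ->
  (forall z, Cmod z = r -> Cmod (F z) <= M) ->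
  sum_n (fun k => (Cmod (a k) * r ^ k) ^ 2) n <= M ^ 2.
Proof.
  intros H Hr HM. assert (Hc := expands_cts R a F r H ltac:(lra)).
  rewrite (sum_n_ext _ (fun k => Cmod (circle_mean (fun t => F (r * cis t) * Cconj (cis t) ^ k)%C) ^ 2)).
  - eapply Rle_trans. apply (bessel (fun t => F (r * cis t)%C) n Hc).
    replace (M ^ 2) with (Re (circle_mean (fun _ => RtoC (M ^ 2)))) by now rewrite circle_mean_const.
    apply circle_mean_Re_le. now apply cts_mult; [|apply cts_conj]. apply cts_const.
    intros t. rewrite <- Cmod2_Re. change (Re (RtoC (M ^ 2))) with (M ^ 2). apply pow_incr. split.
    apply Cmod_ge_0.
    apply HM. rewrite Cmod_mult, Cmod_cis, Cmod_R, Rabs_pos_eq; lra.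
  - intros k. f_equal. rewrite (coef_formula R a F r k) by auto.
    rewrite Cmod_mult, Cmod_pow, Cmod_R, Rabs_pos_eq; lra.
Qed.

(** * Cauchy's formula and Taylor expansion in the disk *)

Lemma param_derive (p dp : R -> R -> R) (s b : R) :
  locally s (fun u => forall t, is_derive (fun x => p x t) u (dp u t)) ->
  (forall t, continuous (fun q : R * R => dp (fst q) (snd q)) (s, t)) ->
  locally s (fun u => ex_RInt (p u) 0 b) ->
  is_derive (fun x => RInt (p x) 0 b) s (RInt (dp s) 0 b).
Proof.
  intros Hd Hc He.
  assert (Hs := locally_singleton _ _ Hd).
  rewrite <- (RInt_ext (fun t => Derive (fun u => p u t) s)).
  2:{ intros t _. apply is_derive_unique, Hs. }
  apply (is_derive_RInt_param p).
  - revert Hd. apply filter_imp. intros u H t _. now exists (dp u t).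
  - intros t _. apply continuity_2d_pt_ext_loc with dp.
    + destruct Hd as [d Hd]. exists d. intros u v Hu _. symmetry. apply is_derive_unique.
      now apply Hd.
    + apply continuity_2d_pt_filterlim. apply (Hc t).
  - exact He.
Qed.

(** Continuity of the derivative permits differentiation under the integral sign in Cauchy's
    formula. *)
Definition holo_on (f f' : C -> C) : Prop :=
  (forall z, Cmod z < 1 -> Cder f z (f' z)) /\
  (forall z, Cmod z < 1 -> @Ccont (AbsRing_UniformSpace C_AbsRing) f' z).

Definition holo (f : C -> C) : Prop := exists f', holo_on f f'.

Lemma holo_cont f z : holo f -> Cmod z < 1 -> @Ccont (AbsRing_UniformSpace C_AbsRing) f z.
Proof. intros [f' [H _]] Hz. eapply Cder_cont. now apply H. Qed.

Lemma holo_cts f r : holo f -> 0 <= r < 1 -> cts (fun t => f (r * cis t)%C).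
Proof.
  intros H Hr. apply (cts_comp (fun t => r * cis t)%C f). solve_cts.
  intros t. apply holo_cont; auto. rewrite Cmod_mult, Cmod_cis, Cmod_R, Rabs_pos_eq; lra.
Qed.

Section Cauchy.
Variables (f f' : C -> C) (z : C) (rho : R).
Hypothesis Hf : holo_on f f'.
Hypothesis Hz : Cmod z < rho.
Hypothesis Hrho : rho < 1.

Let zeta (t : R) : C := (rho * cis t)%C.
Let path (s t : R) : C := (z + s * (zeta t - z))%C.
Let ker (t : R) : C := (zeta t / (zeta t - z))%C.

Let rho_pos : 0 < rho.
Proof. pose proof (Cmod_ge_0 z). lra. Qed.

Let Cmod_zeta t : Cmod (zeta t) = rho.
Proof. unfold zeta. rewrite Cmod_mult, Cmod_cis, Cmod_R, Rabs_pos_eq; pose proof rho_pos; lra. Qed.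

Let zeta_z t : (zeta t - z)%C <> 0.
Proof. apply Cmod_gt_0. pose proof (Cmod_triangle_rev (zeta t) z). rewrite Cmod_zeta in H. lra. Qed.

Let cts_zeta : cts zeta.
Proof. unfold zeta. solve_cts. Qed.

Let cts_ker : cts ker.
Proof.
  unfold ker, Cdiv. apply cts_mult; auto.
  apply (cts_comp (fun t => zeta t - z)%C Cinv). solve_cts.
  intros t. eapply Cder_cont. apply Cder_inv. apply zeta_z.
Qed.

Let path_in s t : Rabs (1 - s) * Cmod z + Rabs s * rho < 1 -> Cmod (path s t) < 1.
Proof.
  intros H. unfold path.
  replace (z + s * (zeta t - z))%C with (RtoC (1 - s)%R * z + s * zeta t)%C by (rewrite RtoC_minus; ring).
  eapply Rle_lt_trans; [apply Cmod_triangle|]. now rewrite !Cmod_mult, !Cmod_R, Cmod_zeta.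
Qed.

Let near s : 0 <= s <= 1 -> locally s (fun u : R => Rabs (1 - u) * Cmod z + Rabs u * rho < 1).
Proof.
  intros Hs. exists (mkposreal ((1 - rho) / 2) ltac:(lra)). intros u Hu.
  change (Rabs (u - s) < (1 - rho) / 2) in Hu.
  pose proof (Cmod_ge_0 z).
  assert (Rabs (1 - u) <= (1 - s) + Rabs (u - s)).
  { replace (1 - u) with ((1 - s) + - (u - s)) by ring. eapply Rle_trans; [apply Rabs_triang|].
    rewrite Rabs_Ropp, (Rabs_pos_eq (1 - s)); lra. }
  assert (Rabs u <= s + Rabs (u - s)).
  { replace u with (s + (u - s)) at 1 by ring. eapply Rle_trans; [apply Rabs_triang|].
    rewrite (Rabs_pos_eq s); lra. }
  pose proof (Rabs_pos (u - s)).
  apply Rle_lt_trans with ((1 - s + Rabs (u - s)) * rho + (s + Rabs (u - s)) * rho).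
  apply Rplus_le_compat. apply Rmult_le_compat; try lra. apply Rabs_pos.
  apply Rmult_le_compat_r; lra.
  nra.
Qed.

(** [Phi s] is the integrand of Cauchy's formula with [f] evaluated on the circle contracted by
    the factor [s] towards [z]. Its derivative in [s] loses the denominator of the kernel. *)
Let Phi (s t : R) : C := (f (path s t) * ker t)%C.
Let dPhi (s t : R) : C := (f' (path s t) * zeta t)%C.

Let Phi_der s t : Rabs (1 - s) * Cmod z + Rabs s * rho < 1 ->
  Cder (fun w => f (z + w * (zeta t - z)) * ker t)%C s (dPhi s t).
Proof.
  intros H. eapply Cder_eq.
  apply (Cder_mult (fun w => f (z + w * (zeta t - z))%C) (fun _ => ker t)).
  apply (Cder_comp f (fun w => z + w * (zeta t - z))%C s (f' (path s t)) (zeta t - z)%C).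
  apply Hf. now apply path_in.
  eapply Cder_eq. apply Cder_plus. apply Cder_const.
  apply (Cder_mult (fun w => w) (fun _ => zeta t - z)%C). apply Cder_id. apply Cder_const. ring.
  apply Cder_const. unfold dPhi, ker. field. apply zeta_z.
Qed.

Let Phi_cts s : Rabs (1 - s) * Cmod z + Rabs s * rho < 1 -> cts (Phi s).
Proof.
  intros H. unfold Phi. apply cts_mult; auto. apply (cts_comp (path s) f). unfold path; solve_cts.
  intros t. eapply Cder_cont. apply Hf. now apply path_in.
Qed.

Let dPhi_cont s t : Rabs (1 - s) * Cmod z + Rabs s * rho < 1 ->
  @Ccont (prod_UniformSpace R_UniformSpace R_UniformSpace) (fun q => dPhi (fst q) (snd q)) (s, t).
Proof.
  intros H.
  assert (Hfst : @Ccont (prod_UniformSpace R_UniformSpace R_UniformSpace) (fun q => RtoC (fst q)) (s, t)).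
  { apply Ccont_RtoC. apply continuous_fst. }
  assert (Hze : @Ccont (prod_UniformSpace R_UniformSpace R_UniformSpace) (fun q => zeta (snd q)) (s, t)).
  { apply (@continuous_comp (prod_UniformSpace R_UniformSpace R_UniformSpace) R_UniformSpace
      (AbsRing_UniformSpace C_AbsRing) snd zeta).
    apply continuous_snd. apply cts_zeta. }
  unfold dPhi. apply Ccont_mult; auto.
  apply (Ccont_comp (fun q : prod_UniformSpace R_UniformSpace R_UniformSpace => path (fst q) (snd q)) f').
  - unfold path. apply Ccont_plus. apply Ccont_const. apply Ccont_mult; auto.
    apply Ccont_minus; auto. apply Ccont_const.
  - apply Hf. now apply path_in.
Qed.

(** Up to the factor [s * Ci], the derivative of [Phi] in [s] is the derivative in [t] of [f]
    along a closed curve. *)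
Let circle_mean_dPhi s : Rabs (1 - s) * Cmod z + Rabs s * rho < 1 -> circle_mean (dPhi s) = 0.
Proof.
  intros H. destruct (Req_dec s 0) as [->|Hs].
  - rewrite (circle_mean_ext _ (fun t => (f' z * rho) * cis t ^ 1)%C).
    rewrite circle_mean_scal, circle_mean_cis_pow by (try lia; apply cts_pow, cts_cis). ring.
    intros t. unfold dPhi, path, zeta. replace (z + 0 * (rho * cis t - z))%C with z by ring.
    rewrite Cpow_1_r. ring.
  - assert (Hd : cts (dPhi s)).
    { unfold dPhi. apply cts_mult; auto. apply (cts_comp (path s) f'). unfold path; solve_cts.
      intros t. apply Hf. now apply path_in. }
    assert (Hsi : (s * Ci)%C <> 0). { apply Cmult_neq_0. intros Q; apply RtoC_inj in Q; auto.
    apply Ci_nz. }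
    assert (E : (s * Ci * circle_mean (dPhi s) = 0)%C).
    { rewrite <- circle_mean_scal by auto.
      apply (circle_mean_deriv_periodic (fun w => f (z + s * (rho * cexp (Ci * w) - z)))%C (fun w
        => s * Ci * (f' (z + s * (rho * cexp (Ci * w) - z)) * (rho * cexp (Ci * w))))%C).
      - intros t. eapply Cder_eq.
        apply (Cder_comp f (fun w => z + s * (rho * cexp (Ci * w) - z))%C t (f' (path s t)) (s *
          (rho * (Ci * cexp (Ci * t))))%C).
        apply Hf. now apply path_in.
        eapply Cder_eq. apply Cder_plus. apply Cder_const. apply Cder_scal. apply Cder_minus.
        apply Cder_scal.
        apply (Cder_comp cexp (fun w => Ci * w)%C t (cexp (Ci * t)) Ci). apply Cder_cexp.
        eapply Cder_eq. apply Cder_scal. apply Cder_id. ring. apply Cder_const. ring.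
        unfold path, zeta, cis. ring.
      - change (cts (fun t => s * Ci * dPhi s t)%C). apply cts_mult. apply cts_const. exact Hd.
      - change (f (z + s * (rho * cis (2 * PI) - z)) = f (z + s * (rho * cexp (Ci * 0) - z)))%C.
        rewrite cis_cs, cos_2PI, sin_2PI. replace (Ci * 0)%C with (RtoC 0) by ring. rewrite cexp_0.
        reflexivity. }
    destruct (Ceq_dec (circle_mean (dPhi s)) 0) as [|N]; auto. exfalso. revert E.
    now apply Cmult_neq_0.
Qed.

(** The mean of [Phi s] does not depend on [s]: [s = 1] is the Cauchy integral over the circle,
    [s = 0] its degenerate form at the centre of contraction. *)
Lemma cauchy_transport : circle_mean (fun t => f (zeta t) * ker t)%C = (f z * circle_mean ker)%C.
Proof.
  pose proof two_PI_pos.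
  assert (H0 : forall h : C -> R, (h = Re \/ h = Im) ->
    forall s, 0 <= s <= 1 -> is_derive (fun x => RInt (fun t => h (Phi x t)) 0 (2 * PI)) s 0).
  { intros h Hh s Hs. assert (Hin := locally_singleton _ _ (near s Hs)).
    assert (HD : is_derive (fun x => RInt (fun t => h (Phi x t)) 0 (2 * PI)) s (RInt (fun t => h
      (dPhi s t)) 0 (2 * PI))).
    { apply (param_derive (fun x t => h (Phi x t)) (fun x t => h (dPhi x t)) s).
      + generalize (near s Hs). apply filter_imp. intros u Hu t.
        destruct Hh as [-> | ->]. apply (Cder_Re (fun w => f (z + w * (zeta t - z)) * ker t)%C).
        now apply Phi_der.
        apply (Cder_Im (fun w => f (z + w * (zeta t - z)) * ker t)%C). now apply Phi_der.
      + intros t.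
        destruct Hh as [-> | ->]; [apply (Ccont_Re (U:=prod_UniformSpace R_UniformSpace
          R_UniformSpace) (fun q => dPhi (fst q) (snd q)))|apply (Ccont_Im (U:=prod_UniformSpace
          R_UniformSpace R_UniformSpace) (fun q => dPhi (fst q) (snd q)))]; now apply dPhi_cont.
      + generalize (near s Hs). apply filter_imp. intros u Hu. destruct Hh as [-> | ->].
        now apply cts_ex_Re, Phi_cts. now apply cts_ex_Im, Phi_cts. }
    assert (EQ : RInt (fun t => h (dPhi s t)) 0 (2 * PI) = 0).
    { assert (E := circle_mean_dPhi s Hin). unfold circle_mean in E.
      assert (E1 := f_equal Re E). assert (E2 := f_equal Im E). simpl in E1, E2.
      assert (HZ : forall x, x / (2 * PI) = 0 -> x = 0).
      { intros x Hx. apply (Rmult_eq_reg_r (/ (2 * PI))). now rewrite Rmult_0_l.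
        apply Rinv_neq_0_compat. lra. }
      destruct Hh as [-> | ->]; apply HZ; [exact E1|exact E2]. }
    rewrite EQ in HD. exact HD. }
  assert (HC : forall h : C -> R, (h = Re \/ h = Im) ->
    RInt (fun t => h (Phi 1 t)) 0 (2 * PI) = RInt (fun t => h (Phi 0 t)) 0 (2 * PI)).
  { intros h Hh. symmetry.
    apply (eq_is_derive (fun x => RInt (fun t => h (Phi x t)) 0 (2 * PI)) 0 1).
    intros t Ht. now apply H0. lra. }
  rewrite (circle_mean_ext _ (Phi 1)). 2:{ intros t. unfold Phi, path. f_equal. f_equal. ring. }
  rewrite <- circle_mean_scal by auto.
  rewrite (circle_mean_ext (fun t => f z * ker t)%C (Phi 0)). 2:{ intros t. unfold Phi, path.
  f_equal. f_equal. ring. }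
  unfold circle_mean. now rewrite (HC Re), (HC Im) by auto.
Qed.

(** The finite geometric series in [z / zeta t], where [/ cis t] is written as a conjugate to
    match the Fourier coefficients. *)
Lemma ker_expand n t : ker t = (psum (fun k => Cconj (cis t) ^ k / rho ^ k) z n + (z / zeta t) ^ n * ker t)%C.
Proof.
  assert (Hzt : zeta t <> 0). { apply Cmod_gt_0. rewrite Cmod_zeta. apply rho_pos. }
  assert (Hr0 : RtoC rho <> 0). { intros Q; apply RtoC_inj in Q. pose proof rho_pos; lra. }
  induction n. simpl. ring.
  simpl psum. rewrite IHn at 1. rewrite <- Cplus_assoc. f_equal.
  assert (E : (z / zeta t = (Cconj (cis t) / rho) * z)%C).
  { unfold zeta.
    replace (Cconj (cis t)) with (/ cis t)%C. field. split; auto; apply cis_neq0.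
    rewrite <- (Cmult_1_r (/ cis t)), <- (cis_conj t). field. apply cis_neq0. }
  replace (Cconj (cis t) ^ n / rho ^ n * z ^ n)%C with ((z / zeta t) ^ n)%C.
  2:{ rewrite E, Cpow_mult_l. unfold Cdiv. now rewrite Cpow_mult_l, Cpow_inv. }
  rewrite Cpow_S. unfold ker. set (Z := ((z / zeta t) ^ n)%C).
  replace (Z + z / zeta t * Z * (zeta t / (zeta t - z)))%C with (Z * (1 + z / (zeta t - z)))%C by
    (field; auto).
  field. auto.
Qed.

Lemma ker_partial g n : cts g ->
  circle_mean (fun t => g t * ker t)%C = (psum (fun k => circle_mean (fun t => g t * Cconj (cis t)
    ^ k) / rho ^ k) z n
     + circle_mean (fun t => g t * ((z / zeta t) ^ n * ker t)))%C.
Proof.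
  intros Hg.
  assert (Hr0 : RtoC rho <> 0). { intros Q; apply RtoC_inj in Q. pose proof rho_pos; lra. }
  assert (Hw : cts (fun t => z / zeta t)%C).
  { unfold Cdiv. apply (cts_mult (fun _ => z) (fun t => / zeta t)%C). apply cts_const.
    apply (cts_comp zeta Cinv); auto. intros t. eapply Cder_cont. apply Cder_inv.
    apply Cmod_gt_0. rewrite Cmod_zeta. apply rho_pos. }
  assert (Hk : cts (fun t => ker t)) by exact cts_ker.
  assert (Hps : forall m, cts (fun t => psum (fun k => Cconj (cis t) ^ k / rho ^ k)%C z m)).
  { induction m; simpl. apply cts_const. apply cts_plus; auto. unfold Cdiv. solve_cts. }
  rewrite (circle_mean_ext _ (fun t => g t * psum (fun k => Cconj (cis t) ^ k / rho ^ k) z n + g t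
    * ((z / zeta t) ^ n * ker t))%C).
  2:{ intros t. rewrite (ker_expand n t) at 1. ring. }
  rewrite circle_mean_plus. 2: now apply cts_mult.
  2: apply cts_mult; auto; apply (cts_mult (fun t => (z / zeta t) ^ n)%C ker); auto; now apply cts_pow.
  f_equal. induction n; simpl.
  - rewrite (circle_mean_ext _ (fun _ => RtoC 0)). apply circle_mean_const. intros; ring.
  - rewrite <- IHn.
    rewrite (circle_mean_ext _ (fun t => g t * psum (fun k => Cconj (cis t) ^ k / rho ^ k) z n + (z
      ^ n / rho ^ n) * (g t * Cconj (cis t) ^ n))%C).
    rewrite circle_mean_plus. rewrite circle_mean_scal. unfold Cdiv. ring. solve_cts.
    apply cts_mult; auto. solve_cts.
    intros t. unfold Cdiv. ring.
Qed.

Lemma cauchy_rem g : cts g -> exists A q, 0 <= q < 1 /\ forall n,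
  Cmod (circle_mean (fun t => g t * ((z / zeta t) ^ n * ker t)))%C <= A * q ^ n.
Proof.
  intros Hg. pose proof rho_pos as Hrp.
  exists (Re (circle_mean (fun t => Cmod (g t) : C)) * (rho / (rho - Cmod z))), (Cmod z / rho).
  assert (Hq : 0 <= Cmod z / rho < 1).
  { split. apply Rle_mult_inv_pos; auto. apply Cmod_ge_0. apply (Rmult_lt_reg_r rho); auto.
    unfold Rdiv. rewrite Rmult_assoc, Rinv_l; lra. }
  split; auto. intros n.
  assert (Hzt : forall t, zeta t <> 0). { intros t. apply Cmod_gt_0. rewrite Cmod_zeta.
  apply rho_pos. }
  assert (Hw : cts (fun t => z / zeta t)%C).
  { unfold Cdiv. apply (cts_mult (fun _ => z) (fun t => / zeta t)%C). apply cts_const.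
    apply (cts_comp zeta Cinv); auto. intros t. eapply Cder_cont. now apply Cder_inv. }
  set (K := (rho / (rho - Cmod z) * (Cmod z / rho) ^ n)).
  replace (Re (circle_mean (fun t => Cmod (g t) : C)) * (rho / (rho - Cmod z)) * (Cmod z / rho) ^
    n) with (Re (circle_mean (fun t => RtoC K * (Cmod (g t) : C))%C)).
  2:{ rewrite circle_mean_scal by now apply cts_Cmod. unfold K.
      destruct (circle_mean (fun t => Cmod (g t) : C)) as [x y]. simpl. ring. }
  apply circle_mean_bound.
  - apply cts_mult; auto. apply (cts_mult (fun t => (z / zeta t) ^ n)%C ker); auto.
    now apply cts_pow.
  - apply cts_mult. apply cts_const. now apply cts_Cmod.
  - intros t. rewrite <- RtoC_mult. simpl Re.
    rewrite !Cmod_mult, Cmod_pow, Cmod_div, Cmod_zeta by auto.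
    rewrite (Rmult_comm K). apply Rmult_le_compat_l. apply Cmod_ge_0. unfold K. rewrite Rmult_comm.
    apply Rmult_le_compat_r. apply pow_le; lra.
    unfold ker. rewrite Cmod_div, Cmod_zeta by auto. apply Rmult_le_compat_l. lra.
    apply Rinv_le_contravar. lra. pose proof (Cmod_triangle_rev (zeta t) z).
    now rewrite Cmod_zeta in H.
Qed.

(** The expansion of the kernel with [g] constant: only the mode 0 survives and the remainder
    tends to 0. *)
Lemma circle_mean_ker : circle_mean ker = 1.
Proof.
  destruct (cauchy_rem (fun _ => RtoC 1) (cts_const _)) as [A [q [Hq HA]]].
  apply Ceq_minus. apply (geom_zero _ q A 1 Hq). intros n Hn. specialize (HA n).
  replace (circle_mean ker) with (circle_mean (fun t => 1 * ker t)%C) by (apply circle_mean_ext;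
    intros; ring).
  rewrite (ker_partial (fun _ => RtoC 1) n (cts_const _)).
  replace (psum _ z n) with (RtoC 1).
  replace (1 + circle_mean (fun t => 1 * ((z / zeta t) ^ n * ker t)) - 1)%C with (circle_mean (fun
    t => 1 * ((z / zeta t) ^ n * ker t)))%C by ring. exact HA.
  clear HA.
  assert (E : forall k, (circle_mean (fun t => 1 * Cconj (cis t) ^ k)%C = if Nat.eqb 0 k then 1 else 0)).
  { intros k. rewrite <- circle_mean_cis_ortho. apply circle_mean_ext. intros; simpl. ring. }
  induction n as [|[|n] IH]. lia.
  match goal with |- _ = psum ?a z 1 => change (psum a z 1) with (0 + a 0%nat * z ^ 0)%C end.
  cbv beta. rewrite E. simpl. field.
  match goal with |- _ = psum ?a z (S (S n)) => change (psum a z (S (S n))) with (psum a z (S n) +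
    a (S n) * z ^ S n)%C end. cbv beta.
  rewrite <- IH by lia. rewrite E. simpl. unfold Cdiv. ring.
Qed.

Lemma cauchy_series : Clim (psum (fun k => circle_mean (fun t => f (rho * cis t) * Cconj (cis t) ^
  k) / rho ^ k)%C z) (f z).
Proof.
  assert (Hg : cts (fun t => f (zeta t))).
  { apply (holo_cts f rho). now exists f'. pose proof rho_pos; lra. }
  destruct (cauchy_rem _ Hg) as [A [q [Hq HA]]].
  intros eps He. destruct (geometric_eventually_small q A eps Hq He) as [N HN]. exists N.
  intros n Hn.
  specialize (HN n Hn). specialize (HA n). eapply Rle_lt_trans; [|exact HN].
  eapply Rle_trans; [|exact HA].
  replace (f z) with (f z * circle_mean ker)%C by (rewrite circle_mean_ker; ring).
  rewrite <- cauchy_transport, (ker_partial _ n Hg). right. rewrite <- Cmod_opp. f_equal.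
  unfold zeta. ring.
Qed.
End Cauchy.

(** Cauchy's formula on the circle of radius [rho] gives an expansion in the smaller disk, with
    coefficients that depend on [rho] only in appearance. *)
Theorem holo_taylor f : holo f -> exists a, expands_on 1 a f.
Proof.
  intros Hh. assert (Hh' := Hh). destruct Hh as [f' Hf].
  set (c := fun rho k => (circle_mean (fun t => f (RtoC rho * cis t) * Cconj (cis t) ^ k) / RtoC rho ^ k)%C).
  assert (HP : forall rho, 0 < rho < 1 -> expands_on rho (c rho) f).
  { intros rho Hr z Hz. now apply (cauchy_series f f' z rho). }
  exists (c (1/2)). intros z Hz. pose proof (Cmod_ge_0 z).
  set (rho := (Rmax (Cmod z) (1/2) + 1) / 2).
  assert (H1 : Cmod z < rho /\ 1/2 < rho < 1).
  { unfold rho. pose proof (Rmax_l (Cmod z) (1/2)). pose proof (Rmax_r (Cmod z) (1/2)).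
    assert (Rmax (Cmod z) (1/2) < 1) by (apply Rmax_lub_lt; lra). lra. }
  replace (c (1/2)) with (c rho). apply HP; lra.
  (* both expansions have the same Fourier coefficients on the circle of radius 1/4 *)
  apply FunctionalExtensionality.functional_extensionality. intros k.
  assert (Hc : cts (fun t => f (RtoC (1/4) * cis t)%C)) by (apply holo_cts; auto; lra).
  assert (E1 := coef_formula rho (c rho) f (1/4) k (HP rho ltac:(lra)) ltac:(lra) Hc).
  assert (E2 := coef_formula (1/2) (c (1/2)) f (1/4) k (HP (1/2) ltac:(lra)) ltac:(lra) Hc).
  rewrite E1 in E2.
  assert (Hn : (RtoC (1/4) ^ k)%C <> 0). { apply Cpow_nz. intros Q; apply RtoC_inj in Q; lra. }
  replace (c rho k) with (c rho k * RtoC (1/4) ^ k / RtoC (1/4) ^ k)%C by (field; auto). rewrite E2.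
  field. auto.
Qed.

(** * Holomorphic functions in the disk *)

Notation DU := (AbsRing_UniformSpace C_AbsRing).
Notation ccont := (@Ccont (AbsRing_UniformSpace C_AbsRing)).

Lemma holo_const c : holo (fun _ => c).
Proof. exists (fun _ => RtoC 0). split; intros. apply Cder_const. apply (Ccont_const (U:=DU)). Qed.

Lemma holo_plus f g : holo f -> holo g -> holo (fun z => f z + g z)%C.
Proof.
  intros [f' [Hf Hf']] [g' [Hg Hg']]. exists (fun z => f' z + g' z)%C.
  split; intros; [apply Cder_plus|apply (Ccont_plus (U:=DU))]; auto.
Qed.

Lemma holo_mult f g : holo f -> holo g -> holo (fun z => f z * g z)%C.
Proof.
  intros Hf0 Hg0. assert (A1 := fun z => holo_cont f z Hf0).
  assert (A2 := fun z => holo_cont g z Hg0).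
  destruct Hf0 as [f' [Hf Hf']], Hg0 as [g' [Hg Hg']]. exists (fun z => f' z * g z + f z * g' z)%C.
  split; intros. apply Cder_mult; auto.
  apply (Ccont_plus (U:=DU)); apply (Ccont_mult (U:=DU)); auto.
Qed.

Lemma holo_minus f g : holo f -> holo g -> holo (fun z => f z - g z)%C.
Proof.
  intros [f' [Hf Hf']] [g' [Hg Hg']]. exists (fun z => f' z - g' z)%C.
  split; intros; [apply Cder_minus|apply (Ccont_minus (U:=DU))]; auto.
Qed.

Lemma holo_id : holo (fun z => z).
Proof. exists (fun _ => RtoC 1). split; intros. apply Cder_id. apply (Ccont_const (U:=DU)). Qed.

Lemma holo_pow f n : holo f -> holo (fun z => f z ^ n)%C.
Proof. intros H. induction n; simpl. apply holo_const. now apply holo_mult. Qed.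

Lemma holo_psum a n : holo (fun z => psum a z n).
Proof.
  induction n; simpl. apply holo_const. apply holo_plus; auto.
  apply holo_mult. apply holo_const. apply holo_pow, holo_id.
Qed.

Lemma holo_cexp f : holo f -> holo (fun z => cexp (f z)).
Proof.
  intros H0. assert (A := fun z => holo_cont f z H0). destruct H0 as [f' [Hf Hf']].
  exists (fun z => f' z * cexp (f z))%C. split; intros z Hz.
  apply (Cder_comp cexp f). apply Cder_cexp. auto.
  apply (Ccont_mult (U:=DU)); auto. apply (Ccont_comp (U:=DU) f cexp). now apply A.
  apply Cder_cont_cexp.
Qed.

Lemma holo_inv f : holo f -> (forall z, Cmod z < 1 -> f z <> 0) -> holo (fun z => / f z)%C.
Proof.
  intros H0 Hn. assert (A := fun z => holo_cont f z H0). destruct H0 as [f' [Hf Hf']].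
  exists (fun z => f' z * - / (f z * f z))%C. split; intros z Hz.
  apply (Cder_comp Cinv f). now apply Cder_inv, Hn. auto.
  apply (Ccont_mult (U:=DU)); auto.
  apply (Ccont_comp (U:=DU) (fun z => f z * f z)%C (fun w => - / w)%C).
  apply (Ccont_mult (U:=DU)); now apply A.
  eapply Cder_cont. apply (Cder_local (fun w => RtoC (-1) * / w)%C) with (r := 1). lra.
  intros; ring.
  apply Cder_scal. apply Cder_inv. apply Cmult_neq_0; now apply Hn.
Qed.

Lemma expands_ext R a b F : (forall k, a k = b k) -> expands_on R a F -> expands_on R b F.
Proof.
  intros H HF z Hz. specialize (HF z Hz). intros eps He. destruct (HF eps He) as [N HN]. exists N.
  intros n Hn.
  replace (psum b z n) with (psum a z n). auto. clear -H. induction n; simpl; congruence.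
Qed.

Lemma expands_holo a F : expands_on 1 a F -> holo F.
Proof.
  intros H. destruct (expands_dcoef _ _ _ H) as [F' H'].
  destruct (expands_dcoef _ _ _ H') as [F'' H''].
  exists F'. split; intros. now apply (expands_derivative 1 a F F'). eapply Cder_cont.
  now apply (expands_derivative 1 (dcoef a) F' F'').
Qed.

Lemma Cder_unique f z l l' : Cder f z l -> Cder f z l' -> l = l'.
Proof.
  rewrite !Cder_eps. intros H H'. apply Ceq_minus, Cmod_eq_0. apply Rle_antisym; [|apply Cmod_ge_0].
  apply le_epsilon. intros eps He.
  destruct (H (eps/2) ltac:(lra)) as [d [Hd H1]]. destruct (H' (eps/2) ltac:(lra)) as [d' [Hd' H2]].
  set (t := Rmin d d' / 2).
  assert (Ht : 0 < t /\ t < d /\ t < d').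
  { unfold t. pose proof (Rmin_l d d'). pose proof (Rmin_r d d'). pose proof (Rmin_pos d d' Hd Hd').
    lra. }
  specialize (H1 (z + t)%C). specialize (H2 (z + t)%C).
  replace (z + t - z)%C with (RtoC t) in * by ring. rewrite Cmod_R, Rabs_pos_eq in * by lra.
  specialize (H1 ltac:(lra)). specialize (H2 ltac:(lra)).
  apply (Rmult_le_reg_r t). lra. rewrite Rplus_0_l.
  replace (Cmod (l - l') * t) with (Cmod ((l - l') * t)%C) by (rewrite Cmod_mult, Cmod_R, Rabs_pos_eq; lra).
  replace ((l - l') * t)%C with ((f (z + t) - f z - l' * t) - (f (z + t) - f z - l * t))%C by ring.
  eapply Rle_trans; [apply Cmod_triangle_minus|]. lra.
Qed.

(** Near each point a local expansion provides the derivative and, being differentiable twice,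
    its continuity; uniqueness of derivatives glues the local choices. *)
Lemma analytic_holo f : analytic_on_disk f -> holo f.
Proof.
  intros Hf.
  assert (Hloc : forall z0, Cmod z0 < 1 -> exists r F', 0 < r /\ ccont F' (RtoC 0) /\
     forall z, Cmod (z - z0)%C < r -> Cder f z (F' (z - z0)%C)).
  { intros z0 Hz0. destruct (Hf z0 Hz0) as [r0 [a [Hr0 Ha]]].
    set (r := Rmin r0 (1 - Cmod z0)). assert (Hr : 0 < r) by (apply Rmin_pos; lra).
    set (F := fun h => f (z0 + h)%C).
    assert (HF : expands_on r a F).
    { intros h Hh. unfold F. assert (Cmod h < r0 /\ Cmod h < 1 - Cmod z0).
      { pose proof (Rmin_l r0 (1 - Cmod z0)). pose proof (Rmin_r r0 (1 - Cmod z0)).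
        unfold r in Hh; lra. }
      specialize (Ha (z0 + h)%C). rewrite power_series_at_iff in Ha.
      replace (z0 + h - z0)%C with h in Ha by ring.
      apply Ha. tauto. unfold disk. eapply Rle_lt_trans; [apply Cmod_triangle|]. lra. }
    destruct (expands_dcoef _ _ _ HF) as [F' HF']. destruct (expands_dcoef _ _ _ HF') as [F'' HF''].
    exists r, F'. split; [exact Hr|split].
    - eapply Cder_cont. apply (expands_derivative r (dcoef a) F' F''); auto. rewrite Cmod_0; lra.
    - intros z Hz. apply (Cder_local (fun w => F (w - z0)%C)) with (r := 1). lra.
      intros w _. unfold F. f_equal. ring.
      eapply Cder_eq. apply (Cder_comp F (fun w => w - z0)%C z (F' (z - z0)%C) 1).
      now apply (expands_derivative r a F F'). eapply Cder_eq. apply Cder_minus. apply Cder_id.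
      apply Cder_const. ring. ring. }
  exists (fun z => epsilon (inhabits (RtoC 0)) (fun l => Cder f z l)).
  assert (Hd : forall z l, Cder f z l -> epsilon (inhabits (RtoC 0)) (fun l => Cder f z l) = l).
  { intros z l H. apply (Cder_unique f z); auto.
    apply (epsilon_spec (inhabits (RtoC 0)) (fun l => Cder f z l)). now exists l. }
  split; intros z Hz; destruct (Hloc z Hz) as [r [F' [Hr [Hc HF]]]].
  - assert (H := HF z). replace (z - z)%C with (RtoC 0) in H by ring. rewrite Cmod_0 in H.
    specialize (H Hr).
    now rewrite (Hd _ _ H).
  - apply Ccont_eps. intros eps He. destruct (proj1 (Ccont_eps _ _) Hc eps He) as [d [Hd' H1]].
    exists (Rmin d r). split. now apply Rmin_pos. intros w Hw.
    assert (Hw1 := Rlt_le_trans _ _ _ Hw (Rmin_l _ _)).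
    assert (Hw2 := Rlt_le_trans _ _ _ Hw (Rmin_r _ _)).
    rewrite (Hd _ _ (HF w Hw2)). assert (H := HF z). replace (z - z)%C with (RtoC 0) in H by ring.
    rewrite Cmod_0 in H. rewrite (Hd _ _ (H Hr)).
    apply H1. now replace (w - z - 0)%C with (w - z)%C by ring.
Qed.

Lemma expands_at_0 R a F : 0 < R -> expands_on R a F -> F 0 = a 0%nat.
Proof.
  intros HR H. assert (H0 : Cmod 0 < R) by (rewrite Cmod_0; lra). specialize (H _ H0).
  apply (Clim_unique _ _ _ H). intros eps He. exists 1%nat. intros [|n] Hn. lia.
  replace (psum a 0 (S n)) with (a 0%nat). replace (a 0%nat - a 0%nat)%C with (RtoC 0) by ring.
  now rewrite Cmod_0.
  clear Hn. induction n. simpl; ring.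
  change (a 0%nat = psum a 0 (S n) + a (S n) * (0 * 0 ^ n))%C. rewrite <- IHn. ring.
Qed.

Lemma Cder_zero_const Q : (forall z, Cmod z < 1 -> Cder Q z 0) -> forall z, Cmod z < 1 -> Q z = Q 0.
Proof.
  intros H z Hz.
  assert (HQ : forall s : R, 0 <= s <= 1 -> Cder (fun w => Q (w * z)%C) s 0).
  { intros s Hs. eapply Cder_eq. apply (Cder_comp Q (fun w => w * z)%C). apply H.
    rewrite Cmod_mult, Cmod_R, Rabs_pos_eq by lra. pose proof (Cmod_ge_0 z). nra.
    apply (Cder_mult (fun w => w) (fun _ => z)). apply Cder_id. apply Cder_const. ring. }
  assert (E1 : Re (Q (0 * z)%C) = Re (Q (1 * z)%C)).
  { apply (eq_is_derive (fun s : R => Re (Q (s * z)%C)) 0 1). intros t Ht.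
    apply (Cder_Re (fun w => Q (w * z)%C) t 0). auto. lra. }
  assert (E2 : Im (Q (0 * z)%C) = Im (Q (1 * z)%C)).
  { apply (eq_is_derive (fun s : R => Im (Q (s * z)%C)) 0 1). intros t Ht.
    apply (Cder_Im (fun w => Q (w * z)%C) t 0). auto. lra. }
  replace (0 * z)%C with (RtoC 0) in * by ring. replace (1 * z)%C with z in * by ring.
  destruct (Q z), (Q 0). unfold Re, Im in *. simpl in *. congruence.
Qed.

(** * Logarithms and Harnack's inequality *)

(** [G] is the primitive of [f' / f] obtained by integrating its Taylor series term by term;
    then [f * cexp (- G)] has derivative 0 and is constant on the disk. Positivity of [f 0]
    makes its logarithm a real number. *)
Lemma holo_log f x0 : holo f -> (forall z, Cmod z < 1 -> f z <> 0) -> 0 < x0 -> f 0 = x0 ->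
  exists g G, expands_on 1 g G /\ g 0%nat = ln x0 /\ forall z, Cmod z < 1 -> f z = cexp (G z).
Proof.
  intros Hf Hn Hx0 Hf0. destruct (holo_taylor f Hf) as [a Ha].
  destruct (expands_dcoef _ _ _ Ha) as [f1 H1].
  set (h := fun z => (f1 z * / f z)%C).
  assert (Hh : holo h). { apply holo_mult. now apply (expands_holo (dcoef a)). now apply holo_inv. }
  destruct (holo_taylor h Hh) as [b Hb].
  set (g := fun k => match k with O => RtoC (ln x0) | S k => (b k / INR (S k))%C end).
  assert (Hg : forall s, 0 < s < 1 -> geom_bounded g s).
  { intros s Hs. destruct (expands_geom_bounded _ _ _ s Hb ltac:(lra)) as [M [HM HMb]].
    exists (M + Rabs (ln x0)). split. pose proof (Rabs_pos (ln x0)); lra. intros [|k].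
    - simpl. rewrite Cmod_R. lra.
    - unfold g. assert (Hk : 1 <= INR (S k)) by (rewrite S_INR; pose proof (pos_INR k); lra).
      rewrite Cmod_div, Cmod_R, Rabs_pos_eq by (try lra; intros Q; apply RtoC_inj in Q; lra).
      specialize (HMb k). simpl pow. pose proof (Cmod_ge_0 (b k)).
      pose proof (pow_lt s k (proj1 Hs)). pose proof (Rabs_pos (ln x0)).
      apply Rle_trans with (Cmod (b k) * s ^ k); [|lra].
      replace (Cmod (b k) / INR (S k) * (s * s ^ k)) with (Cmod (b k) * s ^ k * (s / INR (S k))) by
        (field; lra).
      rewrite <- (Rmult_1_r (Cmod (b k) * s ^ k)) at 2. apply Rmult_le_compat_l. nra.
      apply (Rmult_le_reg_r (INR (S k))). lra. unfold Rdiv. rewrite Rmult_assoc, Rinv_l; lra. }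
  destruct (geom_bounded_sum 1 g Hg) as [G HG]. exists g, G. split; auto. split; auto.
  assert (Hdg : expands_on 1 (dcoef g) h).
  { apply (expands_ext _ b); auto. intros k. unfold dcoef, g. field. intros Q; apply RtoC_inj in Q.
    apply (not_0_INR (S k)); auto. }
  assert (HQ : forall z, Cmod z < 1 -> Cder (fun z => f z * cexp (RtoC (-1) * G z))%C z 0).
  { intros z Hz. eapply Cder_eq. apply Cder_mult. apply (expands_derivative _ _ _ _ Ha H1 z Hz).
    apply (Cder_comp cexp (fun z => RtoC (-1) * G z)%C). apply Cder_cexp. apply Cder_scal.
    apply (expands_derivative _ _ _ _ HG Hdg z Hz).
    unfold h. field. auto. }
  intros z Hz. assert (E := Cder_zero_const _ HQ z Hz). simpl in E.
  rewrite (expands_at_0 1 g G), Hf0 in E by (auto; lra). simpl in E.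
  rewrite <- RtoC_mult, cexp_RtoC, <- RtoC_mult in E.
  replace (x0 * exp (-1 * ln x0)) with 1 in E.
  2:{ replace (-1 * ln x0) with (- ln x0) by ring. rewrite exp_Ropp, exp_ln by lra. field; lra. }
  replace (f z) with (f z * cexp (RtoC (-1) * G z) * cexp (G z))%C. rewrite E. ring.
  rewrite <- Cmult_assoc, <- cexp_add. replace (RtoC (-1) * G z + G z)%C with (RtoC 0) by ring.
  rewrite cexp_0. ring.
Qed.

Lemma bernoulli_neg x k : 0 <= x <= 1 -> 1 - INR k * x <= (1 - x) ^ k.
Proof.
  intros Hx. induction k. simpl; lra.
  rewrite S_INR. change ((1 - x) ^ S k) with ((1 - x) * (1 - x) ^ k).
  assert (0 <= INR k) by apply pos_INR.
  assert ((1 - x) * (1 - INR k * x) <= (1 - x) * (1 - x) ^ k) by (apply Rmult_le_compat_l; lra).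
  nra.
Qed.

(** Estimates on circles of radius [r < 1] pass to the unit circle: [(1 - x) ^ k >= 1 - k x],
    and [x] is chosen so small that the loss is at most [eps]. *)
Lemma le_radius_limit s B k : 0 <= s -> (forall r, 0 < r < 1 -> s * r ^ k <= B) -> s <= B.
Proof.
  intros Hs H. apply le_epsilon. intros eps He.
  set (x := eps / (eps + 1 + s * (INR k + 1))).
  assert (Hk : 0 <= INR k) by apply pos_INR.
  assert (Hd : 0 < eps + 1 + s * (INR k + 1)) by nra.
  assert (Hx : 0 < x < 1). { unfold x. split. now apply Rdiv_lt_0_compat.
  apply (Rmult_lt_reg_r (eps + 1 + s * (INR k + 1))); auto. unfold Rdiv.
  rewrite Rmult_assoc, Rinv_l by lra. nra. }
  assert (Hc := H (1 - x) ltac:(lra)). assert (Hb := bernoulli_neg x k ltac:(lra)).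
  assert (s * INR k * x <= eps).
  { unfold x. apply (Rmult_le_reg_r (eps + 1 + s * (INR k + 1))); auto.
    replace (s * INR k * (eps / (eps + 1 + s * (INR k + 1))) * (eps + 1 + s * (INR k + 1))) with (s
      * INR k * eps) by (field; lra).
    assert (0 <= s * INR k) by now apply Rmult_le_pos. nra. }
  nra.
Qed.

(** As [G] has no negative modes, its [n]-th coefficient is also that of [2 Re G], whose sign
    makes its mean equal to its mean modulus. *)
Lemma caratheodory_coef g G r n : expands_on 1 g G -> 0 < r < 1 ->
  (forall z, Cmod z < 1 -> Re (G z) <= 0) -> (0 < n)%nat ->
  Cmod (g n) * r ^ n <= - 2 * Re (g 0%nat).
Proof.
  intros HG Hr Hre Hn. assert (Hc := expands_cts 1 g G r HG ltac:(lra)). assert (Hcc := cts_cis).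
  assert (E1 := coef_formula 1 g G r n HG Hr Hc).
  assert (E2 := coef_formula_neg 1 g G r n HG Hr Hc Hn).
  assert (E0 := coef_formula 1 g G r 0 HG Hr Hc).
  assert (E3 : circle_mean (fun t => Cconj (G (r * cis t)) * Cconj (cis t) ^ n)%C = 0).
  { transitivity (Cconj (circle_mean (fun t => G (r * cis t) * cis t ^ n)%C)).
    rewrite <- circle_mean_conj by solve_cts. apply circle_mean_ext. intros t. rewrite <- Cpow_conj.
    destruct (G (r * cis t)%C), (cis t ^ n)%C. unfold Cconj, Cmult; simpl; f_equal; ring.
    rewrite E2. unfold Cconj, RtoC; simpl. f_equal; ring. }
  assert (E4 : circle_mean (fun t => RtoC 2 * (Re (G (r * cis t)%C)) * Cconj (cis t) ^ n)%C =
    (g n * r ^ n)%C).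
  { rewrite (circle_mean_ext _ (fun t => G (r * cis t) * Cconj (cis t) ^ n + Cconj (G (r * cis t))
      * Cconj (cis t) ^ n)%C).
    rewrite circle_mean_plus by solve_cts. rewrite E1, E3. ring.
    intros t. rewrite <- Cmult_plus_distr_r. f_equal. destruct (G (r * cis t)%C).
    unfold Cconj, RtoC, Cmult, Cplus; simpl. f_equal; ring. }
  replace (Cmod (g n) * r ^ n) with (Cmod (g n * r ^ n)%C) by (rewrite Cmod_mult, Cmod_pow, Cmod_R,
    Rabs_pos_eq; lra).
  rewrite <- E4.
  replace (-2 * Re (g 0%nat)) with (Re (circle_mean (fun t => RtoC (-2) * (G (r * cis t) * Cconj
    (cis t) ^ 0))%C)).
  2:{ rewrite circle_mean_scal by solve_cts. rewrite E0. destruct (g 0%nat). simpl. ring. }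
  apply circle_mean_bound.
  - apply cts_mult; [|solve_cts]. apply cts_mult. apply cts_const. intros t. apply Ccont_RtoC.
    apply Ccont_Re. apply Hc.
  - solve_cts.
  - intros t. rewrite !Cmod_mult, !Cmod_R, Cmod_pow, Cmod_conj, Cmod_cis, pow1.
    assert (Hneg : Re (G (r * cis t)%C) <= 0). { apply Hre.
    rewrite Cmod_mult, Cmod_cis, Cmod_R, Rabs_pos_eq; lra. }
    rewrite (Rabs_left1 (Re _)), (Rabs_pos_eq 2) by lra. destruct (G (r * cis t)%C). simpl in *.
    lra.
Qed.

(** The coefficients of [G] are bounded by [- 2 Re (g 0)], and the geometric series gives the
    growth; [g 0] is real, which keeps the same constant for the index 0. *)
Lemma harnack_lower_bound g G : expands_on 1 g G ->
  (forall z, Cmod z < 1 -> Re (G z) <= 0) -> Im (g 0%nat) = 0 ->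
  forall z, Cmod z < 1 -> - Re (G z) <= - 2 * Re (g 0%nat) / (1 - Cmod z).
Proof.
  intros HG Hre Him z Hz.
  assert (H0 : Re (g 0%nat) <= 0). { rewrite <- (expands_at_0 1 g G) by (auto; lra). apply Hre.
  rewrite Cmod_0; lra. }
  assert (Hn : forall n, Cmod (g n) * 1 ^ n <= - 2 * Re (g 0%nat)).
  { intros [|n].
    - simpl. assert (Cmod (g 0%nat) <= - Re (g 0%nat)); [|lra].
      eapply Rle_trans; [apply Cmod_le_Re_Im|]. rewrite Him, Rabs_R0, Rabs_left1; lra.
    - rewrite pow1, Rmult_1_r. apply le_radius_limit with (k := S n). apply Cmod_ge_0.
      intros r Hr. apply (caratheodory_coef g G); auto; lia. }
  assert (HT := expands_tail 1 g G 1 (-2 * Re (g 0%nat)) z 0 HG ltac:(lra) Hn Hz Hz). simpl in HT.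
  replace (G z - 0)%C with (G z) in HT by ring. unfold Rdiv in HT. rewrite Rinv_1, !Rmult_1_r in HT.
  pose proof (re_le_Cmod (G z)). pose proof (Rle_abs (- Re (G z))). rewrite Rabs_Ropp in H1.
  unfold Rdiv. lra.
Qed.

Lemma coef_bound R a F r M k : expands_on R a F -> 0 < r < R -> (forall z, Cmod z = r -> Cmod (F z) <= M) ->
  Cmod (a k) * r ^ k <= M.
Proof.
  intros H Hr HM. assert (Hc := expands_cts R a F r H ltac:(lra)). assert (Hcc := cts_cis).
  replace (Cmod (a k) * r ^ k) with (Cmod (a k * r ^ k)%C) by (rewrite Cmod_mult, Cmod_pow, Cmod_R,
    Rabs_pos_eq; lra).
  rewrite <- (coef_formula R a F r k) by auto. apply circle_mean_bound_const. solve_cts.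
  intros t. rewrite Cmod_mult, Cmod_pow, Cmod_conj, Cmod_cis, pow1, Rmult_1_r. apply HM.
  rewrite Cmod_mult, Cmod_cis, Cmod_R, Rabs_pos_eq; lra.
Qed.

(** * The weighted space *)

Lemma sum_n_le_R (u v : nat -> R) n : (forall k, (k <= n)%nat -> u k <= v k) -> sum_n u n <= sum_n v n.
Proof.
  induction n; intros H. rewrite !sum_O; auto. rewrite !sum_Sn. apply Rplus_le_compat; auto.
Qed.

Lemma sum_n_scal_R (c : R) (u : nat -> R) n : sum_n (fun k => c * u k) n = c * sum_n u n.
Proof. induction n. now rewrite !sum_O. rewrite !sum_Sn, IHn. unfold plus; simpl. ring. Qed.

Lemma sum_n_pos (u : nat -> R) n : (forall k, 0 <= u k) -> 0 <= sum_n u n.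
Proof.
  intros H. induction n. rewrite sum_O; auto. rewrite sum_Sn. unfold plus; simpl.
  specialize (H (S n)). lra.
Qed.

(** Bessel's inequality on circles of radius [r], and [r] tends to 1. *)
Lemma bounded_holo_l2 a F M n : expands_on 1 a F -> (forall z, Cmod z < 1 -> Cmod (F z) <= M) ->
  sum_n (fun k => Cmod (a k) ^ 2) n <= M ^ 2.
Proof.
  intros H HM. apply le_radius_limit with (k := (2 * n)%nat). apply sum_n_pos. intros k.
  apply pow2_ge_0.
  intros r Hr. eapply Rle_trans; [|apply (expands_bessel 1 a F r M n H Hr)].
  - rewrite Rmult_comm, <- sum_n_scal_R. apply sum_n_le_R. intros k Hk.
    rewrite Rpow_mult_distr, Rmult_comm. apply Rmult_le_compat_l. apply pow2_ge_0.
    rewrite <- pow_mult. replace (2 * n)%nat with ((k * 2) + (2 * n - k * 2))%nat by lia.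
    rewrite pow_add.
    rewrite <- (Rmult_1_r (r ^ (k * 2))) at 2. apply Rmult_le_compat_l. apply pow_le; lra.
    rewrite <- (pow1 (2 * n - k * 2)). apply pow_incr; lra.
  - intros z Hz. apply HM. lra.
Qed.

(** The norm of [F] is at most [eps]: a bound on all partial sums, which needs no prior
    convergence, in place of the value of the series. *)
Definition A2_bound (omega : nat -> R) (F : C -> C) (eps : R) : Prop :=
  exists a, expands_on 1 a F /\ forall n, sum_n (fun k => Cmod (a k) ^ 2 / omega k ^ 2) n <= eps ^ 2.

Lemma psum_plus a b z n : psum (fun k => a k + b k)%C z n = (psum a z n + psum b z n)%C.
Proof. induction n; simpl. ring. rewrite IHn. ring. Qed.

Lemma psum_scal c a z n : psum (fun k => c * a k)%C z n = (c * psum a z n)%C.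
Proof. induction n; simpl. ring. rewrite IHn. ring. Qed.

Lemma Clim_ext u v l : (forall n, u n = v n) -> Clim u l -> Clim v l.
Proof. intros E H eps He. destruct (H eps He) as [N HN]. exists N. intros n Hn. rewrite <- E. auto.
Qed.

Lemma Clim_plus u v l m : Clim u l -> Clim v m -> Clim (fun n => u n + v n)%C (l + m)%C.
Proof.
  intros H1 H2 eps He. destruct (H1 (eps/2) ltac:(lra)) as [N1 HN1].
  destruct (H2 (eps/2) ltac:(lra)) as [N2 HN2].
  exists (max N1 N2). intros n Hn. specialize (HN1 n ltac:(lia)). specialize (HN2 n ltac:(lia)).
  replace (u n + v n - (l + m))%C with ((u n - l) + (v n - m))%C by ring.
  eapply Rle_lt_trans; [apply Cmod_triangle|]. lra.
Qed.

Lemma Clim_scal c u l : Clim u l -> Clim (fun n => c * u n)%C (c * l)%C.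
Proof.
  intros H eps He. pose proof (Cmod_ge_0 c).
  destruct (H (eps / (Cmod c + 1))) as [N HN]. apply Rdiv_lt_0_compat; lra.
  exists N. intros n Hn. specialize (HN n Hn).
  rewrite <- Cmult_minus_distr_l || replace (c * u n - c * l)%C with (c * (u n - l))%C by ring.
  rewrite Cmod_mult. apply (Rmult_lt_compat_r (Cmod c + 1)) in HN; [|lra].
  unfold Rdiv in HN. rewrite Rmult_assoc, Rinv_l in HN by lra. pose proof (Cmod_ge_0 (u n - l)%C).
  nra.
Qed.

Lemma expands_plus R a b F G : expands_on R a F -> expands_on R b G ->
  expands_on R (fun k => a k + b k)%C (fun z => F z + G z)%C.
Proof.
  intros H1 H2 z Hz. eapply Clim_ext. intros n. symmetry. apply psum_plus. apply Clim_plus; auto.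
Qed.

Lemma expands_scal R c a F : expands_on R a F -> expands_on R (fun k => c * a k)%C (fun z => c * F z)%C.
Proof.
  intros H1 z Hz. eapply Clim_ext. intros n. symmetry. apply psum_scal. apply Clim_scal; auto.
Qed.

Definition shift_coef (a : nat -> C) (k : nat) : C := match k with O => RtoC 0 | S k => a k end.

Lemma psum_shift a z n : psum (shift_coef a) z (S n) = (z * psum a z n)%C.
Proof.
  induction n. simpl. ring.
  change (psum (shift_coef a) z (S n) + a n * z ^ S n = z * (psum a z n + a n * z ^ n))%C.
  rewrite IHn, Cpow_S. ring.
Qed.

Lemma expands_shift R a F : expands_on R a F -> expands_on R (shift_coef a) (fun z => z * F z)%C.
Proof.
  intros H z Hz.
  intros eps He. destruct (Clim_scal z _ _ (H z Hz) eps He) as [N HN]. exists (S N). intros [|n] Hn.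
  lia.
  rewrite psum_shift. apply HN. lia.
Qed.

Lemma expands_fun_ext R a F G : (forall z, Cmod z < R -> F z = G z) -> expands_on R a F -> expands_on R a G.
Proof. intros E H z Hz. rewrite <- E; auto. Qed.

Lemma A2_bound_ext omega F G eps : (forall z, Cmod z < 1 -> F z = G z) -> A2_bound omega F eps ->
  A2_bound omega G eps.
Proof. intros E [a [H1 H2]]. exists a. split; auto. now apply (expands_fun_ext 1 a F). Qed.

Section Weighted.
Variable omega : nat -> R.
Hypothesis omega_pos : forall n, 0 < omega n.
Hypothesis omega_mono : forall m n, (m <= n)%nat -> omega m <= omega n.

Lemma A2_bound_le F e e' : 0 <= e <= e' -> A2_bound omega F e -> A2_bound omega F e'.
Proof.
  intros H [a [H1 H2]]. exists a. split; auto. intros n. eapply Rle_trans; [apply H2|].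
  apply pow_incr; lra.
Qed.

(** Minkowski's inequality, from [(x + y) ^ 2 <= (1 + e2 / e1) x ^ 2 + (1 + e1 / e2) y ^ 2],
    with equality when [x] and [y] are in the ratio of [e1] to [e2]. *)
Lemma A2_bound_plus F G e1 e2 : 0 < e1 -> 0 < e2 -> A2_bound omega F e1 -> A2_bound omega G e2 ->
  A2_bound omega (fun z => F z + G z)%C (e1 + e2).
Proof.
  intros He1 He2 [a [Ha1 Ha2]] [b [Hb1 Hb2]]. exists (fun k => a k + b k)%C. split.
  now apply expands_plus.
  intros n.
  apply Rle_trans with ((1 + e2 / e1) * sum_n (fun k => Cmod (a k) ^ 2 / omega k ^ 2) n + (1 + e1 /
    e2) * sum_n (fun k => Cmod (b k) ^ 2 / omega k ^ 2) n).
  - rewrite <- !sum_n_scal_R.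
    rewrite <- (sum_n_plus (G:=R_AbelianMonoid) (fun k => (1 + e2 / e1) * (Cmod (a k) ^ 2 / omega k
      ^ 2)) (fun k => (1 + e1 / e2) * (Cmod (b k) ^ 2 / omega k ^ 2))).
    apply sum_n_le_R. intros k _.
    match goal with |- ?l <= _ => change (l <= (1 + e2 / e1) * (Cmod (a k) ^ 2 / omega k ^ 2) + (1
      + e1 / e2) * (Cmod (b k) ^ 2 / omega k ^ 2)) end.
    pose proof (omega_pos k). pose proof (Cmod_triangle (a k) (b k)).
    pose proof (Cmod_ge_0 (a k + b k)%C).
    set (x := Cmod (a k)) in *. set (y := Cmod (b k)) in *. set (s := Cmod (a k + b k)%C) in *.
    replace ((1 + e2 / e1) * (x ^ 2 / omega k ^ 2) + (1 + e1 / e2) * (y ^ 2 / omega k ^ 2)) with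
      (((x + y) ^ 2 + (e2 * x - e1 * y) ^ 2 / (e1 * e2)) / omega k ^ 2) by (field; lra).
    apply Rmult_le_compat_r. left; apply Rinv_0_lt_compat; nra.
    assert (0 <= (e2 * x - e1 * y) ^ 2 / (e1 * e2)). { apply Rle_mult_inv_pos. apply pow2_ge_0. nra.
    }
    assert (s ^ 2 <= (x + y) ^ 2) by (apply pow_incr; lra). lra.
  - replace ((e1 + e2) ^ 2) with ((1 + e2 / e1) * e1 ^ 2 + (1 + e1 / e2) * e2 ^ 2) by (field; lra).
    assert (0 < e2 / e1) by now apply Rdiv_lt_0_compat.
    assert (0 < e1 / e2) by now apply Rdiv_lt_0_compat.
    apply Rplus_le_compat; apply Rmult_le_compat_l; auto; lra.
Qed.

Lemma A2_bound_scal c F e : A2_bound omega F e -> A2_bound omega (fun z => c * F z)%C (Cmod c * e).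
Proof.
  intros [a [H1 H2]]. exists (fun k => c * a k)%C. split. now apply expands_scal. intros n.
  rewrite (sum_n_ext _ (fun k => Cmod c ^ 2 * (Cmod (a k) ^ 2 / omega k ^ 2))).
  rewrite sum_n_scal_R, Rpow_mult_distr. apply Rmult_le_compat_l. apply pow2_ge_0. apply H2.
  intros k. rewrite Cmod_mult, Rpow_mult_distr. apply Rmult_assoc.
Qed.

(** The shift moves each coefficient to a larger weight, hence is a contraction. *)
Lemma A2_bound_shift F e : A2_bound omega F e -> A2_bound omega (fun z => z * F z)%C e.
Proof.
  intros [a [H1 H2]]. exists (shift_coef a). split. now apply expands_shift.
  intros [|n]. rewrite sum_O. simpl. rewrite Cmod_0. unfold Rdiv. rewrite !Rmult_0_l.
  pose proof (pow2_ge_0 e). simpl in H. lra.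
  eapply Rle_trans; [|apply (H2 n)].
  induction n.
  - rewrite sum_Sn, !sum_O. unfold plus; simpl plus. unfold shift_coef. rewrite Cmod_0.
    pose proof (omega_pos 0%nat). pose proof (omega_pos 1%nat).
    pose proof (omega_mono 0 1 ltac:(lia)).
    replace (0 ^ 2 / omega 0%nat ^ 2) with 0 by (field; lra). rewrite Rplus_0_l.
    apply Rmult_le_compat_l. apply pow2_ge_0. apply Rinv_le_contravar. nra. nra.
  - rewrite (sum_Sn _ (S n)), (sum_Sn (fun k => Cmod (a k) ^ 2 / omega k ^ 2) n).
    apply Rplus_le_compat; auto. unfold shift_coef.
    pose proof (omega_pos (S n)). pose proof (omega_pos (S (S n))).
    pose proof (omega_mono (S n) (S (S n)) ltac:(lia)).
    apply Rmult_le_compat_l. apply pow2_ge_0. apply Rinv_le_contravar. nra. nra.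
Qed.

Lemma A2_bound_zpow F e n : A2_bound omega F e -> A2_bound omega (fun z => z ^ n * F z)%C e.
Proof.
  intros H. induction n. revert H. apply A2_bound_ext. intros; simpl; ring.
  apply A2_bound_shift in IHn. revert IHn. apply A2_bound_ext. intros; simpl; ring.
Qed.

Lemma A2_bound_psum c n :
  exists K, 0 < K /\ forall F e, 0 < e -> A2_bound omega F e ->
    A2_bound omega (fun z => psum c z n * F z)%C (K * e).
Proof.
  induction n as [|n [K [HK H]]].
  - exists 1. split. lra. intros F e He HF.
    apply (A2_bound_ext _ (fun z => 0 * F z)%C). intros; simpl; ring.
    apply (A2_bound_le _ (Cmod 0 * e)). rewrite Cmod_0; lra. now apply A2_bound_scal.
  - exists (K + (Cmod (c n) + 1)). pose proof (Cmod_ge_0 (c n)). split. lra. intros F e He HF.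
    apply (A2_bound_ext _ (fun z => psum c z n * F z + c n * (z ^ n * F z))%C). intros; simpl; ring.
    rewrite Rmult_plus_distr_r. apply A2_bound_plus. nra. nra. now apply H.
    apply (A2_bound_le _ (Cmod (c n) * e)). nra. now apply A2_bound_scal, A2_bound_zpow.
Qed.

Lemma A2_bound_norm F e : 0 <= e -> A2_bound omega F e -> exists N, is_A2_norm omega F N /\ N <= e.
Proof.
  intros He [a [H1 H2]].
  set (u := fun n => Cmod (a n) ^ 2 / omega n ^ 2) in *.
  assert (Hu : forall n, 0 <= u n). { intros n. apply Rle_mult_inv_pos. apply pow2_ge_0.
  apply pow_lt, omega_pos. }
  destruct (ex_finite_lim_seq_incr (sum_n u) (e ^ 2)) as [l Hl].
  intros n. rewrite sum_Sn. unfold plus; simpl. specialize (Hu (S n)). lra. exact H2.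
  assert (Hl0 : 0 <= l). { apply (is_lim_seq_le (fun _ => 0) (sum_n u) 0 l). intros n.
  now apply sum_n_pos. apply is_lim_seq_const. exact Hl. }
  assert (Hl1 : l <= e ^ 2). { apply (is_lim_seq_le (sum_n u) (fun _ => e ^ 2) l (e ^ 2)). exact H2.
  exact Hl. apply is_lim_seq_const. }
  exists (sqrt l). split. split. apply sqrt_pos. exists a. split. now apply taylor_iff.
  rewrite pow2_sqrt by auto. exact Hl.
  rewrite <- (sqrt_pow2 e He). now apply sqrt_le_1_alt.
Qed.

Lemma A2_bound_in_A2 F e : 0 <= e -> A2_bound omega F e -> in_A2 omega F.
Proof.
  intros He H. destruct (A2_bound_norm F e He H) as [N [[_ [a [H1 H2]]] _]]. exists a. split; auto.
  now exists (N ^ 2).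
Qed.

(** The coefficients of index below [n] vanish by the Cauchy estimates on small circles, all
    other ones have weight at least [omega n], and the sum of squares is at most [M ^ 2]. *)
Lemma A2_bound_vanishing E M Cst n : holo E -> (forall z, Cmod z < 1 -> Cmod (E z) <= M) ->
  (forall z, Cmod z <= 1/2 -> Cmod (E z) <= Cst * Cmod z ^ n) -> A2_bound omega E (M / omega n).
Proof.
  intros HE HM HC. destruct (holo_taylor E HE) as [a Ha]. exists a. split; auto. intros N.
  assert (Hz : forall k, (k < n)%nat -> a k = 0).
  { intros k Hk. apply Cmod_eq_0. apply Rle_antisym; [|apply Cmod_ge_0].
    assert (HCst : 0 <= Cst).
    { specialize (HC (RtoC (1/2)) ltac:(rewrite Cmod_R, Rabs_pos_eq; lra)).
      rewrite Cmod_R, Rabs_pos_eq in HC by lra.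
      pose proof (Cmod_ge_0 (E (RtoC (1/2)))). pose proof (pow_lt (1/2) n ltac:(lra)). nra. }
    assert (Hr : forall r, 0 < r <= 1/2 -> Cmod (a k) <= Cst * r).
    { intros r Hr. pose proof (pow_lt r k (proj1 Hr)). apply (Rmult_le_reg_r (r ^ k)); auto.
      eapply Rle_trans. apply (coef_bound 1 a E r (Cst * r ^ n)). auto. lra. intros z Hz.
      rewrite <- Hz. apply HC. lra.
      rewrite Rmult_assoc. apply Rmult_le_compat_l; auto. change (r * r ^ k) with (r ^ S k).
      replace n with (S k + (n - S k))%nat by lia. rewrite pow_add.
      rewrite <- (Rmult_1_r (r ^ S k)) at 2.
      apply Rmult_le_compat_l. apply pow_le; lra. rewrite <- (pow1 (n - S k)). apply pow_incr; lra.
      }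
    apply le_epsilon. intros eps He. set (r := Rmin (1/2) (eps / (Cst + 1))).
    assert (0 < r <= 1/2). { split. apply Rmin_pos. lra. apply Rdiv_lt_0_compat; lra. apply Rmin_l.
    }
    specialize (Hr r H). assert (r <= eps / (Cst + 1)) by apply Rmin_r.
    apply (Rmult_le_compat_r (Cst + 1)) in H0; [|lra]. unfold Rdiv in H0.
    rewrite Rmult_assoc, Rinv_l in H0 by lra. nra. }
  pose proof (omega_pos n) as Hn.
  apply Rle_trans with (sum_n (fun k => / omega n ^ 2 * Cmod (a k) ^ 2) N).
  - apply sum_n_le_R. intros k _. destruct (Nat.lt_ge_cases k n) as [Hk|Hk].
    + rewrite (Hz k Hk), Cmod_0. right. field. split; apply Rgt_not_eq; apply omega_pos.
    + unfold Rdiv. rewrite Rmult_comm. apply Rmult_le_compat_r. apply pow2_ge_0.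
      apply Rinv_le_contravar. nra. apply pow_incr. split. lra. now apply omega_mono.
  - rewrite sum_n_scal_R. replace ((M / omega n) ^ 2) with (/ omega n ^ 2 * M ^ 2) by (field; lra).
    apply Rmult_le_compat_l. left; apply Rinv_0_lt_compat; nra. now apply (bounded_holo_l2 a E).
Qed.

Lemma A2_truncate g e : 0 < e -> in_A2 omega g -> exists c n, A2_bound omega (fun z => psum c z n - g z)%C e.
Proof.
  intros He [b [Hb [l Hl]]]. apply taylor_iff in Hb.
  set (u := fun n => Cmod (b n) ^ 2 / omega n ^ 2) in *.
  assert (Hu : forall n, 0 <= u n). { intros n. apply Rle_mult_inv_pos. apply pow2_ge_0.
  apply pow_lt, omega_pos. }
  assert (Hlim : is_lim_seq (sum_n u) l) by exact Hl.
  assert (Hle : forall n, sum_n u n <= l).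
  { intros n. apply (is_lim_seq_incr_compare (sum_n u) l Hlim). intros k. rewrite sum_Sn.
    unfold plus; simpl. specialize (Hu (S k)). lra. }
  assert (He2 : 0 < e ^ 2) by (apply pow_lt; auto).
  destruct (proj2 (is_lim_seq_spec (sum_n u) l) Hlim (mkposreal _ He2)) as [d Hd].
  specialize (Hd d (le_n _)). simpl in Hd.
  exists b, (S d).
  set (a := fun k => if Nat.leb k d then RtoC 0 else (RtoC (-1) * b k)%C).
  exists a. split.
  - intros z Hz.
    assert (E : forall n, psum a z (S d + n) = (psum b z (S d) - psum b z (S d + n))%C).
    { assert (E0 : forall n, (n <= S d)%nat -> psum a z n = 0).
      { induction n; intros Hn; simpl; auto. rewrite IHn by lia. unfold a.
        destruct (Nat.leb_spec n d); [|lia]. ring. }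
      induction n. rewrite Nat.add_0_r, E0 by lia. ring.
      rewrite Nat.add_succ_r.
      change (psum a z (S d + n) + a (S d + n)%nat * z ^ (S d + n) =
        psum b z (S d) - (psum b z (S d + n) + b (S d + n)%nat * z ^ (S d + n)))%C.
      rewrite IHn. unfold a. destruct (Nat.leb_spec (S d + n) d); [lia|]. ring. }
    intros eps Heps. destruct (Hb z Hz eps Heps) as [N HN]. exists (S d + N)%nat. intros n Hn.
    replace n with (S d + (n - S d))%nat by lia. rewrite E.
    replace (psum b z (S d) - psum b z (S d + (n - S d)) - (psum b z (S d) - g z))%C with (- (psum
      b z (S d + (n - S d)) - g z))%C by ring.
    rewrite Cmod_opp. apply HN. lia.
  - assert (Hsum : forall n, sum_n (fun k => Cmod (a k) ^ 2 / omega k ^ 2) n <=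
      Rmax 0 (sum_n u n - sum_n u d)).
    { assert (H0 : forall n, (n <= d)%nat -> sum_n (fun k => Cmod (a k) ^ 2 / omega k ^ 2) n = 0).
      { induction n; intros Hn. rewrite sum_O. unfold a; simpl. rewrite Cmod_0. unfold Rdiv; ring.
        rewrite sum_Sn, IHn by lia. unfold a. destruct (Nat.leb_spec (S n) d); [|lia].
        rewrite Cmod_0. unfold plus; simpl. unfold Rdiv; ring. }
      assert (H1 : forall n, (d <= n)%nat ->
        sum_n (fun k => Cmod (a k) ^ 2 / omega k ^ 2) n = sum_n u n - sum_n u d).
      { intros n Hn. induction Hn. rewrite H0 by lia. symmetry. apply Rminus_diag_eq. reflexivity.
        rewrite !sum_Sn, IHHn.
        assert (E : Cmod (a (S m)) ^ 2 / omega (S m) ^ 2 = u (S m)).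
        { unfold a, u. destruct (Nat.leb_spec (S m) d); [lia|].
          replace (RtoC (-1) * b (S m))%C with (- b (S m))%C by ring. now rewrite Cmod_opp. }
        rewrite E. change (sum_n u m - sum_n u d + u (S m) = sum_n u m + u (S m) - sum_n u d). lra.
        }
      intros n. destruct (Nat.le_gt_cases n d). rewrite H0 by auto. apply Rmax_l. rewrite H1 by lia.
      apply Rmax_r. }
    intros n. eapply Rle_trans; [apply Hsum|]. apply Rmax_lub. lra. specialize (Hle n).
    apply Rabs_def2 in Hd. simpl. lra.
Qed.
End Weighted.

(** * Polynomials *)

Lemma is_polynomial_iff p : is_polynomial p <-> exists c n, forall z, p z = psum c z n.
Proof.
  assert (E : forall c z d, sum_n (fun k : nat => (c k * z ^ k)%C) d = psum c z (S d)).
  { intros c z d. induction d. rewrite sum_O. simpl. ring.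
    rewrite sum_Sn, IHd. reflexivity. }
  split.
  - intros [d [c H]]. exists c, (S d). intros z. now rewrite H, E.
  - intros [c [[|n] H]].
    + exists 0%nat, (fun _ => RtoC 0). intros z. rewrite H, E. simpl. ring.
    + exists n, c. intros z. now rewrite H, E.
Qed.

Lemma psum_pad c n m z : (n <= m)%nat -> psum (fun k => if Nat.ltb k n then c k else 0) z m = psum c z n.
Proof.
  intros H. induction H.
  - assert (E : forall j, (j <= n)%nat -> psum (fun k => if Nat.ltb k n then c k else 0) z j = psum c z j).
    { induction j; intros Hj; simpl; auto. rewrite IHj by lia. destruct (Nat.ltb_spec j n); [|lia].
      reflexivity. }
    now apply E.
  - simpl. rewrite IHle. destruct (Nat.ltb_spec m n); [lia|]. ring.
Qed.

Lemma is_polynomial_ext p q : (forall z, p z = q z) -> is_polynomial p -> is_polynomial q.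
Proof. intros E [d [c H]]. exists d, c. intros z. now rewrite <- E. Qed.

Lemma is_polynomial_plus p q : is_polynomial p -> is_polynomial q -> is_polynomial (fun z => p z + q z)%C.
Proof.
  rewrite !is_polynomial_iff. intros [c [n H]] [d [m H']].
  exists (fun k => (if Nat.ltb k n then c k else 0) + (if Nat.ltb k m then d k else 0))%C, (max n m).
  intros z. rewrite psum_plus, !psum_pad by lia. now rewrite H, H'.
Qed.

Lemma is_polynomial_scal c p : is_polynomial p -> is_polynomial (fun z => c * p z)%C.
Proof.
  rewrite !is_polynomial_iff. intros [a [n H]]. exists (fun k => c * a k)%C, n. intros z.
  now rewrite psum_scal, H.
Qed.

Lemma is_polynomial_zpow p n : is_polynomial p -> is_polynomial (fun z => z ^ n * p z)%C.
Proof.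
  intros Hp. induction n.
  - revert Hp. apply is_polynomial_ext. intros; simpl; ring.
  - apply is_polynomial_iff in IHn. destruct IHn as [a [m H]]. apply is_polynomial_iff.
    exists (shift_coef a), (S m). intros z. rewrite psum_shift, <- H. simpl. ring.
Qed.

Lemma is_polynomial_psum c n : is_polynomial (fun z => psum c z n).
Proof. apply is_polynomial_iff. now exists c, n. Qed.

Lemma is_polynomial_mult p q : is_polynomial p -> is_polynomial q -> is_polynomial (fun z => p z * q z)%C.
Proof.
  intros Hp Hq. apply is_polynomial_iff in Hp. destruct Hp as [c [n H]].
  apply (is_polynomial_ext (fun z => psum c z n * q z)%C). intros z. now rewrite H. clear H.
  induction n.
  - apply (is_polynomial_ext (fun z => RtoC 0 * q z)%C). intros; reflexivity.
    now apply is_polynomial_scal.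
  - apply (is_polynomial_ext (fun z => psum c z n * q z + c n * (z ^ n * q z))%C).
    intros; simpl; ring.
    apply is_polynomial_plus; auto. now apply is_polynomial_scal, is_polynomial_zpow.
Qed.

Lemma holo_polynomial p : is_polynomial p -> holo p.
Proof.
  rewrite is_polynomial_iff. intros [c [n H]]. destruct (holo_psum c n) as [f' [H1 H2]]. exists f'.
  split; auto.
  intros z Hz. apply (Cder_local (fun z => psum c z n)) with (r := 1). lra. intros; now rewrite H.
  auto.
Qed.

(** * Inverting a fractional power of the function modulo a power of z *)

Lemma exp_le x y : x <= y -> exp x <= exp y.
Proof. intros [H | ->]. left; now apply exp_increasing. apply Rle_refl. Qed.

Lemma exp_lower x : 0 <= x <= 1/2 -> exp (- (2 * x)) <= 1 - x.
Proof.
  intros Hx. rewrite exp_Ropp. assert (H := exp_ineq1_le (2 * x)).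
  apply Rle_trans with (/ (1 + 2 * x)). apply Rinv_le_contravar; lra.
  apply (Rmult_le_reg_r (1 + 2 * x)). lra. rewrite Rinv_l by lra. nra.
Qed.

Lemma exp_INR n x : exp x ^ n = exp (INR n * x).
Proof. induction n. simpl. rewrite Rmult_0_l, exp_0; auto. rewrite S_INR. simpl.
rewrite IHn, <- exp_plus. f_equal. ring. Qed.

(** The Taylor polynomial of [exp (- t G)] of degree below [n]. Cauchy's estimate on the circle
    of radius [1 - x], with [x = lam / n], costs [exp (2 lam)] for the factor [(1 - x) ^ (- n)]
    and [exp lam] for the supremum of [exp (- t G)] there. *)
Lemma polynomial_inverse_mod_zn G kappa t lam n : holo G -> 0 < kappa ->
  (forall z, Cmod z < 1 -> Re (G z) <= 0) ->
  (forall z, Cmod z < 1 -> - Re (G z) <= kappa / (1 - Cmod z)) ->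
  (1 <= n)%nat -> 0 < lam -> 2 * lam <= INR n -> 0 <= t -> t * kappa * INR n <= lam ^ 2 ->
  exists h, is_polynomial h /\
   (forall z, Cmod z < 1 -> Cmod (cexp (t * G z) * h z)%C <= INR n * exp (3 * lam)) /\
   exists K, forall z, Cmod z <= 1/2 -> Cmod (cexp (t * G z) * h z - 1)%C <= K * Cmod z ^ n.
Proof.
  intros HG Hk Hneg Hlow Hn Hlam Hln Ht Htk.
  set (F := fun z => cexp (RtoC (- t) * G z)).
  assert (HF : holo F). { apply holo_cexp. apply holo_mult; auto. apply holo_const. }
  destruct (holo_taylor F HF) as [a Ha].
  assert (HR : forall s z, Re (RtoC s * G z)%C = s * Re (G z)) by (intros; destruct (G z); simpl; ring).
  assert (Hup : forall z, Cmod z < 1 -> Cmod (cexp (t * G z)) <= 1).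
  { intros z Hz. rewrite Cmod_cexp, HR. rewrite <- exp_0. apply exp_le. specialize (Hneg z Hz). nra.
    }
  assert (HINR : 1 <= INR n) by (apply (le_INR 1); auto).
  set (x := lam / INR n).
  assert (Hx : 0 < x <= 1/2). { unfold x. split. apply Rdiv_lt_0_compat; lra.
  apply (Rmult_le_reg_r (INR n)). lra. unfold Rdiv. rewrite Rmult_assoc, Rinv_l; lra. }
  assert (Hcoef : forall k, (k < n)%nat -> Cmod (a k) <= exp (3 * lam)).
  { intros k Hkn. assert (Hc : Cmod (a k) * (1 - x) ^ k <= exp lam).
    { apply (coef_bound 1 a F). auto. lra. intros z Hz. unfold F. rewrite Cmod_cexp, HR.
      apply exp_le.
      specialize (Hlow z ltac:(lra)). rewrite Hz in Hlow.
      replace (1 - (1 - x)) with x in Hlow by ring.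
      apply Rle_trans with (t * (kappa / x)). nra.
      unfold x.
      replace (t * (kappa / (lam / INR n))) with (t * kappa * INR n / lam) by (field; lra).
      apply (Rmult_le_reg_r lam); auto. unfold Rdiv. rewrite Rmult_assoc, Rinv_l by lra.
      simpl in Htk. lra. }
    assert (Hp : exp (- (2 * lam)) <= (1 - x) ^ k).
    { apply Rle_trans with ((1 - x) ^ n).
      - replace (- (2 * lam)) with (INR n * - (2 * x)) by (unfold x; field; lra).
        rewrite <- exp_INR.
        apply pow_incr. split. left; apply exp_pos. apply exp_lower; lra.
      - replace n with (k + (n - k))%nat by lia. rewrite pow_add.
        rewrite <- (Rmult_1_r ((1 - x) ^ k)) at 2.
        apply Rmult_le_compat_l. apply pow_le; lra. apply pow_le_1; lra. }
    pose proof (exp_pos (- (2 * lam))). apply (Rmult_le_reg_r (exp (- (2 * lam)))); auto.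
    rewrite <- exp_plus. replace (3 * lam + - (2 * lam)) with lam by ring.
    eapply Rle_trans; [|exact Hc]. apply Rmult_le_compat_l; auto. apply Cmod_ge_0. }
  exists (fun z => psum a z n). split; [apply is_polynomial_psum|]. split.
  - intros z Hz. rewrite Cmod_mult.
    assert (Hb : forall m, (m <= n)%nat -> Cmod (psum a z m) <= INR m * exp (3 * lam)).
    { induction m; intros Hm. simpl. rewrite Cmod_0. lra.
      rewrite S_INR. simpl psum. eapply Rle_trans; [apply Cmod_triangle|].
      specialize (IHm ltac:(lia)). specialize (Hcoef m ltac:(lia)).
      assert (Cmod (a m * z ^ m)%C <= exp (3 * lam)); [|lra].
      rewrite Cmod_mult, Cmod_pow. assert (Cmod z ^ m <= 1). { rewrite <- (pow1 m). apply pow_incr.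
      split. apply Cmod_ge_0. lra. }
      pose proof (Cmod_ge_0 (a m)). pose proof (pow_le (Cmod z) m (Cmod_ge_0 z)). nra. }
    specialize (Hb n (le_n _)). specialize (Hup z Hz). pose proof (Cmod_ge_0 (cexp (t * G z))).
    pose proof (Cmod_ge_0 (psum a z n)). nra.
  - destruct (expands_geom_bounded 1 a F (3/4) Ha ltac:(lra)) as [M [HM Hg]].
    exists (3 * M * (4/3) ^ n). intros z Hz.
    assert (HT := expands_tail 1 a F (3/4) M z n Ha ltac:(lra) Hg ltac:(lra) ltac:(lra)).
    replace (cexp (t * G z) * psum a z n - 1)%C with (cexp (t * G z) * - (F z - psum a z n))%C.
    2:{ unfold F. replace (RtoC 1) with (cexp (t * G z) * cexp (RtoC (- t) * G z))%C. ring.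
        rewrite <- cexp_add, RtoC_opp. replace (t * G z + - t * G z)%C with (RtoC 0) by ring.
        apply cexp_0. }
    rewrite Cmod_mult, Cmod_opp. specialize (Hup z ltac:(lra)).
    pose proof (Cmod_ge_0 (F z - psum a z n)%C).
    pose proof (Cmod_ge_0 (cexp (t * G z))).
    apply Rle_trans with (Cmod (F z - psum a z n)). nra. eapply Rle_trans; [exact HT|].
    replace (Cmod z / (3 / 4)) with (4/3 * Cmod z) by field. rewrite Rpow_mult_distr.
    set (y := (4/3)^n * Cmod z ^ n). pose proof (Cmod_ge_0 z).
    assert (0 <= y). { unfold y. apply Rmult_le_pos; apply pow_le; lra. }
    replace (3 * M * (4 / 3) ^ n * Cmod z ^ n) with (M * y * 3) by (unfold y; ring).
    apply Rmult_le_compat_l. nra. rewrite <- (Rinv_inv 3). apply Rinv_le_contravar; lra.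
Qed.

(** * Divergence along dyadic scales *)

Section Divergence.
Variable L : nat -> R.
Variable J0 : nat.
Hypothesis L_mono : forall j, L j <= L (S j).

(** The squared increment of [L] between the scales [j] and [j + 1]. An increment below
    [4 (j + 2)] would not absorb the factor [2 ^ (j + 1)] lost in [polynomial_inverse_mod_zn],
    and such a scale is skipped. *)
Definition gain (j : nat) : R :=
  if Rle_dec (4 * (INR j + 2)) (L (S j) - L j) then (L (S j) - L j) ^ 2 / 2 ^ S j else 0.

Fixpoint gains (i : nat) : R := match i with O => 0 | S i => gains i + gain (J0 + i) end.
Fixpoint energy (i : nat) : R := match i with O => 0 | S i => energy i + L (S (J0 + i)) ^ 2 / 2 ^ S
  (J0 + i) end.

Let v (j : nat) : R := (INR j ^ 2 + 6 * INR j + 11) / 2 ^ j.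

(** A discrete Hardy inequality. From [(a + b) ^ 2 <= 3/2 a ^ 2 + 3 b ^ 2] the quantity
    [L j ^ 2 / 2 ^ j] contracts by the factor 3/4 at each scale up to the squared increment;
    skipped increments contribute at most [16 (j + 2) ^ 2 / 2 ^ (j + 1)], which telescopes as
    the difference [v j - v (j + 1)]. *)
Lemma energy_le_gains i :
  energy i <= 12 * gains i + 192 * v J0 + 3 * (L J0 ^ 2 / 2 ^ J0).
Proof.
  assert (H : energy i + 3 * (L (J0 + i) ^ 2 / 2 ^ (J0 + i)) <=
    12 * gains i + 192 * (v J0 - v (J0 + i)) + 3 * (L J0 ^ 2 / 2 ^ J0)).
  { induction i.
    - simpl energy. simpl gains. rewrite Nat.add_0_r. lra.
    - rewrite Nat.add_succ_r. set (j := (J0 + i)%nat) in *.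
      change (energy (S i)) with (energy i + L (S j) ^ 2 / 2 ^ S j).
      change (gains (S i)) with (gains i + gain j).
      assert (Hs : L (S j) ^ 2 / 2 ^ S j <= 3/4 * (L j ^ 2 / 2 ^ j) + 3 * gain j + 48 * (v j - v (S j))).
      { assert (Hp : 0 < 2 ^ j) by (apply pow_lt; lra).
        replace (v j - v (S j)) with ((INR j + 2) ^ 2 / 2 ^ S j) by (unfold v; rewrite S_INR;
          simpl; field; lra).
        set (d := L (S j) - L j) in *.
        assert (Hd : d ^ 2 / 2 ^ S j <= gain j + 16 * ((INR j + 2) ^ 2 / 2 ^ S j)).
        { unfold gain. fold d. assert (0 <= (INR j + 2) ^ 2 / 2 ^ S j). { apply Rle_mult_inv_pos.
          apply pow2_ge_0. apply pow_lt; lra. }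
          destruct (Rle_dec (4 * (INR j + 2)) d). lra. rewrite Rplus_0_l.
          replace (16 * ((INR j + 2) ^ 2 / 2 ^ S j)) with ((4 * (INR j + 2)) ^ 2 / 2 ^ S j) by
            (field; apply pow_nonzero; lra).
          apply Rmult_le_compat_r. left; apply Rinv_0_lt_compat, pow_lt; lra. apply pow_incr.
          specialize (L_mono j). unfold d in *. lra. }
        replace (L (S j)) with (L j + d) by (unfold d; ring).
        assert ((L j + d) ^ 2 / 2 ^ S j <= 3/4 * (L j ^ 2 / 2 ^ j) + 3 * (d ^ 2 / 2 ^ S j)); [|lra].
        replace (3/4 * (L j ^ 2 / 2 ^ j) + 3 * (d ^ 2 / 2 ^ S j)) with ((3/2
          * L j ^ 2 + 3 * d ^ 2) / 2 ^ S j) by (simpl; field; lra).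
        apply Rmult_le_compat_r. left; apply Rinv_0_lt_compat, pow_lt; lra.
        pose proof (pow2_ge_0 (L j - 2 * d)). nra. }
      lra. }
  assert (0 <= L (J0 + i)%nat ^ 2 / 2 ^ (J0 + i)). { apply Rle_mult_inv_pos. apply pow2_ge_0.
  apply pow_lt; lra. }
  assert (0 <= v (J0 + i)). { apply Rle_mult_inv_pos. pose proof (pos_INR (J0 + i)). nra.
  apply pow_lt; lra. }
  lra.
Qed.
End Divergence.

Lemma block_sum (q : nat -> R) m p b : (1 <= m)%nat -> (forall n, (m < n <= m + p)%nat -> q n <= b) ->
  sum_n_m q 1 (m + p) <= sum_n_m q 1 m + INR p * b.
Proof.
  intros Hm. induction p; intros H. rewrite Nat.add_0_r. simpl. lra.
  rewrite Nat.add_succ_r, sum_n_Sm, S_INR by lia. specialize (IHp ltac:(intros; apply H; lia)).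
  specialize (H (S (m + p)) ltac:(lia)). unfold plus; simpl. simpl in IHp. lra.
Qed.

Lemma INR_pow2 j : INR (2 ^ j) = 2 ^ j.
Proof. induction j; simpl; auto. rewrite !plus_INR, IHj. simpl. ring. Qed.

Lemma pow2_ge_1 j : (1 <= 2 ^ j)%nat.
Proof. induction j; simpl; lia. Qed.

(** Cauchy condensation over the blocks from [2 ^ j + 1] to [2 ^ (j + 1)]; the block starts
    after [2 ^ j] so that the weight at its last index is the dyadic one. The hypothesis at [J0]
    makes the logarithms nonnegative, without which their squares would not be monotone. *)
Lemma dyadic_sum (omega : nat -> R) J0 i :
  (forall n, 0 < omega n) -> (forall m n, (m <= n)%nat -> omega m <= omega n) -> 1 <= omega (2 ^ J0)%nat ->
  sum_n_m (fun n => ln (omega n) ^ 2 / INR n ^ 2) 1 (2 ^ (J0 + i)) <=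
  sum_n_m (fun n => ln (omega n) ^ 2 / INR n ^ 2) 1 (2 ^ J0) + 2 * energy (fun j => ln (omega (2 ^
    j)%nat)) J0 i.
Proof.
  intros Hpos Hmono H1. set (q := fun n => ln (omega n) ^ 2 / INR n ^ 2). induction i.
  - rewrite Nat.add_0_r. simpl energy. lra.
  - rewrite Nat.add_succ_r. set (j := (J0 + i)%nat) in *.
    change (energy (fun j => ln (omega (2 ^ j)%nat)) J0 (S i)) with (energy (fun j => ln (omega (2
      ^ j)%nat)) J0 i + ln (omega (2 ^ S j)%nat) ^ 2 / 2 ^ S j).
    assert (Hj : (2 ^ J0 <= 2 ^ j)%nat) by (apply Nat.pow_le_mono_r; lia).
    assert (Hb : sum_n_m q 1 (2 ^ j + 2 ^ j) <= sum_n_m q 1 (2 ^ j) + INR (2 ^ j) * (ln (omega (2 ^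
      S j)%nat) ^ 2 / (2 ^ j) ^ 2)).
    { apply block_sum. apply pow2_ge_1. intros n Hn. unfold q.
      assert (Hp : 0 < 2 ^ j) by (apply pow_lt; lra).
      assert (Hln : 0 <= ln (omega n) <= ln (omega (2 ^ S j)%nat)).
      { split. rewrite <- ln_1. apply ln_le. lra. eapply Rle_trans; [exact H1|]. apply Hmono. lia.
        apply ln_le. apply Hpos. apply Hmono. simpl. lia. }
      assert (Hn' : 2 ^ j <= INR n) by (rewrite <- INR_pow2; apply le_INR; lia).
      apply Rmult_le_compat. apply pow2_ge_0. left; apply Rinv_0_lt_compat; nra.
      apply pow_incr; lra.
      apply Rinv_le_contravar. nra. apply pow_incr; lra. }
    replace (2 ^ S j)%nat with (2 ^ j + 2 ^ j)%nat at 1 by (simpl; lia).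
    rewrite INR_pow2 in Hb.
    replace (2 ^ j * (ln (omega (2 ^ S j)%nat) ^ 2 / (2 ^ j) ^ 2)) with (2 * (ln (omega (2 ^ S
      j)%nat) ^ 2 / 2 ^ S j)) in Hb by (change (2 ^ S j)%R with (2 * 2 ^ j)%R; field; apply pow_nonzero; lra).
    lra.
Qed.

(** * The product over the dyadic scales *)

Lemma exp_1_ge_2 : 2 <= exp 1.
Proof. pose proof (exp_ineq1_le 1). lra. Qed.

Lemma pow2_le_exp k : 2 ^ k <= exp (INR k).
Proof.
  replace (INR k) with (INR k * 1) by ring. rewrite <- exp_INR. apply pow_incr.
  pose proof exp_1_ge_2. lra.
Qed.

Lemma exp_neg_INR_le k : exp (- INR k) <= (1/2) ^ k.
Proof.
  rewrite exp_Ropp. replace ((1/2)^k) with (/ 2 ^ k) by (rewrite <- pow_inv; f_equal; lra).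
  apply Rinv_le_contravar. apply pow_lt; lra. apply pow2_le_exp.
Qed.

Lemma A2_bound_zero omega e : A2_bound omega (fun _ => RtoC 0) e.
Proof.
  exists (fun _ => RtoC 0). split.
  - intros z _ eps He. exists 0%nat. intros n _. replace (psum (fun _ => RtoC 0) z n) with (RtoC 0).
    replace (0 - 0)%C with (RtoC 0) by ring. now rewrite Cmod_0. induction n; simpl; auto.
    rewrite <- IHn. ring.
  - intros n. replace (sum_n _ n) with 0. apply pow2_ge_0. induction n.
    rewrite sum_O, Cmod_0. unfold Rdiv. simpl. ring. rewrite sum_Sn, <- IHn, Cmod_0.
    unfold plus; simpl. unfold Rdiv. ring.
Qed.

Section Product.
Variable omega : nat -> R.
Hypothesis omega_pos : forall n, 0 < omega n.
Hypothesis omega_mono : forall m n, (m <= n)%nat -> omega m <= omega n.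
Let L (j : nat) : R := ln (omega (2 ^ j)%nat).
Variables (J0 : nat) (G : C -> C) (kappa tau : R).
Hypothesis L_J0 : 0 <= L J0.
Hypothesis L_le : forall j, (J0 <= j)%nat -> L j <= 2 ^ j.
Hypothesis HG : holo G.
Hypothesis kappa_pos : 0 < kappa.
Hypothesis G_neg : forall z, Cmod z < 1 -> Re (G z) <= 0.
Hypothesis G_low : forall z, Cmod z < 1 -> - Re (G z) <= kappa / (1 - Cmod z).
Hypothesis tau_pos : 0 <= tau.
Hypothesis tau_le : tau * (144 * kappa) <= 1.

Let L_mono j k : (j <= k)%nat -> L j <= L k.
Proof. intros H. apply ln_le. apply omega_pos. apply omega_mono. apply Nat.pow_le_mono_r; lia. Qed.

(** If [P] inverts the power collected so far up to an error [A] and the next scale gives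
    [exp (t G) h = 1 + E], then the new error is [A + exp (T G) P E], where [T] is the power
    collected so far. The second term vanishes to order [2 ^ j] and is bounded by
    [exp ((L j - L J0) / 2)], so its norm is at most [exp (- (L j + L J0) / 2)]; on the scales
    that are kept [L j] exceeds [4 j], and these errors are dominated by a geometric series. *)
Lemma approximate_inverse i : exists P, is_polynomial P /\
  (forall z, Cmod z < 1 -> Cmod (cexp (RtoC (tau * gains L J0 i) * G z) * P z)%C <=
    exp ((L (J0 + i) - L J0) / 2)) /\
  A2_bound omega (fun z => cexp (RtoC (tau * gains L J0 i) * G z) * P z - 1)%C (exp (- L J0 / 2) *
    (2 - (1/2) ^ i)).
Proof.
  induction i as [|i [P [HP [Hbd Hsm]]]].
  - exists (fun _ => RtoC 1). split; [|split].
    + exists 0%nat, (fun _ => RtoC 1). intros z. rewrite sum_O. simpl. ring.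
    + intros z Hz. rewrite Nat.add_0_r. simpl gains.
      replace (RtoC (tau * 0) * G z)%C with (RtoC 0) by (rewrite Rmult_0_r; ring).
      rewrite cexp_0. replace ((L J0 - L J0) / 2) with 0 by lra. rewrite exp_0, Cmult_1_r, Cmod_1.
      lra.
    + apply (A2_bound_ext _ (fun _ => RtoC 0)). 2: apply A2_bound_zero.
      intros z _. simpl gains.
      replace (RtoC (tau * 0) * G z)%C with (RtoC 0) by (rewrite Rmult_0_r; ring). rewrite cexp_0.
      ring.
  - set (j := (J0 + i)%nat) in *. rewrite Nat.add_succ_r. fold j.
    change (gains L J0 (S i)) with (gains L J0 i + gain L j).
    assert (Hpw : 0 < (1/2) ^ i) by (apply pow_lt; lra).
    assert (Hpw1 : (1/2) ^ i <= 1) by (apply pow_le_1; lra).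
    pose proof (exp_pos (- L J0 / 2)) as He0.
    unfold gain. set (d := L (S j) - L j).
    assert (Hd0 : 0 <= d) by (unfold d; pose proof (L_mono j (S j) ltac:(lia)); lra).
    destruct (Rle_dec (4 * (INR j + 2)) d) as [Hd|Hd].
    + assert (Hj0 : 0 <= INR j) by apply pos_INR.
      assert (HLj : 0 <= L j) by (pose proof (L_mono J0 j ltac:(unfold j; lia)); lra).
      assert (Hp2 : 0 < 2 ^ S j) by (apply pow_lt; lra).
      set (t := tau * (d ^ 2 / 2 ^ S j)).
      assert (Ht : 0 <= t). { apply Rmult_le_pos; auto. apply Rle_mult_inv_pos; auto.
      apply pow2_ge_0. }
      destruct (polynomial_inverse_mod_zn G kappa t (d / 12) (2 ^ S j)%nat) as [h [Hh [Hh1 [K HK]]]]; auto.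
      { apply pow2_ge_1. } { lra. }
      { rewrite INR_pow2. pose proof (L_le (S j) ltac:(unfold j; lia)). unfold d in *. lra. }
      { rewrite INR_pow2. unfold t.
        replace (tau * (d ^ 2 / 2 ^ S j) * kappa * 2 ^ S j) with (tau * (144 * kappa) * (d / 12) ^
          2) by (field; lra).
        pose proof (pow2_ge_0 (d / 12)). nra. }
      rewrite INR_pow2 in Hh1. replace (3 * (d / 12)) with (d / 4) in Hh1 by field.
      (* the left side is at most 2 ^ (j + 2) * exp (d / 4), and j + 2 <= d / 4 *)
      assert (Hexp : 1 + 2 ^ S j * exp (d / 4) <= exp (d / 2)).
      { assert (1 <= 2 ^ S j) by (apply pow_R1_Rle; lra).
        assert (1 <= exp (d / 4)) by (rewrite <- exp_0; apply exp_le; lra).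
        apply Rle_trans with (2 ^ S (S j) * exp (d / 4)). change (2 ^ S (S j)) with (2 * 2 ^ S j).
        nra.
        apply Rle_trans with (exp (INR (S (S j))) * exp (d / 4)).
        apply Rmult_le_compat_r. left; apply exp_pos. apply pow2_le_exp.
        rewrite <- exp_plus. apply exp_le. rewrite !S_INR. lra. }
      assert (Hsplit : forall z, cexp (RtoC (tau * (gains L J0 i + d ^ 2 / 2 ^ S j)) * G z) =
        (cexp (RtoC (tau * gains L J0 i) * G z) * cexp (t * G z))%C).
      { intros z. rewrite <- cexp_add. f_equal. unfold t. rewrite Rmult_plus_distr_l, RtoC_plus.
        ring. }
      assert (Hexp2 : exp ((L j - L J0) / 2) * exp (d / 2) = exp ((L (S j) - L J0) / 2)).
      { rewrite <- exp_plus. f_equal. unfold d. lra. }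
      assert (Hhol : forall s, holo (fun z => cexp (RtoC s * G z))). { intros s.
      apply holo_cexp, holo_mult; auto. apply holo_const. }
      exists (fun z => P z * h z)%C. split; [now apply is_polynomial_mult|split].
      * intros z Hz. rewrite Hsplit.
        replace (cexp (RtoC (tau * gains L J0 i) * G z) * cexp (t * G z) * (P z * h z))%C with
          ((cexp (RtoC (tau * gains L J0 i) * G z) * P z) * (cexp (t * G z) * h z))%C by ring.
        rewrite Cmod_mult, <- Hexp2. apply Rmult_le_compat; auto; try apply Cmod_ge_0.
        eapply Rle_trans; [apply Hh1; auto|]. lra.
      * apply (A2_bound_ext _ (fun z => (cexp (RtoC (tau * gains L J0 i) * G z) * P z - 1) + (cexp
          (RtoC (tau * gains L J0 i) * G z) * P z) * (cexp (t * G z) * h z - 1))%C).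
        { intros z _. rewrite Hsplit. ring. }
        replace (exp (- L J0 / 2) * (2 - (1/2) ^ S i)) with (exp (- L J0 / 2) * (2 - (1/2) ^ i) +
          exp (- L J0 / 2) * (1/2) ^ S i) by (simpl; field).
        apply A2_bound_plus; auto. nra. apply Rmult_lt_0_compat; auto. apply pow_lt; lra.
        apply (A2_bound_le _ _ (exp ((L (S j) - L J0) / 2) / omega (2 ^ S j)%nat)).
        { split. apply Rle_mult_inv_pos. left; apply exp_pos. apply omega_pos.
          replace (omega (2 ^ S j)%nat) with (exp (L (S j))) by (unfold L; now rewrite exp_ln).
          unfold Rdiv. rewrite <- exp_Ropp, <- exp_plus.
          apply Rle_trans with (exp (- L J0 / 2) * exp (- INR (S i))).
          rewrite <- exp_plus. apply exp_le. assert (INR (S i) <= INR j + 1).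
          { rewrite S_INR. apply Rplus_le_compat_r. apply le_INR. unfold j; lia. }
          unfold d in *. lra. apply Rmult_le_compat_l. lra. apply exp_neg_INR_le. }
        apply (A2_bound_vanishing omega omega_pos omega_mono _ _ (exp ((L j - L J0) / 2) * K)).
        -- apply holo_mult. apply holo_mult. apply Hhol. now apply holo_polynomial.
           apply holo_minus. apply holo_mult. apply Hhol. now apply holo_polynomial.
           apply holo_const.
        -- intros z Hz. rewrite Cmod_mult, <- Hexp2.
           apply Rmult_le_compat; auto; try apply Cmod_ge_0.
           eapply Rle_trans; [apply Cmod_triangle_minus|]. rewrite Cmod_1. specialize (Hh1 z Hz).
           lra.
        -- intros z Hz. rewrite Cmod_mult, Rmult_assoc.
           apply Rmult_le_compat; auto; try apply Cmod_ge_0. apply Hbd. lra.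
    + exists P. split; auto. rewrite Rplus_0_r. split.
      * intros z Hz. eapply Rle_trans; [apply Hbd; auto|]. apply exp_le. unfold d in Hd0. lra.
      * revert Hsm. apply A2_bound_le. simpl. nra.
Qed.
End Product.

(** * Cyclicity *)

Section Cyclic.
Variable omega : nat -> R.
Hypothesis homega : weight_sequence omega.
Hypothesis hdiv :
  is_lim_seq (fun N : nat => sum_n_m (fun n : nat => (ln (omega n)) ^ 2 / (INR n) ^ 2) 1 N) p_infty.

Let omega_pos : forall n, 0 < omega n := proj1 homega.
Let omega_mono : forall m n, (m <= n)%nat -> omega m <= omega n := proj1 (proj2 homega).
Let L (j : nat) : R := ln (omega (2 ^ j)%nat).

Let INR_le_pow2 j : (j <= 2 ^ j)%nat.
Proof. pose proof (Nat.pow_gt_lin_r 2 j). lia. Qed.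

Let L_large B : exists J, forall j, (J <= j)%nat -> B <= L j /\ L j <= 2 ^ j.
Proof.
  assert (Hw := homega). destruct Hw as [_ [_ [Hinf Ho]]].
  destruct (proj2 (is_lim_seq_spec omega p_infty) Hinf (exp B)) as [N1 H1].
  destruct (proj2 (is_lim_seq_spec _ 0) Ho (mkposreal 1 Rlt_0_1)) as [N2 H2].
  exists (max N1 N2). intros j Hj. pose proof (INR_le_pow2 j). split.
  - rewrite <- (ln_exp B). apply ln_le. apply exp_pos. left. apply H1. lia.
  - specialize (H2 (2 ^ j)%nat ltac:(lia)). simpl in H2. rewrite Rminus_0_r in H2.
    apply Rabs_def2 in H2. destruct H2 as [H2 _].
    rewrite INR_pow2 in H2. assert (0 < 2 ^ j) by (apply pow_lt; lra).
    apply (Rmult_lt_compat_r (2 ^ j)) in H2; auto. unfold Rdiv in H2.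
    rewrite Rmult_assoc, Rinv_l in H2 by lra. unfold L. lra.
Qed.

Let gains_unbounded J0 B : 0 <= L J0 -> exists i, B <= gains L J0 i.
Proof.
  intros HL. set (q := fun n : nat => (ln (omega n)) ^ 2 / (INR n) ^ 2) in *.
  set (X := sum_n_m q 1 (2 ^ J0) + 2 * (12 * B + 192 * ((INR J0 ^ 2 + 6 * INR J0 + 11) / 2 ^ J0) +
    3 * (L J0 ^ 2 / 2 ^ J0))).
  destruct (proj2 (is_lim_seq_spec _ p_infty) hdiv X) as [N HN].
  exists N. specialize (HN (2 ^ (J0 + N))%nat). pose proof (INR_le_pow2 (J0 + N)).
  specialize (HN ltac:(lia)).
  assert (H1 : 1 <= omega (2 ^ J0)%nat).
  { rewrite <- exp_0. rewrite <- (exp_ln (omega (2 ^ J0)%nat)) by apply omega_pos. now apply exp_le.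
    }
  assert (HD := dyadic_sum omega J0 N omega_pos omega_mono H1). fold q in HD.
  assert (HE := energy_le_gains L J0 ltac:(intros j; apply ln_le; [apply omega_pos|apply
    omega_mono; apply Nat.pow_le_mono_r; lia]) N).
  change (fun j => ln (omega (2 ^ j)%nat)) with L in HD. fold q in HN. unfold X in HN. lra.
Qed.

(** [J0] is chosen first, to make the total error small; then enough scales are used for the
    available power to exceed 1, and the factor [tau] brings it down to 1 exactly. *)
Lemma approximates_one f x0 : holo f -> (forall z, Cmod z < 1 -> f z <> 0) ->
  (forall z, Cmod z < 1 -> Cmod (f z) <= 1) ->
  0 < x0 -> f 0 = x0 -> forall eps, 0 < eps ->
    exists P, is_polynomial P /\ A2_bound omega (fun z => P z * f z - 1)%C eps.
Proof.
  intros Hf Hn Hb Hx0 Hf0 eps He.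
  destruct (holo_log f x0 Hf Hn Hx0 Hf0) as [g [G [HGs [Hg0 HfG]]]].
  assert (Hx1 : x0 <= 1). { specialize (Hb 0 ltac:(rewrite Cmod_0; lra)).
  rewrite Hf0, Cmod_R, Rabs_pos_eq in Hb; lra. }
  assert (HG : holo G) by now apply (expands_holo g).
  assert (Hneg : forall z, Cmod z < 1 -> Re (G z) <= 0).
  { intros z Hz. specialize (Hb z Hz). rewrite (HfG z Hz), Cmod_cexp in Hb.
    destruct (Rle_lt_dec (Re (G z)) 0); auto. apply exp_increasing in r. rewrite exp_0 in r. lra. }
  assert (Hln : ln x0 <= 0) by (rewrite <- ln_1; now apply ln_le).
  set (kappa := -2 * ln x0 + 1).
  assert (Hlow : forall z, Cmod z < 1 -> - Re (G z) <= kappa / (1 - Cmod z)).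
  { intros z Hz. eapply Rle_trans. apply (harnack_lower_bound g G HGs Hneg); auto. now rewrite Hg0.
    rewrite Hg0. simpl Re. apply Rmult_le_compat_r. left; apply Rinv_0_lt_compat; lra.
    unfold kappa; lra. }
  destruct (L_large (Rmax 0 (2 * - ln (eps / 2)))) as [J0 HJ0].
  assert (HLJ := HJ0 J0 (le_n _)). destruct HLJ as [HLJ _].
  assert (HL0 : 0 <= L J0) by (eapply Rle_trans; [apply Rmax_l|exact HLJ]).
  assert (HL1 : 2 * - ln (eps / 2) <= L J0) by (eapply Rle_trans; [apply Rmax_r|exact HLJ]).
  assert (Hk : 0 < kappa) by (unfold kappa; lra).
  destruct (gains_unbounded J0 (144 * kappa) HL0) as [i Hi].
  set (U := gains L J0 i) in *.
  assert (HU : 0 < U) by lra.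
  destruct (approximate_inverse omega omega_pos omega_mono J0 G kappa (/ U) HL0 (fun j Hj => proj2
    (HJ0 j Hj)) HG Hk Hneg Hlow) with (i := i) as [P [HP [_ HS]]].
  - left; now apply Rinv_0_lt_compat.
  - apply (Rmult_le_reg_l U); auto. rewrite <- Rmult_assoc, Rinv_r by lra. lra.
  - exists P. split; auto.
    apply (A2_bound_ext _ (fun z => cexp (RtoC (/ U * U) * G z) * P z - 1)%C).
    { intros z Hz. rewrite Rinv_l by lra. rewrite (HfG z Hz).
      replace (RtoC 1 * G z)%C with (G z) by ring. ring. }
    revert HS. apply A2_bound_le. pose proof (exp_pos (- L J0 / 2)).
    assert (0 < (1/2)^i) by (apply pow_lt; lra). assert ((1/2)^i <= 1) by (apply pow_le_1; lra).
    change (ln (omega (2 ^ J0)%nat)) with (L J0). split. nra.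
    apply Rle_trans with (exp (- L J0 / 2) * 2). nra.
    assert (exp (- L J0 / 2) <= eps / 2); [|lra]. rewrite <- (exp_ln (eps / 2)) by lra.
    apply exp_le. lra.
Qed.

(** If [P * f] is close to 1 and the polynomial [q] is close to [g], then [q * P * f - g] is
    [q * (P * f - 1)] plus [q - g]; [q] is fixed before [P]. *)
Lemma cyclic_of_divergence f : in_Hinf f -> (forall z, disk z -> f z <> RtoC 0) -> cyclic_in_A2 omega f.
Proof.
  intros [Han [M0 HM0]] Hn. assert (Hf := analytic_holo f Han).
  assert (HD0 : Cmod 0 < 1) by (rewrite Cmod_0; lra).
  set (m := Cmod (f 0)). assert (Hm : 0 < m) by (apply Cmod_gt_0; now apply Hn).
  assert (HmM : m <= M0) by now apply HM0.
  assert (HfS : A2_bound omega f (M0 / omega 0%nat)).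
  { apply (A2_bound_vanishing omega omega_pos omega_mono f M0 M0 0 Hf HM0). intros z Hz. simpl.
    rewrite Rmult_1_r. apply HM0. unfold disk; lra. }
  assert (He0 : 0 < M0 / omega 0%nat) by (apply Rdiv_lt_0_compat; [lra|apply omega_pos]).
  split. apply (A2_bound_in_A2 omega omega_pos f (M0 / omega 0%nat)); auto. lra.
  split.
  - intros h [p [Hp Hh]]. apply is_polynomial_iff in Hp. destruct Hp as [c [n Hc]].
    destruct (A2_bound_psum omega omega_pos omega_mono c n) as [K [HK HKs]].
    apply (A2_bound_in_A2 omega omega_pos h (K * (M0 / omega 0%nat))).
    left; now apply Rmult_lt_0_compat.
    apply (A2_bound_ext _ (fun z => psum c z n * f z)%C). intros z Hz. rewrite Hh, Hc; auto.
    now apply HKs.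
  - intros g Hg eps Heps.
    destruct (A2_truncate omega omega_pos g (eps / 4) ltac:(lra) Hg) as [c [n Hc]].
    destruct (A2_bound_psum omega omega_pos omega_mono c n) as [K [HK HKs]].
    (* normalise f to a contraction that is positive at the origin *)
    set (u := (Cconj (f 0) / RtoC (m * M0))%C).
    assert (HmM0 : RtoC (m * M0) <> 0). { intros Q; apply RtoC_inj in Q. nra. }
    assert (Hu : Cmod u = / M0).
    { unfold u. rewrite Cmod_div, Cmod_conj, Cmod_R by auto. fold m. rewrite Rabs_pos_eq by nra.
      field. lra. }
    assert (Hu0 : u <> 0). { apply Cmod_gt_0. rewrite Hu. apply Rinv_0_lt_compat; lra. }
    destruct (approximates_one (fun z => u * f z)%C (m / M0)) with (eps := eps / (4 * K)) as [P [HP HPs]].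
    + apply holo_mult; auto. apply holo_const.
    + intros z Hz. apply Cmult_neq_0; auto.
    + intros z Hz. rewrite Cmod_mult, Hu. apply (Rmult_le_reg_l M0). lra.
      rewrite <- Rmult_assoc, Rinv_r by lra. specialize (HM0 z Hz). lra.
    + apply Rdiv_lt_0_compat; lra.
    + unfold u.
      replace (Cconj (f 0) / RtoC (m * M0) * f 0)%C with ((f 0 * Cconj (f 0)) / RtoC (m * M0))%C by
        (field; auto).
      rewrite <- Cmod2_conj. fold m. rewrite <- RtoC_div by nra. f_equal. field. lra.
    + apply Rdiv_lt_0_compat; lra.
    + exists (fun z => (psum c z n * (u * P z)) * f z)%C. split.
      * exists (fun z => psum c z n * (u * P z))%C. split; auto.
        apply is_polynomial_mult. apply is_polynomial_psum. now apply is_polynomial_scal.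
      * destruct (A2_bound_norm omega omega_pos (fun z => psum c z n * (u * P z) * f z - g z)%C
          (eps / 2) ltac:(lra)) as [N [HN HNe]].
        apply (A2_bound_ext _ (fun z => psum c z n * (P z * (u * f z) - 1) + (psum c z n - g z))%C).
        intros; ring.
        replace (eps / 2) with (K * (eps / (4 * K)) + eps / 4) by (field; lra).
        apply (A2_bound_plus omega omega_pos). apply Rmult_lt_0_compat; auto.
        apply Rdiv_lt_0_compat; lra. lra.
        apply HKs; auto. apply Rdiv_lt_0_compat; lra. exact Hc.
        exists N. split; auto. lra.
Qed.
End Cyclic.

Theorem theorem1 (omega : nat -> R)
  (homega : weight_sequence omega)
  (hdiv : is_lim_seq
            (fun N : nat =>
               sum_n_m (fun n : nat => (ln (omega n)) ^ 2 / (INR n) ^ 2) 1 N)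
            p_infty) :
  forall f : C -> C,
    in_Hinf f ->
    (forall z : C, disk z -> f z <> RtoC 0) ->
    cyclic_in_A2 omega f.
Proof. exact (cyclic_of_divergence omega homega hdiv). Qed.
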